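(* For every $n\ge 1$, there exists a countable $\omega$-categorical structure $\mathbb{D}$ with a finite relational signature such that $\mathrm{CSP}(\mathbb{D})$ is $\Sigma_{2n}^{\mathrm{P}}$-complete, and there exists a countable $\omega$-categorical structure $\mathbb{D}'$ with a finite relational signature such that $\mathrm{CSP}(\mathbb{D}')$ is $\Pi_{2n+1}^{\mathrm{P}}$-complete.
   Context: A countable structure is $\omega$-categorical if for every $k\ge1$ only finitely many $k$-ary relations are first-order definable (without parameters) in it. For a structure $\mathbb{D}$ with finite relational signature $\sigma$, $\mathrm{CSP}(\mathbb{D})$ is the decision problem of whether a given finite $\sigma$-structure admits a homomorphism to $\mathbb{D}$. $\Sigma_k^{\mathrm{P}}$ and $\Pi_k^{\mathrm{P}}$ denote the levels of the polynomial hierarchy; completeness is with respect to polynomial-time reductions. *)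

(* Defs.v *)
From mathcomp Require Import all_boot all_algebra.
From mathcomp Require Import boolp classical_sets functions cardinality.

Set Implicit Arguments.
Unset Strict Implicit.
Unset Printing Implicit Defensive.

Local Open Scope classical_set_scope.

Record signature := Signature { symbol : finType; arity : symbol -> nat }.

Definition structure (sg : signature) (D : Type) :=
  forall R : symbol sg, set ((arity R).-tuple D).

(* Well-scoped de Bruijn syntax: the free variables of [phi : formula sg k] are
   among 0, ..., k-1, and [FEx] binds variable 0 of its argument. *)
Inductive formula (sg : signature) : nat -> Type :=
| FEq k of 'I_k & 'I_k : formula sg k
| FRel k (R : symbol sg) of (arity R).-tuple 'I_k : formula sg k
| FNot k of formula sg k : formula sg k
| FAnd k of formula sg k & formula sg k : formula sg k
| FEx k of formula sg k.+1 : formula sg k.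

Fixpoint sat sg (D : Type) (I : structure sg D) k (phi : formula sg k) :
    k.-tuple D -> Prop :=
  match phi in formula _ k return k.-tuple D -> Prop with
  | FEq _ i j => fun v => tnth v i = tnth v j
  | FRel _ R t => fun v => I R [tuple of map (tnth v) t]
  | FNot _ f => fun v => ~ sat I f v
  | FAnd _ f g => fun v => sat I f v /\ sat I g v
  | FEx _ f => fun v => exists d : D, sat I f [tuple of d :: v]
  end.

Definition definable sg (D : Type) (I : structure sg D) k (X : set (k.-tuple D)) :=
  exists phi : formula sg k, X = [set v | sat I phi v].

Definition omega_categorical sg (D : Type) (I : structure sg D) :=
  forall k, 1 <= k -> finite_set [set X : set (k.-tuple D) | definable I X].

(* Single-tape deterministic Turing machines with input alphabet [A], auxiliary
   tape symbols [aux] and a two-way infinite tape; [None] is the blank.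
   The machine halts when [delta] returns [None]. *)
Inductive move := MLeft | MStay | MRight.

Record TM (A : finType) := Machine {
  state : finType;
  aux : finType;
  start : state;
  accepting : pred state;
  delta : state -> option (A + aux) ->
          option (state * option (A + aux) * move) }.

Section Run.
Variables (A : finType) (M : TM A).

Let cell := option (A + aux M).

(* State, cells left of the head (nearest first), scanned cell, cells right of
   the head; all cells that are not listed are blank. *)
Definition config := (state M * seq cell * cell * seq cell)%type.

Definition init (x : seq A) : config :=
  let s := [seq Some (inl a) : cell | a <- x] in
  (start M, [::], head None s, behead s).

Definition step (c : config) : option config :=
  let: (q, l, a, r) := c in
  if delta q a is Some (q', b, m) then
    Some match m with
    | MLeft => (q', behead l, head None l, b :: r)
    | MStay => (q', l, b, r)
    | MRight => (q', b :: l, head None r, behead r)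
    end
  else None.

Fixpoint run (t : nat) (c : config) : config :=
  if t is t'.+1 then if step c is Some c' then run t' c' else c else c.

Definition halted (c : config) : Prop := step c = None.

Definition accepts (c : config) : bool := let: (q, _, _, _) := c in accepting q.

Fixpoint read (s : seq cell) : seq A :=
  if s is Some (inl a) :: s' then a :: read s' else [::].

(* The output is the longest block of input symbols starting at the head. *)
Definition output (c : config) : seq A := let: (_, _, a, r) := c in read (a :: r).

End Run.

Definition language (A : Type) := set (seq A).

Definition polytime_decidable (A : finType) (L : language A) :=
  exists (M : TM A) (p : {poly nat}), forall x : seq A,
    let c := run p.[size x]%R (init M x) in
    halted c /\ (L x <-> accepts c).

Definition polytime_computable (A : finType) (f : seq A -> seq A) :=
  exists (M : TM A) (p : {poly nat}), forall x : seq A,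
    let c := run p.[size x]%R (init M x) in
    halted c /\ output c = f x.

(* [alternate ex k m P] is "Q_1 u_1 Q_2 u_2 ... Q_k u_k, P [:: u_1; ...; u_k]",
   where the u_i range over binary words of length m and the quantifiers
   alternate, Q_1 being existential iff [ex]. *)
Fixpoint alternate (ex : bool) (k m : nat) (P : seq (seq bool) -> Prop) : Prop :=
  if k is k'.+1 then
    if ex then exists u : m.-tuple bool,
                 alternate false k' m (fun us => P (tval u :: us))
    else forall u : m.-tuple bool,
           alternate true k' m (fun us => P (tval u :: us))
  else P [::].

(* The word x#u_1#...#u_k, the separator # being [None]. *)
Definition join_words (x : seq bool) (us : seq (seq bool)) : seq (option bool) :=
  map Some x ++ flatten [seq None :: map Some u | u <- us].

Definition SigmaP (k : nat) (L : language bool) :=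
  exists (V : language (option bool)) (q : {poly nat}),
    polytime_decidable V /\
    forall x, L x <-> alternate true k q.[size x]%R (fun us => V (join_words x us)).

Definition PiP (k : nat) (L : language bool) := SigmaP k (~` L).

Definition reduces_to (L L' : language bool) :=
  exists f : seq bool -> seq bool,
    polytime_computable f /\ forall x, L x <-> L' (f x).

Definition complete (C : language bool -> Prop) (L : language bool) :=
  C L /\ forall L', C L' -> reduces_to L' L.

Definition fin_structure (sg : signature) (m : nat) :=
  forall R : symbol sg, pred ((arity R).-tuple 'I_m).

Definition homomorphic sg m (B : fin_structure sg m) (D : Type) (I : structure sg D) :=
  exists h : 'I_m -> D, forall (R : symbol sg) (t : (arity R).-tuple 'I_m),
    B R t -> I R [tuple of map h t].

Fixpoint lex_tuples (m k : nat) : seq (k.-tuple 'I_m) :=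
  if k is k'.+1 then
    [seq cons_tuple i t | i <- enum 'I_m, t <- lex_tuples m k']
  else [:: nil_tuple 'I_m].

(* 1^m 0 followed by the characteristic bit vector of each relation. *)
Definition encode sg m (B : fin_structure sg m) : seq bool :=
  nseq m true ++ false ::
  flatten [seq [seq B R t | t <- lex_tuples m (arity R)] | R <- enum (symbol sg)].

Definition CSP sg (D : Type) (I : structure sg D) : language bool :=
  [set w | exists m (B : fin_structure sg m), w = encode B /\ homomorphic B I].

(* Main.v *)
(** A vertex serves at once as a clause and as one Boolean variable for each quantifier
    block, and binary relations record which literals a clause contains; a finite
    structure [K] is thus a quantified CNF formula.  Call [K] forbidden if its vertices
    are pairwise joined by a relation E, each of them has an S-successor in [K] (hence no
    proper part of an intended instance is forbidden), and the formula
    "exists u_1, forall u_2, ..., exists u_k, all clauses hold" is true.  Forbidden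
    structures are cliques, so the structures omitting them amalgamate freely and have a
    homogeneous, hence omega-categorical, limit.  A structure without E-loops maps to the
    limit iff it has no forbidden part, which is a Pi_k condition; if the first block is
    instead read off a unary predicate of the limit that is dropped from the signature,
    then a homomorphism guesses this block and the condition becomes Sigma_(k+1).  The
    parities in the theorem are those for which the innermost quantifier of "forbidden" is
    existential, so that the clauses of a Cook-Levin tableau can be used for hardness.

    Both the verifier and the reduction are given by formulas of arithmetic with bounded
    quantifiers over the letters of the input word, and such formulas are evaluated in
    polynomial time by Turing machines that keep numbers in unary as marks on the tape. *)

Require Import Defs.
From mathcomp Require Import all_boot all_algebra.
From mathcomp Require Import boolp classical_sets functions cardinality.
From mathcomp Require Import zify.

Set Implicit Arguments.
Unset Strict Implicit.
Unset Printing Implicit Defensive.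

(** * Structured Turing machine programs *)

(** Two obstacles shape the proof. Choosing the candidate forbidden part K must not cost a
    quantifier block: avoiding all K quantifies over K immediately outside a block of the same kind
    (universal for avoidance, existential for its negation), so K and that block are packed into one
    word. This word is the second one when the first block is hidden, and the first one otherwise.
    The other obstacle is that CSPs speak of homomorphisms and limits of embeddings. The conditions
    on a forbidden structure are positive in its relations, and E has no loops in the limit, so a
    homomorphism is injective on a forbidden clique and maps it to a forbidden set; conversely, a
    structure with a colouring that avoids forbidden sets embeds into the limit one vertex at a
    time. The hidden colour counts when types are formed. Formulas of the smaller signature cannot
    separate tuples of equal coloured type, and there are finitely many such types, so dropping the
    colour keeps the limit omega-categorical. *)

Definition upd (X : Type) (G : nat -> X) (p : nat) (v : X) : nat -> X :=
  fun p' => if p' == p then v else G p'.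

Section Fragments.
Variable C : finType.

(* [inr b] leaves the fragment with answer [b].  Fragments stay on the half-line of
   nonnegative positions. *)
Record frag := Frag {
  fstate : finType;
  entry : fstate;
  fdelta : fstate -> C -> C * move * (fstate + bool) }.

Definition shift (m : move) (p : nat) :=
  match m with MLeft => p.-1 | MStay => p | MRight => p.+1 end.

Definition shiftable (m : move) (p : nat) := if m is MLeft then 0 < p else true.

(** A big-step relation with exact running time, so that composition goes by induction on the run of
    the first fragment. Divergence and moves to the left of the origin have no derivation. [exec]
    keeps only an upper bound on the time, which adds up under composition. *)
Inductive steps (M : frag) (s : fstate M) (G : nat -> C) (p : nat) :
    bool -> (nat -> C) -> nat -> nat -> Prop :=
| StepsExit v m b of fdelta s (G p) = (v, m, inr b) & shiftable m p :
    steps s G p b (upd G p v) (shift m p) 1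
| StepsNext v m s' b G' p' t of fdelta s (G p) = (v, m, inl s') &
    shiftable m p & steps s' (upd G p v) (shift m p) b G' p' t :
    steps s G p b G' p' t.+1.

Definition exec (M : frag) G p b G' p' t :=
  exists2 t', t' <= t & steps (entry M) G p b G' p' t'.

Lemma execW M G p b G' p' t t1 :
  exec M G p b G' p' t -> t <= t1 -> exec M G p b G' p' t1.
Proof. by case=> t' le_t' h le_t; exists t' => //; apply: leq_trans le_t. Qed.

Definition act (g : C -> bool * C * move) : frag :=
  @Frag unit tt (fun _ v => let: (b, v', m) := g v in (v', m, inr b)).

Definition ite (P Q R : frag) : frag :=
  @Frag (fstate P + (fstate Q + fstate R))%type (inl (entry P))
    (fun s v => match s with
     | inl s1 => let: (v', m, r) := fdelta s1 v in
         (v', m, match r with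
           | inl s' => inl (inl s')
           | inr b => inl (inr (if b then inl (entry Q) else inr (entry R)))
           end)
     | inr (inl s2) => let: (v', m, r) := fdelta s2 v in
         (v', m, match r with inl s' => inl (inr (inl s')) | inr b => inr b end)
     | inr (inr s3) => let: (v', m, r) := fdelta s3 v in
         (v', m, match r with inl s' => inl (inr (inr s')) | inr b => inr b end)
     end).

Definition loop (P : frag) : frag :=
  @Frag (fstate P) (entry P)
    (fun s v => let: (v', m, r) := fdelta s v in
       (v', m, match r with
         | inl s' => inl s'
         | inr b => if b then inl (entry P) else inr false end)).

Lemma upd_eq (X : Type) (G : nat -> X) p v : upd G p v p = v.
Proof. by rewrite /upd eqxx. Qed.

Lemma upd_ne (X : Type) (G : nat -> X) p v q : q != p -> upd G p v q = G q.
Proof. by rewrite /upd => /negbTE ->. Qed.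

Lemma upd_id (X : Type) (G : nat -> X) p : upd G p (G p) = G.
Proof. by apply/funext => q; rewrite /upd; case: eqP => // ->. Qed.

Lemma updK (X : Type) (G : nat -> X) p v v' : upd (upd G p v) p v' = upd G p v'.
Proof. by apply/funext => q; rewrite /upd; case: (q == p). Qed.

Lemma exec_act g G p b v m : g (G p) = (b, v, m) -> shiftable m p ->
  exec (act g) G p b (upd G p v) (shift m p) 1.
Proof. by move=> e ok; exists 1 => //; apply: StepsExit => //=; rewrite e. Qed.

Lemma exec_test g G p b m : g (G p) = (b, G p, m) -> shiftable m p ->
  exec (act g) G p b G (shift m p) 1.
Proof. by move=> e ok; rewrite -{2}(upd_id G p); apply: exec_act. Qed.

Lemma exec_ite P Q R G p b G1 p1 b' G' p' t1 t2 :
  exec P G p b G1 p1 t1 -> exec (if b then Q else R) G1 p1 b' G' p' t2 ->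
  exec (ite P Q R) G p b' G' p' (t1 + t2).
Proof.
case=> t1' le1 h1 [t2' le2 h2]; exists (t1' + t2'); first exact: leq_add.
have {}h2 : steps (M := ite P Q R)
    (inr (if b then inl (entry Q) else inr (entry R))) G1 p1 b' G' p' t2'.
  case: b h1 h2 => _.
  - elim=> {G1 p1 t2' le2} [s G1 p1 v m b2 e ok | s G1 p1 v m s' b2 G2 p2 t e ok _ IH].
      by apply: StepsExit => //=; rewrite e.
    by apply: StepsNext IH => //=; rewrite e.
  - elim=> {G1 p1 t2' le2} [s G1 p1 v m b2 e ok | s G1 p1 v m s' b2 G2 p2 t e ok _ IH].
      by apply: StepsExit => //=; rewrite e.
    by apply: StepsNext IH => //=; rewrite e.
rewrite /=; elim: h1 h2 => {G p b G1 p1 t1' le1}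
    [s G p v m b e ok | s G p v m s' b G1 p1 t e ok _ IH] h2.
  by rewrite add1n; apply: StepsNext h2 => //=; rewrite e.
by rewrite addSn; apply: StepsNext (IH h2) => //=; rewrite e.
Qed.

Lemma exec_loop_exit P G p G' p' t :
  exec P G p false G' p' t -> exec (loop P) G p false G' p' t.
Proof.
case=> t' le; move eb: false => b h; exists t' => //; rewrite /=.
elim: h eb => {G p b G' p' t' le}
    [s G p v m b e ok | s G p v m s' b G1 p1 t' e ok _ IH] eb.
  by apply: StepsExit => //=; rewrite e -eb.
by apply: StepsNext (IH eb) => //=; rewrite e.
Qed.

Lemma exec_loop_next P G p G1 p1 b' G' p' t1 t2 :
  exec P G p true G1 p1 t1 -> exec (loop P) G1 p1 b' G' p' t2 ->
  exec (loop P) G p b' G' p' (t1 + t2).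
Proof.
case=> t1' le1 h1 [t2' le2 h2]; exists (t1' + t2'); first exact: leq_add.
rewrite /=; move eb: true h1 => b h1.
elim: h1 eb h2 => {G p b G1 p1 t1' le1}
    [s G p v m b e ok | s G p v m s' b G1 p1 t e ok _ IH] eb h2.
  by rewrite add1n; apply: StepsNext h2 => //=; rewrite e -eb.
by rewrite addSn; apply: StepsNext (IH eb h2) => //=; rewrite e.
Qed.

End Fragments.
Arguments act {C} g.

(** * From fragments to Turing machines *)

Section Machine.
Variables (A : finType) (K : nat).

(* A tape cell: its input letter, its output letter, the set of registers whose
   value is its position, and the mark of the origin. *)
Definition vcell : finType :=
  (option A * option A * {ffun 'I_K.+1 -> bool} * bool)%type.

Definition plain (a : option A) : vcell := (a, None, [ffun=> false], false).

(* Chosen so that the raw input tape is already the coding of a tape of cells, and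
   that an output letter can be written as a raw letter. *)
Definition raw (v : vcell) : option (A + vcell) :=
  if v == plain None then None
  else if v == plain v.1.1.1 then omap inl v.1.1.1 else Some (inr v).

Definition view (x : option (A + vcell)) : vcell :=
  match x with None => plain None | Some (inl a) => plain (Some a)
  | Some (inr v) => v end.

Lemma rawK : cancel raw view.
Proof.
move=> v; rewrite /raw; case: ifP => [/eqP -> // | ne].
case: ifP => // /eqP e; move: ne; rewrite {1}e; case: (v.1.1.1) e => [a|] -> //.
Qed.

Lemma raw_letter a : raw (plain (Some a)) = Some (inl a).
Proof.
rewrite /raw [plain _ == plain _.1.1.1]eqxx.
by have -> : (plain (Some a) == plain None) = false by apply/eqP.
Qed.

Lemma raw_blank : raw (plain None) = None.
Proof. by rewrite /raw eqxx. Qed.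

Definition machine (M : frag vcell) : TM A :=
  @Machine A (fstate M + bool)%type vcell (inl (entry M))
    (fun s => if s is inr b then b else false)
    (fun s x => if s is inl s' then
       let: (v, m, r) := fdelta s' (view x) in Some (r, raw v, m) else None).

(** The list to the right of the head is compared by [nth] with blank as default, since it may omit
    trailing blanks; the list to the left has length exactly [p], so its end is the origin. *)
Definition represents (M : frag vcell) (c : config (machine M))
    (s : fstate M + bool) (G : nat -> vcell) (p : nat) :=
  let: (q, l, a, r) := c in
  [/\ q = s, l = rev [seq raw (G i) | i <- iota 0 p], a = raw (G p)
    & forall j, nth None r j = raw (G (p.+1 + j))].

Lemma map_raw_upd G p v n : n <= p ->
  [seq raw (upd G p v i) | i <- iota 0 n] = [seq raw (G i) | i <- iota 0 n].
Proof.
move=> le; apply/eq_in_map => i; rewrite mem_iota add0n => /andP[_ lt].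
by rewrite upd_ne //; lia.
Qed.

Lemma represents_step (M : frag vcell) c s G p v m r :
  represents c (inl s) G p -> fdelta s (G p) = (v, m, r) -> shiftable m p ->
  exists2 c', step c = Some c' & @represents M c' r (upd G p v) (shift m p).
Proof.
case: c => [[[q l] a] r0] [-> -> -> hr] e ok; rewrite /step /= rawK e.
have updp : upd G p v p = v by apply: upd_eq.
have updr i : raw (upd G p v (p.+1 + i)) = raw (G (p.+1 + i)).
  by rewrite upd_ne //; lia.
case: m ok {e} => /= ok.
- case: p ok hr updp updr => // p _ hr updp updr; eexists; first by [].
  rewrite -[p.+1]addn1 iotaD map_cat rev_cat /= addn1 add0n; split=> //.
  + by rewrite map_raw_upd.
  + by rewrite upd_ne //; lia.
  + by case=> [|j] /=; rewrite ?addn0 ?updp // hr -updr; congr (raw (upd _ _ _ _)); lia.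
- eexists; first by []; split=> //; first by rewrite map_raw_upd.
    by rewrite updp.
  by move=> j; rewrite hr updr.
- eexists; first by []; split=> //.
  + rewrite -[p.+1]addn1 iotaD map_cat rev_cat /= add0n updp.
    by rewrite map_raw_upd.
  + by have := hr 0; rewrite -updr addn0 => <-; case: (r0).
  + move=> j; have := hr j.+1; rewrite -updr => h; rewrite nth_behead h.
    by congr (raw (upd _ _ _ _)); lia.
Qed.

Lemma represents_steps (M : frag vcell) s G p b G' p' t c :
  steps s G p b G' p' t -> represents c (inl s) G p ->
  @represents M (run t c) (inr b) G' p'.
Proof.
move=> h; elim: h c => {s G p b G' p' t}
    [s G p v m b e ok | s G p v m s' b G' p' t e ok _ IH] c hc /=.
- by have [c' -> h'] := represents_step hc e ok.
- by have [c' -> h'] := represents_step hc e ok; apply: IH.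
Qed.

Lemma halted_represents (M : frag vcell) c b G p :
  @represents M c (inr b) G p -> halted c.
Proof. by case: c => [[[q l] a] r] [-> _ _ _]. Qed.

Lemma run_halted (M : TM A) (c : config M) t t' : halted (run t c) -> t <= t' ->
  run t' c = run t c.
Proof.
elim: t t' c => [|t IH] t' c /=.
  by rewrite /halted => h _; case: t' => //= t'; rewrite h.
case: t' => // t' /=; case: (step c) => // c'; exact: IH.
Qed.

Definition input_tape (w : seq A) (p : nat) : vcell := plain (onth w p).

Lemma represents_init (M : frag vcell) w :
  represents (init (machine M) w) (inl (entry M)) (input_tape w) 0.
Proof.
have e x : raw (plain x) = omap inl x.
  by case: x => [a|]; rewrite ?raw_letter ?raw_blank.
split=> //; rewrite /input_tape ?e; first by case: w.
move=> j; rewrite e add1n nth_behead.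
elim: w j.+1 => [|a w IH] [|i] //=.
Qed.

Lemma machine_run (M : frag vcell) w b G p t :
  exec M (input_tape w) 0 b G p t ->
  @represents M (run t (init (machine M) w)) (inr b) G p.
Proof.
case=> t' le h; have := represents_steps h (@represents_init M w) => hr.
by rewrite (run_halted _ le) //; apply: halted_represents hr.
Qed.

End Machine.

(** * Bounded arithmetic formulas and their evaluation *)

(** Evaluation gets its own name so that its laws can be stated with the operations of [nat], on
    which [lia] works. *)
Definition pev (p : {poly nat}) (n : nat) : nat := p.[n]%R.

Lemma pevD p q n : pev (p + q)%R n = pev p n + pev q n.
Proof. exact: hornerD. Qed.
Lemma pevM p q n : pev (p * q)%R n = pev p n * pev q n.
Proof. exact: hornerM. Qed.
Lemma pevC k n : pev k%:P%R n = k.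
Proof. exact: hornerC. Qed.
Lemma pevX n : pev 'X%R n = n.
Proof. exact: hornerX. Qed.
Lemma pev_comp p q n : pev (p \Po q)%R n = pev p (pev q n).
Proof. exact: horner_comp. Qed.
Definition pevE := (pevD, pevM, pevC, pevX, pev_comp).

Inductive dterm :=
| TVar of nat
| TConst of nat
| TLen
| TAdd of dterm & dterm
| TMul of dterm & dterm.

Inductive dform (A : Type) :=
| DEq of dterm & dterm
| DLet of A & dterm
| DNot of dform A
| DAnd of dform A & dform A
| DEx of dterm & dform A.
Arguments DEq {A}.

Fixpoint dval (n : nat) (e : nat -> nat) (t : dterm) : nat :=
  match t with
  | TVar i => e i
  | TConst k => k
  | TLen => n
  | TAdd a b => dval n e a + dval n e b
  | TMul a b => dval n e a * dval n e b
  end.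

(* [DEx t f] at depth [d] quantifies the variable number [d] over all values
   smaller than [t]. *)
Fixpoint dsem (A : eqType) (w : seq A) (d : nat) (e : nat -> nat) (f : dform A) : bool :=
  match f with
  | DEq a b => dval (size w) e a == dval (size w) e b
  | DLet x t => onth w (dval (size w) e t) == Some x
  | DNot g => ~~ dsem w d e g
  | DAnd g h => dsem w d e g && dsem w d e h
  | DEx t g => has (fun x => dsem w d.+1 (upd e d x) g) (iota 0 (dval (size w) e t))
  end.

Fixpoint twf (d : nat) (t : dterm) : bool :=
  match t with
  | TVar i => i < d
  | TConst _ | TLen => true
  | TAdd a b | TMul a b => twf d a && twf d b
  end.

Fixpoint fwf (A : Type) (d : nat) (f : dform A) : bool :=
  match f with
  | DEq a b => twf d a && twf d b
  | DLet _ t => twf d t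
  | DNot g => fwf d g
  | DAnd g h => fwf d g && fwf d h
  | DEx t g => twf d t && fwf d.+1 g
  end.

(** Bounds the number of registers used by [tcode]: a product needs five of its own, for the result,
    two operands and two loop counters. *)
Fixpoint dsize (t : dterm) : nat :=
  match t with
  | TVar _ | TConst _ | TLen => 1
  | TAdd a b | TMul a b => dsize a + dsize b + 5
  end.

Fixpoint fsize (A : Type) (f : dform A) : nat :=
  match f with
  | DEq a b => dsize a + dsize b + 2
  | DLet _ t => dsize t + 1
  | DNot g => fsize g
  | DAnd g h => fsize g + fsize h
  | DEx t g => dsize t + fsize g + 3
  end.

Ltac upds := rewrite /upd;
  repeat match goal with |- context [?x == ?y] => case: (@eqP _ x y) => ? end;
  try congruence; try lia.
Ltac updt := apply/funext => ?; upds.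

(** * Register programs on a marked tape *)

Section Registers.
Variables (A : finType) (K : nat).
Local Notation vcell := (vcell A K).
Implicit Types (v : vcell) (G : nat -> vcell) (c : nat -> nat) (w o : seq A).

Definition tape w o c (p : nat) : vcell :=
  (onth w p, onth o p, [ffun i : 'I_K.+1 => c i == p], p == 0).

Definition mark (r : nat) v : bool := v.1.2 (inord r).

Definition setmark (r : nat) (b : bool) v : vcell :=
  (v.1.1, [ffun i => if i == inord r then b else v.1.2 i], v.2).

Definition seqf (P Q : frag vcell) := ite P Q Q.
Definition ret (b : bool) : frag vcell := act (fun v => (b, v, MStay)).
Definition goto r : frag vcell :=
  loop (act (fun v => if mark r v then (false, v, MStay) else (true, v, MRight))).
Definition home : frag vcell :=
  loop (act (fun v => if v.2 then (false, v, MStay) else (true, v, MLeft))).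
Definition modify r (g : vcell -> vcell) :=
  seqf (goto r) (seqf (act (fun v => (false, g v, MStay))) home).
Definition finally (P Q : frag vcell) := ite P (seqf Q (ret true)) (seqf Q (ret false)).
Definition check r (h : vcell -> bool) :=
  seqf (goto r) (finally (act (fun v => (h v, v, MStay))) home).
Definition copyreg r s := seqf (modify r (setmark r false)) (modify s (setmark r true)).
Definition zeroreg r :=
  seqf (modify r (setmark r false)) (act (fun v => (false, setmark r true v, MStay))).
Definition increg r :=
  seqf (goto r) (seqf (act (fun v => (false, setmark r false v, MRight)))
    (seqf (act (fun v => (false, setmark r true v, MStay))) home)).
Definition emit r a := modify r (fun v => (v.1.1.1, Some a, v.1.2, v.2)).
Definition eqr r s := check r (mark s).
Definition letter r a := check r (fun v => v.1.1.1 == Some a).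
Definition forr s b body :=
  loop (ite (eqr s b) (ret false) (seqf body (seqf (increg s) (ret true)))).

Definition runs (M : frag vcell) w o c b o' c' t :=
  exec M (tape w o c) 0 b (tape w o' c') 0 t.

Lemma exec_seqf P Q G p b G1 p1 b' G' p' t1 t2 :
  exec P G p b G1 p1 t1 -> exec Q G1 p1 b' G' p' t2 ->
  exec (seqf P Q) G p b' G' p' (t1 + t2).
Proof. by move=> h1 h2; apply: exec_ite h1 _; rewrite if_same. Qed.

Lemma exec_ret b G p : exec (ret b) G p b G p 1.
Proof. exact: (exec_test (m := MStay)). Qed.

Lemma exec_finally P Q G p b G1 p1 b' G' p' t1 t2 :
  exec P G p b G1 p1 t1 -> exec Q G1 p1 b' G' p' t2 ->
  exec (finally P Q) G p b G' p' (t1 + (t2 + 1)).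
Proof.
move=> h1 h2; apply: exec_ite h1 _.
by case: b; apply: exec_seqf h2 (exec_ret _ _ _).
Qed.

Lemma exec_goto r G p q : p <= q ->
  (forall i, p <= i < q -> ~~ mark r (G i)) -> mark r (G q) ->
  exec (goto r) G p false G q (q - p).+1.
Proof.
move=> le; rewrite -(subnKC le) addKn; move: (q - p) => n {q le}.
elim: n p => [|n IH] p no yes.
  apply: exec_loop_exit; rewrite addn0 in yes *.
  by apply: (exec_test (m := MStay)) => //; rewrite yes.
rewrite -[n.+2]add1n; apply: (exec_loop_next (G1 := G) (p1 := p.+1)).
  by apply: (exec_test (m := MRight)); rewrite // (negbTE (no _ _)) //; apply/andP; split; lia.
rewrite -addSnnS; apply: IH; rewrite addSnnS // => i h.
by apply: no; move: h; clear; lia.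
Qed.

Lemma exec_home G q : (forall i, i <= q -> (G i).2 = (i == 0)) ->
  exec home G q false G 0 q.+1.
Proof.
elim: q => [|q IH] h.
  by apply: exec_loop_exit; apply: (exec_test (m := MStay)) => //; rewrite h.
rewrite -[q.+2]add1n; apply: (exec_loop_next (G1 := G) (p1 := q)).
  by apply: (exec_test (m := MLeft)); rewrite // h.
by apply: IH => i le; apply: h; apply: ltnW.
Qed.

Lemma exec_modify r g G q : (forall i, i < q -> ~~ mark r (G i)) ->
  mark r (G q) -> (forall i, (G i).2 = (i == 0)) -> (forall v, (g v).2 = v.2) ->
  exec (modify r g) G 0 false (upd G q (g (G q))) 0 (2 * q + 3).
Proof.
move=> no yes org gorg.
have -> : 2 * q + 3 = (q - 0).+1 + (1 + q.+1) by lia.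
apply: exec_seqf (exec_goto (leq0n q) _ yes) _; first by move=> i /andP[_ /no].
apply: exec_seqf (exec_act (m := MStay) _ _) _; [by [] | by [] | apply: exec_home].
by move=> i _; rewrite /upd; case: ifP => // /eqP->; rewrite gorg.
Qed.

Lemma mark_tape r w o c p : r <= K -> mark r (tape w o c p) = (c r == p).
Proof. by move=> le; rewrite /mark ffunE inordK. Qed.

Lemma inord_eq (i : 'I_K.+1) r : r <= K -> (i == inord r) = (i == r :> nat).
Proof. by move=> le; rewrite -val_eqE /= inordK. Qed.

Lemma setmark_tape r w o c c' p q :
  r <= K -> (forall i, i != r -> c' i = c i) -> (c' r == p) = q ->
  setmark r q (tape w o c p) = tape w o c' p.
Proof.
move=> le ne e; rewrite /setmark /tape /=; congr (_, _, _); apply/ffunP => i.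
rewrite !ffunE inord_eq //; have [->|ne'] := eqVneq (nat_of_ord i) r.
  by rewrite e.
by rewrite ne.
Qed.

Lemma setmarkK r b b' v : setmark r b (setmark r b' v) = setmark r b v.
Proof.
rewrite /setmark /=; congr (_, _, _); apply/ffunP => i; rewrite !ffunE.
by case: (i == inord r).
Qed.

(** The tape halfway through an assignment: register [r] has no mark at all, so no choice of
    register values describes this tape. *)
Definition cleared r w o c (p : nat) := setmark r false (tape w o c p).

Lemma cleared_upd r w o c : r <= K ->
  upd (tape w o c) (c r) (setmark r false (tape w o c (c r))) = cleared r w o c.
Proof.
move=> le; apply/funext => p; rewrite /upd /cleared; case: ifP => [/eqP-> //|ne].
by apply/esym; apply: setmark_tape; rewrite // eq_sym ne.
Qed.

Lemma mark_cleared r s w o c p : r <= K -> s <= K -> r != s ->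
  mark s (cleared r w o c p) = (c s == p).
Proof.
move=> ler les ne; rewrite /mark /cleared /= !ffunE inord_eq // inordK //.
by rewrite eq_sym (negbTE ne).
Qed.

Lemma cleared_set r w o c x : r <= K ->
  upd (cleared r w o c) x (setmark r true (cleared r w o c x)) =
  tape w o (upd c r x).
Proof.
move=> le; apply/funext => p.
have ne i : i != r -> upd c r x i = c i by move=> ?; rewrite upd_ne.
have [->|px] := eqVneq p x.
  by rewrite upd_eq /cleared setmarkK; apply: setmark_tape => //; rewrite upd_eq eqxx.
rewrite upd_ne // /cleared; apply: setmark_tape => //.
by rewrite upd_eq eq_sym (negbTE px).
Qed.

Lemma exec_clear r w o c : r <= K ->
  exec (modify r (setmark r false)) (tape w o c) 0 false (cleared r w o c) 0
    (2 * c r + 3).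
Proof.
move=> le; rewrite -cleared_upd //; apply: exec_modify => //.
  by move=> i lt; rewrite mark_tape //; lia.
by rewrite mark_tape.
Qed.

(** The registers must differ because [s] is looked up after the mark of [r] has been erased. The
    cost [6 * N + 12] is one generous bound shared by all register instructions, so that later
    estimates are multiples of a single expression. *)
Lemma runs_copyreg r s w o c N : r <= K -> s <= K -> r != s -> c r <= N -> c s <= N ->
  runs (copyreg r s) w o c false o (upd c r (c s)) (6 * N + 12).
Proof.
move=> ler les ne leN leN'.
apply: execW (exec_seqf (exec_clear w o c ler) _) _.
  rewrite -cleared_set //; apply: exec_modify => //.
    by move=> i lt; rewrite mark_cleared //; lia.
  by rewrite mark_cleared.
lia.
Qed.

Lemma runs_zeroreg r w o c N : r <= K -> c r <= N ->
  runs (zeroreg r) w o c false o (upd c r 0) (6 * N + 12).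
Proof.
move=> ler leN; apply: execW (exec_seqf (exec_clear w o c ler) _) _.
  by rewrite -cleared_set //; apply: (exec_act (m := MStay)).
lia.
Qed.

Lemma runs_increg r w o c N : r <= K -> c r <= N ->
  runs (increg r) w o c false o (upd c r (c r).+1) (6 * N + 12).
Proof.
move=> ler leN; apply: execW (exec_seqf (exec_goto (q := c r) _ _ _) _) _ => //.
- by move=> i lt; rewrite mark_tape //; lia.
- by rewrite mark_tape.
- apply: exec_seqf (exec_act (m := MRight) _ _) _; [by []|by []|].
  rewrite cleared_upd //; apply: exec_seqf (exec_act (m := MStay) _ _) _; [by []|by []|].
  by rewrite cleared_set //; apply: exec_home.
rewrite /=; lia.
Qed.

Lemma runs_check r h w o c N : r <= K -> c r <= N ->
  runs (check r h) w o c (h (tape w o c (c r))) o c (6 * N + 12).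
Proof.
move=> ler leN; apply: execW (exec_seqf (exec_goto (q := c r) _ _ _) _) _ => //.
- by move=> i lt; rewrite mark_tape //; lia.
- by rewrite mark_tape.
- apply: exec_finally (exec_test (m := MStay) _ _) _; [by []|by []|].
  exact: exec_home.
rewrite /=; lia.
Qed.

Lemma runs_eqr r s w o c N : r <= K -> s <= K -> c r <= N ->
  runs (eqr r s) w o c (c r == c s) o c (6 * N + 12).
Proof.
by move=> ler les leN; rewrite eq_sym -(mark_tape w o) //; apply: runs_check.
Qed.

Lemma runs_letter r a w o c N : r <= K -> c r <= N ->
  runs (letter r a) w o c (onth w (c r) == Some a) o c (6 * N + 12).
Proof. by move=> ler leN; apply: runs_check. Qed.

Lemma onth_rcons (X : Type) (s : seq X) x i :
  onth (rcons s x) i = if i == size s then Some x else onth s i.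
Proof.
by elim: s i => [|y s IH] [|i] //=; case: i.
Qed.

Lemma runs_emit r a w o c N : r <= K -> c r = size o -> size o <= N ->
  runs (emit r a) w o c false (rcons o a) c (6 * N + 12).
Proof.
move=> ler e leN; rewrite /runs.
have -> : tape w (rcons o a) c = upd (tape w o c) (c r)
   ((onth w (c r), Some a, [ffun i : 'I_K.+1 => c i == c r], c r == 0) : vcell).
  apply/funext => p; rewrite /upd /tape onth_rcons -e.
  by case: ifP => // /eqP->.
apply: execW (exec_modify (q := c r) _ _ _ _) _ => //.
- by move=> i lt; rewrite mark_tape //; lia.
- by rewrite mark_tape.
by rewrite e; lia.
Qed.

(** [sg j] and [os j] are the registers and the output after [j] rounds, except that the counter [s]
    is overwritten separately. The body may change any register as long as the bound survives and
    the counter is given back. *)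
Lemma runs_for (sg : nat -> nat -> nat) (os : nat -> seq A) s b body w m N t :
  s <= K -> b <= K -> s != b -> m <= N ->
  (forall j, j <= m -> sg j b = m) ->
  (forall j, j < m -> runs body w (os j) (upd (sg j) s j) false
                         (os j.+1) (upd (sg j.+1) s j) t) ->
  runs (forr s b body) w (os 0) (upd (sg 0) s 0) false (os m) (upd (sg m) s m)
    (m.+1 * (t + 2 * (6 * N + 12) + 1)).
Proof.
move=> les leb ne leN hb hbody; have ne' : b != s by rewrite eq_sym.
suff h n j : j + n = m -> runs (forr s b body) w (os j) (upd (sg j) s j) false
    (os m) (upd (sg m) s m) (n.+1 * (t + 2 * (6 * N + 12) + 1)) by apply: (h m 0).
elim: n j => [|n IH] j e.
  rewrite addn0 in e; rewrite e; apply: exec_loop_exit.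
  apply: execW (exec_ite (runs_eqr w (os m) (c := upd (sg m) s m) (N := N) les leb _) _) _.
  - by rewrite upd_eq.
  - by rewrite upd_eq upd_ne ?hb ?eqxx //; apply: exec_ret.
  - lia.
rewrite mulSn; apply: exec_loop_next (IH j.+1 (etrans (addSnnS j n) e)).
apply: execW (exec_ite (runs_eqr w (os j) (c := upd (sg j) s j) (N := N) les leb _) _) _.
- by rewrite upd_eq; lia.
- rewrite upd_eq upd_ne ?hb //; last lia.
  have -> : (j == m) = false by lia.
  apply: exec_seqf (hbody _ _) _; first lia.
  apply: exec_seqf (exec_ret _ _ _).
  have := @runs_increg s w (os j.+1) (upd (sg j.+1) s j) N les.
  rewrite upd_eq; have -> : upd (upd (sg j.+1) s j) s j.+1 = upd (sg j.+1) s j.+1.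
    by rewrite updK.
  by apply; lia.
- lia.
Qed.

Fixpoint iterf n (P : frag vcell) : frag vcell :=
  if n is n'.+1 then seqf P (iterf n' P) else ret false.

(* [tcode t r] puts the value of [t] into register [r]; the registers from [r] on are
   zero before, and those above [r] are zero after.  Variable [i] lives in register
   [2 * i], and register [2 * i + 1] holds the bound of its quantifier. *)
Fixpoint tcode (t : dterm) (r : nat) : frag vcell :=
  match t with
  | TVar i => copyreg r (2 * i)
  | TConst k => iterf k (increg r)
  | TLen => loop (ite (check r (fun v => v.1.1.1 == None)) (ret false)
                   (seqf (increg r) (ret true)))
  | TAdd a b => seqf (tcode a r) (seqf (tcode b r.+1)
      (seqf (forr r.+2 r.+1 (increg r)) (seqf (zeroreg r.+1) (zeroreg r.+2))))
  | TMul a b => seqf (tcode a r.+1) (seqf (tcode b r.+2)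
      (seqf (forr r.+3 r.+1 (seqf (forr r.+4 r.+2 (increg r)) (zeroreg r.+4)))
        (seqf (zeroreg r.+1) (seqf (zeroreg r.+2) (zeroreg r.+3)))))
  end.

Fixpoint tbound (t : dterm) : {poly nat} :=
  match t with
  | TVar _ | TLen => 'X%R
  | TConst k => k%:P%R
  | TAdd a b => (tbound a + tbound b)%R
  | TMul a b => (tbound a * tbound b)%R
  end.

Definition envof (c : nat -> nat) (i : nat) := c (2 * i).

Definition clean (r : nat) (c : nat -> nat) (N : nat) :=
  (forall i, i < r -> c i <= N) /\ (forall i, r <= i -> c i = 0).

Lemma leq_tbound t n e d N : twf d t -> n <= N -> (forall i, i < d -> e i <= N) ->
  dval n e t <= pev (tbound t) N.
Proof.
move=> wf le h; elim: t wf => /= [i|k||a IHa b IHb|a IHa b IHb] wf;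
  rewrite ?pevE //; first exact: h.
  by case/andP: wf => /IHa ha /IHb hb; apply: leq_add.
by case/andP: wf => /IHa ha /IHb hb; apply: leq_mul.
Qed.

Lemma eq_dval n d t e e' : twf d t -> (forall i, i < d -> e i = e' i) ->
  dval n e t = dval n e' t.
Proof.
move=> wf h; elim: t wf => //= [a IHa b IHb|a IHa b IHb].
  by case/andP=> /IHa -> /IHb ->.
by case/andP=> /IHa -> /IHb ->.
Qed.

Lemma upd_same (c : nat -> nat) r x : c r = x -> upd c r x = c.
Proof. by move=> <-; apply: upd_id. Qed.

Lemma clean_upd r c N x N' : clean r c N -> N <= N' -> x <= N' ->
  clean r.+1 (upd c r x) N'.
Proof.
move=> [h1 h2] le le'; split=> i lt.
  have [->|ne] := eqVneq i r; first by rewrite upd_eq.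
  by rewrite upd_ne //; apply: leq_trans le; apply: h1; lia.
by rewrite upd_ne; [apply: h2; lia | lia].
Qed.

Lemma cleanS r c N : clean r c N -> clean r.+1 c N.
Proof.
move=> [h1 h2]; split=> i lt; last by apply: h2; lia.
by have [->|ne] := eqVneq i r; [rewrite h2|apply: h1; lia].
Qed.

Lemma runs_iter_inc k r w o c N : r <= K -> c r + k <= N ->
  runs (iterf k (increg r)) w o c false o (upd c r (c r + k)) (k * (6 * N + 12) + 1).
Proof.
move=> le; elim: k c => [|k IH] c h.
  by rewrite addn0 upd_id; apply: exec_ret.
apply: execW (exec_seqf (runs_increg (N := N) _ _ le _) _) _; first by lia.
  have -> : upd c r (c r + k.+1) =
      upd (upd c r (c r).+1) r ((upd c r (c r).+1) r + k).
    by rewrite updK upd_eq addSnnS.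
  by apply: IH; rewrite upd_eq; lia.
rewrite mulSn; lia.
Qed.

Lemma onth_None (w : seq A) i : (onth w i == None) = (size w <= i).
Proof. by elim: w i => [|a w IH] [|i] //=; rewrite IH. Qed.

Lemma runs_len r w o c N : r <= K -> size w <= N -> c r = 0 ->
  runs (tcode TLen r) w o c false o (upd c r (size w))
    ((size w).+1 * (2 * (6 * N + 12) + 1)).
Proof.
move=> le leN c0; rewrite -{1}(upd_same c0) /=.
suff h n j : j + n = size w -> runs (tcode TLen r) w o (upd c r j) false o
    (upd c r (size w)) (n.+1 * (2 * (6 * N + 12) + 1)) by apply: h.
elim: n j => [|n IH] j e.
  rewrite addn0 in e; rewrite -e; apply: exec_loop_exit.
  apply: execW (exec_ite (runs_check (fun v => v.1.1.1 == None) w o (c := upd c r j)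
    (N := N) le _) _) _.
  - by rewrite upd_eq; lia.
  - by rewrite /tape /= upd_eq onth_None e leqnn; apply: exec_ret.
  - lia.
rewrite mulSn; apply: exec_loop_next (IH j.+1 (etrans (addSnnS j n) e)).
apply: execW (exec_ite (runs_check (fun v => v.1.1.1 == None) w o (c := upd c r j)
  (N := N) le _) _) _.
- by rewrite upd_eq; lia.
- rewrite /tape /= upd_eq onth_None leqNgt -e; have -> : j < j + n.+1 by lia.
  apply: exec_seqf (exec_ret _ _ _).
  have := @runs_increg r w o (upd c r j) N le; rewrite upd_eq updK.
  by apply; lia.
- lia.
Qed.

(** The polynomial is built along the term and precedes the choice of base register, word and
    register values, so the time bound is uniform in them. *)
Lemma runs_tcode t d : twf d t -> exists q : {poly nat}, forall r w o c N,
  2 * d <= r -> r + dsize t <= K -> size w <= N -> clean r c N ->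
  runs (tcode t r) w o c false o (upd c r (dval (size w) (envof c) t)) (pev q N).
Proof.
elim: t => /= [i|k||a IHa b IHb|a IHa b IHb].
- move=> lt; exists (6%:P * 'X + 12%:P)%R => r w o c N led leK leN [h1 h2].
  rewrite !pevE; apply: runs_copyreg; try lia; last by apply: h1; lia.
  by rewrite h2.
- move=> _; exists (k%:P * (6%:P * ('X + k%:P) + 12%:P) + 1%:P)%R.
  move=> r w o c N led leK leN [h1 h2]; rewrite !pevE.
  have c0 : c r = 0 by apply: h2.
  by have := @runs_iter_inc k r w o c (N + k); rewrite c0 add0n; apply; lia.
- move=> _; exists (('X + 1%:P) * (2%:P * (6%:P * 'X + 12%:P) + 1%:P))%R.
  move=> r w o c N led leK leN [h1 h2]; rewrite !pevE.
  apply: (execW (@runs_len r w o c N _ leN _)); [lia | exact: h2 |].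
  by rewrite addn1 leq_mul2r; lia.
- case/andP=> wfa wfb; have [qa ha] := IHa wfa; have [qb hb] := IHb wfb.
  (* [Q] bounds every register value met on the way, so each instruction below costs at most
     [6 * pev Q N + 12]. *)
  have [Q eQ] : exists Q, forall n, pev Q n = n + pev (tbound a) n + pev (tbound b) n.
    by exists ('X + tbound a + tbound b)%R => n; rewrite !pevE.
  exists (qa + (qb \Po Q) + ((Q + 1%:P) * (18%:P * Q + 37%:P) + (12%:P * Q + 24%:P)))%R.
  move=> r w o c N led leK leN cl; have [h1 h2] := cl.
  have env1 i : i < d -> envof c i <= N by move=> lt; apply: h1; lia.
  set va := dval _ _ a; set vb := dval _ _ b.
  have leva : va <= pev (tbound a) N by apply: leq_tbound env1.
  have levb : vb <= pev (tbound b) N by apply: leq_tbound env1.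
  pose B := pev Q N; have eB : B = N + pev (tbound a) N + pev (tbound b) N.
    exact: eQ.
  have cl1 : clean r.+1 (upd c r va) B by apply: clean_upd cl _ _; lia.
  have e1 : dval (size w) (envof (upd c r va)) b = vb.
    by apply: eq_dval wfb _ => i lt; rewrite /envof upd_ne //; lia.
  have hb' : runs (tcode b r.+1) w o (upd c r va) false o
      (upd (upd c r va) r.+1 vb) (pev qb B) by rewrite -e1; apply: hb => //; lia.
  pose sg j := upd (upd c r (va + j)) r.+1 vb.
  have hl : runs (forr r.+2 r.+1 (increg r)) w o (upd (sg 0) r.+2 0) false o
      (upd (sg vb) r.+2 vb) (vb.+1 * (6 * B + 12 + 2 * (6 * B + 12) + 1)).
    apply: (runs_for (os := fun=> o)); try lia.
      by move=> j _; rewrite /sg upd_eq.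
    move=> j lt; have <- : upd (upd (sg j) r.+2 j) r (upd (sg j) r.+2 j r).+1 =
        upd (sg j.+1) r.+2 j by rewrite /sg; updt.
    by apply: runs_increg; rewrite /sg; upds.
  have e0 : upd (sg 0) r.+2 0 = upd (upd c r va) r.+1 vb.
    by rewrite upd_same /sg ?addn0 // !upd_ne ?h2 //; lia.
  rewrite e0 in hl.
  have ef : upd (upd (upd (sg vb) r.+2 vb) r.+1 0) r.+2 0 = upd c r (va + vb).
    have c1 : c r.+1 = 0 by apply: h2; lia.
    have c2 : c r.+2 = 0 by apply: h2; lia.
    by rewrite /sg; updt.
  rewrite -ef.
  apply: execW (exec_seqf (ha _ _ _ _ _ led _ leN cl) (exec_seqf hb'
    (exec_seqf hl (exec_seqf (runs_zeroreg (N := B) _ _ _ _) (runs_zeroreg (N := B) _ _ _ _))))) _;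
    try lia.
  1,2: by rewrite /sg; upds.
  have le3 : vb.+1 * (18 * B + 37) <= (B + 1) * (18 * B + 37).
    by rewrite leq_mul2r; lia.
  by rewrite !(pevD, pevM, pevC, pev_comp) -/B; lia.
- case/andP=> wfa wfb; have [qa ha] := IHa wfa; have [qb hb] := IHb wfb.
  have [Q eQ] : exists Q, forall n, pev Q n =
      n + pev (tbound a) n + pev (tbound b) n + pev (tbound a) n * pev (tbound b) n.
    by exists ('X + tbound a + tbound b + tbound a * tbound b)%R => n; rewrite !pevE.
  exists (qa + (qb \Po Q) + ((Q + 1%:P) * ((Q + 1%:P) * (18%:P * Q + 37%:P) +
    (18%:P * Q + 37%:P)) + (18%:P * Q + 36%:P)))%R.
  move=> r w o c N led leK leN cl; have [h1 h2] := cl.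
  have env1 i : i < d -> envof c i <= N by move=> lt; apply: h1; lia.
  set va := dval _ _ a; set vb := dval _ _ b.
  have leva : va <= pev (tbound a) N by apply: leq_tbound env1.
  have levb : vb <= pev (tbound b) N by apply: leq_tbound env1.
  pose B := pev Q N; have eB : B = N + pev (tbound a) N + pev (tbound b) N +
      pev (tbound a) N * pev (tbound b) N.
    exact: eQ.
  have levab : va * vb <= pev (tbound a) N * pev (tbound b) N by apply: leq_mul.
  have cl0 := cleanS cl.
  have cl1 : clean r.+2 (upd c r.+1 va) B by apply: clean_upd cl0 _ _; lia.
  have ha' := ha r.+1 w o c N ltac:(lia) ltac:(lia) leN cl0.
  have e1 : dval (size w) (envof (upd c r.+1 va)) b = vb.
    by apply: eq_dval wfb _ => i lt; rewrite /envof upd_ne //; lia.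
  have hb' : runs (tcode b r.+2) w o (upd c r.+1 va) false o
      (upd (upd c r.+1 va) r.+2 vb) (pev qb B) by rewrite -e1; apply: hb => //; lia.
  pose sg j := upd (upd (upd c r (j * vb)) r.+1 va) r.+2 vb.
  have c0 : c r = 0 by apply: h2; lia.
  have c1 : c r.+1 = 0 by apply: h2; lia.
  have c2 : c r.+2 = 0 by apply: h2; lia.
  have c3 : c r.+3 = 0 by apply: h2; lia.
  have c4 : c r.+4 = 0 by apply: h2; lia.
  pose T := vb.+1 * (6 * B + 12 + 2 * (6 * B + 12) + 1) + (6 * B + 12).
  have hl : runs (forr r.+3 r.+1 (seqf (forr r.+4 r.+2 (increg r)) (zeroreg r.+4))) w o
      (upd (sg 0) r.+3 0) false o
      (upd (sg va) r.+3 va) (va.+1 * (T + 2 * (6 * B + 12) + 1)).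
    apply: (runs_for (os := fun=> o)); try lia.
      by move=> j _; rewrite /sg upd_ne ?upd_eq //; lia.
    move=> j lt.
    have jle i : i <= vb -> j * vb + i <= va * vb.
      move=> le; apply: (@leq_trans (j.+1 * vb)); first by rewrite mulSn; lia.
      by rewrite leq_mul2r; lia.
    pose sg' i := upd (upd (upd (upd c r (j * vb + i)) r.+1 va) r.+2 vb) r.+3 j.
    have hl' : runs (forr r.+4 r.+2 (increg r)) w o (upd (sg' 0) r.+4 0) false o
        (upd (sg' vb) r.+4 vb) (vb.+1 * (6 * B + 12 + 2 * (6 * B + 12) + 1)).
      apply: (runs_for (os := fun=> o)); try lia.
        by move=> i _; rewrite /sg' upd_ne ?upd_eq //; lia.
      move=> i lti; have lei := jle i (ltnW lti).
      have <- : upd (upd (sg' i) r.+4 i) r (upd (sg' i) r.+4 i r).+1 =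
          upd (sg' i.+1) r.+4 i by rewrite /sg'; updt.
      by apply: runs_increg; rewrite /sg'; upds.
    have -> : upd (sg j) r.+3 j = upd (sg' 0) r.+4 0.
      by rewrite /sg /sg' addn0; updt.
    have -> : upd (sg j.+1) r.+3 j = upd (upd (sg' vb) r.+4 vb) r.+4 0.
      by rewrite /sg /sg' mulSn addnC; updt.
    apply: execW (exec_seqf hl' (runs_zeroreg (N := B) _ _ _ _)) _; try lia.
    by rewrite upd_eq; lia.
  have e0 : upd (sg 0) r.+3 0 = upd (upd c r.+1 va) r.+2 vb.
    by rewrite /sg mul0n; updt.
  rewrite e0 in hl.
  have ef : upd (upd (upd (upd (sg va) r.+3 va) r.+1 0) r.+2 0) r.+3 0 =
      upd c r (va * vb) by rewrite /sg; updt.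
  rewrite -ef.
  apply: execW (exec_seqf ha' (exec_seqf hb'
    (exec_seqf hl (exec_seqf (runs_zeroreg (N := B) _ _ _ _)
     (exec_seqf (runs_zeroreg (N := B) _ _ _ _) (runs_zeroreg (N := B) _ _ _ _)))))) _;
    try lia.
  1-3: by rewrite /sg; upds.
  have le3 : vb.+1 * (18 * B + 37) <= (B + 1) * (18 * B + 37).
    by rewrite leq_mul2r; lia.
  have le4 : va.+1 * (T + 2 * (6 * B + 12) + 1) <=
      (B + 1) * ((B + 1) * (18 * B + 37) + (18 * B + 37)).
    by rewrite leq_mul //; rewrite /T; lia.
  by rewrite !(pevD, pevM, pevC, pev_comp) -/B; lia.
Qed.

(** The search for a witness leaves its loop with the same answer at the bound and at the first
    witness, so the candidate is compared with the bound once more to obtain the truth value.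
    [finally] keeps this value while the scratch registers are zeroed. *)
Fixpoint fcode (d : nat) (f : dform A) : frag vcell :=
  let r := 2 * d in
  match f with
  | DEq a b => seqf (tcode a r) (seqf (tcode b r.+1)
      (finally (eqr r r.+1) (seqf (zeroreg r) (zeroreg r.+1))))
  | DLet x t => seqf (tcode t r) (finally (letter r x) (zeroreg r))
  | DNot g => ite (fcode d g) (ret false) (ret true)
  | DAnd g h => ite (fcode d g) (fcode d h) (ret false)
  | DEx t g => seqf (tcode t r.+1)
      (seqf (loop (ite (eqr r r.+1) (ret false)
               (ite (fcode d.+1 g) (ret false) (seqf (increg r) (ret true)))))
        (finally (ite (eqr r r.+1) (ret false) (ret true))
           (seqf (zeroreg r) (zeroreg r.+1))))
  end.

(** The registers come back unchanged, which lets the second conjunct and every round of a search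
    start from the state that the induction hypothesis expects. *)
Lemma runs_fcode f d : fwf d f -> exists q : {poly nat}, forall w o c N,
  2 * d + fsize f <= K -> size w <= N -> clean (2 * d) c N ->
  runs (fcode d f) w o c (dsem w d (envof c) f) o c (pev q N).
Proof.
elim: f d => [a b|x t|g IH|g IHg h IHh|t g IH] d /=.
- case/andP=> wfa wfb.
  have [qa ha] := runs_tcode wfa; have [qb hb] := runs_tcode wfb.
  have [Q eQ] : exists Q, forall n, pev Q n = n + pev (tbound a) n + pev (tbound b) n.
    by exists ('X + tbound a + tbound b)%R => n; rewrite !pevE.
  exists (qa + (qb \Po Q) + (18%:P * Q + 37%:P))%R.
  move=> w o c N leK leN cl; have [h1 h2] := cl.
  have env1 i : i < d -> envof c i <= N by move=> lt; apply: h1; lia.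
  pose r := 2 * d; have er2 : r = 2 * d by [].
  rewrite -/r in leK cl h1 h2 *; clearbody r.
  set va := dval _ _ a; set vb := dval _ _ b.
  have leva : va <= pev (tbound a) N by apply: leq_tbound env1.
  have levb : vb <= pev (tbound b) N by apply: leq_tbound env1.
  pose B := pev Q N; have eB : B = N + pev (tbound a) N + pev (tbound b) N by apply: eQ.
  have cl1 : clean r.+1 (upd c r va) B by apply: clean_upd cl _ _; lia.
  have e1 : dval (size w) (envof (upd c r va)) b = vb.
    by apply: eq_dval wfb _ => i lt; rewrite /envof upd_ne //; lia.
  have hb' : runs (tcode b r.+1) w o (upd c r va) false o
      (upd (upd c r va) r.+1 vb) (pev qb B) by rewrite -e1; apply: hb => //; lia.
  set c' := upd (upd c r va) r.+1 vb in hb'.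
  have ef : upd (upd c' r 0) r.+1 0 = c.
    have c0 : c r = 0 by apply: h2; lia.
    have c1 : c r.+1 = 0 by apply: h2; lia.
    by rewrite /c'; updt.
  have er : c' r = va by rewrite /c'; upds.
  have er' : c' r.+1 = vb by rewrite /c'; upds.
  rewrite -[in X in runs _ _ _ _ _ _ X _]ef -er -er'.
  apply: execW (exec_seqf (ha r w o c N _ _ leN cl) (exec_seqf hb' (exec_finally
    (runs_eqr (N := B) _ _ _ _ _)
    (exec_seqf (runs_zeroreg (N := B) _ _ _ _) (runs_zeroreg (N := B) _ _ _ _))))) _;
    try lia; try by rewrite ?er //; upds.
  by rewrite !(pevD, pevM, pevC, pev_comp) -/B; lia.
- move=> wf; have [q hq] := runs_tcode wf.
  exists (q + (12%:P * ('X + tbound t) + 25%:P))%R.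
  move=> w o c N leK leN cl; have [h1 h2] := cl.
  have env1 i : i < d -> envof c i <= N by move=> lt; apply: h1; lia.
  pose r := 2 * d; have er2 : r = 2 * d by [].
  rewrite -/r in leK cl h1 h2 *; clearbody r.
  set va := dval _ _ t.
  have leva : va <= pev (tbound t) N by apply: leq_tbound env1.
  set c' := upd c r va.
  have ef : upd c' r 0 = c by rewrite /c' updK upd_same ?h2.
  have er : c' r = va by rewrite /c' upd_eq.
  rewrite -[in X in runs _ _ _ _ _ _ X _]ef -er.
  apply: execW (exec_seqf (hq r w o c N _ _ leN cl) (exec_finally
    (runs_letter (N := N + va) _ _ _ _ _) (runs_zeroreg (N := N + va) _ _ _ _))) _;
    try lia; try by rewrite -/c' ?er; lia.
  by rewrite !(pevD, pevM, pevC, pevX); lia.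
- move=> wf; have [q hq] := IH _ wf.
  exists (q + 1%:P)%R => w o c N leK leN cl; rewrite pevD pevC.
  apply: exec_ite (hq w o c N leK leN cl) _.
  by case: (dsem _ _ _ _); apply: exec_ret.
- case/andP=> wfg wfh; have [qg hg] := IHg _ wfg; have [qh hh] := IHh _ wfh.
  exists (qg + (qh + 1%:P))%R => w o c N leK leN cl; rewrite !pevD pevC.
  apply: exec_ite (hg w o c N _ leN cl) _; first lia.
  case: (dsem _ _ _ _) => /=.
    by apply: execW (hh w o c N _ leN cl) _; lia.
  by apply: execW (exec_ret _ _ _) _; lia.
- case/andP=> wft wfg; have [q hq] := runs_tcode wft; have [qg hg] := IH _ wfg.
  have [Q eQ] : exists Q, forall n, pev Q n = n + pev (tbound t) n.
    by exists ('X + tbound t)%R => n; rewrite !pevE.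
  exists (q + ((Q + 1%:P) * ((qg \Po Q) + (12%:P * Q + 25%:P)) + (18%:P * Q + 38%:P)))%R.
  move=> w o c N leK leN cl; have [h1 h2] := cl.
  have env1 i : i < d -> envof c i <= N by move=> lt; apply: h1; lia.
  pose r := 2 * d; have er2 : r = 2 * d by [].
  rewrite -/r in leK cl h1 h2 *; clearbody r.
  set va := dval _ _ t.
  have leva : va <= pev (tbound t) N by apply: leq_tbound env1.
  pose B := pev Q N; have eB : B = N + pev (tbound t) N by apply: eQ.
  have cl0 := cleanS cl.
  pose st x := upd (upd c r.+1 va) r x.
  have c0 : c r = 0 by apply: h2; lia.
  have c1 : c r.+1 = 0 by apply: h2; lia.
  have str x : st x r = x by rewrite /st; upds.
  have str' x : st x r.+1 = va by rewrite /st; upds.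
  have st0 : upd c r.+1 va = st 0 by rewrite /st; updt.
  have stf x : upd (upd (st x) r 0) r.+1 0 = c by rewrite /st; updt.
  have sti x : upd (st x) r (st x r).+1 = st x.+1 by rewrite /st; updt.
  have envs x : envof (st x) = upd (envof c) d x.
    apply/funext => i; rewrite /envof /st; have [->|ne] := eqVneq i d.
      by rewrite -er2 !upd_eq.
    by rewrite !upd_ne // er2; lia.
  have clst x : x <= va -> clean (2 * d.+1) (st x) B.
    move=> le; split=> i lt; rewrite /st /upd; case: eqP => [|ne1]; try lia;
      case: eqP => [|ne2]; try lia; last by apply: h2; lia.
    by apply: (@leq_trans N); [apply: h1; lia | lia].
  pose p x := dsem w d.+1 (upd (envof c) d x) g.
  pose T := pev qg B + (12 * B + 25).
  pose body := ite (eqr r r.+1) (ret false)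
    (ite (fcode d.+1 g) (ret false) (seqf (increg r) (ret true))) : frag vcell.
  have hl n x : x + n = va -> runs (loop body) w o (st x) false o
      (st (x + find p (iota x n))) (n.+1 * T).
    elim: n x => [|n IHn] x e.
      rewrite addn0; apply: exec_loop_exit.
      apply: execW (exec_ite (runs_eqr w o (c := st x) (N := B) _ _ _) _) _; try lia.
      + by rewrite str; lia.
      + have -> : st x r == st x r.+1 by rewrite str str'; lia.
        exact: exec_ret.
      + by rewrite /T; lia.
    have hne : st x r == st x r.+1 = false by rewrite str str'; lia.
    have hx : exec (fcode d.+1 g) (tape w o (st x)) 0 (p x) (tape w o (st x)) 0 (pev qg B).
      by rewrite /p -envs; apply: hg; [lia | lia | apply: clst; lia].
    rewrite /=; case: ifP => px.
      rewrite addn0; apply: exec_loop_exit.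
      apply: execW (exec_ite (runs_eqr w o (c := st x) (N := B) _ _ _) _) _; try lia.
      + by rewrite str; lia.
      + by rewrite hne; apply: exec_ite hx _; rewrite px; apply: exec_ret.
      + by rewrite /T; lia.
    rewrite -addSnnS mulSn; apply: exec_loop_next (IHn x.+1 _); last by rewrite addSnnS.
    apply: execW (exec_ite (runs_eqr w o (c := st x) (N := B) _ _ _) _) _; try lia.
    + by rewrite str; lia.
    + rewrite hne; apply: exec_ite hx _; rewrite px.
      apply: exec_seqf (exec_ret _ _ _); rewrite -sti.
      apply: (runs_increg w o (c := st x) (N := B)); try lia.
      by rewrite str; lia.
    + by rewrite /T; lia.
  (* The candidate on leaving the loop: the first witness, or [va] if there is none. *)
  pose y := find p (iota 0 va).
  have ley : y <= va by rewrite -[va](size_iota 0) find_size.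
  have hy : has p (iota 0 va) = ~~ (y == va).
    by rewrite has_find size_iota -/y; lia.
  have hl0 := hl va 0 (add0n _); rewrite add0n -/y in hl0.
  rewrite -/p hy.
  have hq' := hq r.+1 w o c N ltac:(lia) ltac:(lia) leN cl0.
  rewrite -/va st0 in hq'.
  have hf : exec (ite (eqr r r.+1) (ret false) (ret true)) (tape w o (st y)) 0
      (y != va) (tape w o (st y)) 0 (6 * B + 13).
    apply: execW (exec_ite (runs_eqr w o (c := st y) (N := B) _ _ _) _) _; try lia.
    + by rewrite str; lia.
    + by rewrite str str'; case: (y == va); apply: exec_ret.
    + lia.
  rewrite -[in X in runs _ _ _ _ _ _ X _](stf y).
  apply: execW (exec_seqf hq' (exec_seqf hl0 (exec_finally hf
    (exec_seqf (runs_zeroreg (N := B) _ _ _ _) (runs_zeroreg (N := B) _ _ _ _))))) _;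
    try lia.
  + by rewrite str; lia.
  + by rewrite upd_ne ?str'; lia.
  have le3 : va.+1 * T <= (B + 1) * T by rewrite leq_mul2r; lia.
  by rewrite !(pevD, pevM, pevC, pev_comp) -/B -/T; lia.
Qed.

Definition setup : frag vcell :=
  act (fun v => (false, ((v.1.1, [ffun=> true], true) : vcell), MStay)).

Lemma exec_setup w :
  exec setup (input_tape K w) 0 false (tape w [::] (fun=> 0)) 0 1.
Proof.
have -> : tape w [::] (fun=> 0) = upd (input_tape K w) 0
    ((input_tape K w 0).1.1, [ffun=> true], true).
  apply/funext => p; rewrite /tape /upd /input_tape /plain.
  have [->|ne] := eqVneq p 0; first by congr (_, _, _, _); apply/ffunP => i; rewrite !ffunE.
  by congr (_, _, _, _); case: p ne.
exact: (exec_act (m := MStay)).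
Qed.

(** [output] reads raw letters from the head up to the first other cell. Hence output letters are
    rewritten as raw letters and the cell after them as a blank; the origin is converted last,
    because [home] still needs its mark. For the empty output the blank has to go to the origin
    itself. *)
Definition finish : frag vcell :=
  ite (act (fun v => if v.1.1.2 is Some _ then (true, v, MRight)
                     else (false, plain K None, MStay)))
    (seqf (loop (act (fun v => if v.1.1.2 is Some a
                               then (true, plain K (Some a), MRight)
                               else (false, plain K None, MLeft))))
      (seqf home (act (fun v => (false, plain K v.1.1.2, MStay)))))
    (ret false).

Lemma exec_finish w o c : exists2 G, exec finish (tape w o c) 0 false G 0
    (2 * size o + 5) & forall p, p <= size o -> G p = plain K (onth o p).
Proof.
case: o => [|a o].
  exists (upd (tape w [::] c) 0 (plain K None)); last first.
    by case=> // _; rewrite upd_eq.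
  apply: (execW (exec_ite (b := false) (t2 := 1) (exec_act (m := MStay) _ _) _)) => //.
  exact: exec_ret.
pose Gc i p := if 0 < p < i then plain K (onth (a :: o) p) else tape w (a :: o) c p.
have h n i : i + n = size o -> exec (loop (act (fun v => if v.1.1.2 is Some a
      then (true, plain K (Some a), MRight) else (false, plain K None, MLeft))))
    (Gc i.+1) i.+1 false (Gc (size o).+2) (size o) n.+1.
  have Gi j : upd (Gc j.+1) j.+1 (plain K (onth o j)) = Gc j.+2.
    apply/funext => p; rewrite /upd /Gc; have [->|ne] := eqVneq p j.+1.
      by rewrite ltnS leqnn.
    by rewrite [p < j.+2]ltnS [p <= _]leq_eqVlt (negbTE ne).
  have Gi' j : Gc j.+1 j.+1 = tape w (a :: o) c j.+1 by rewrite /Gc ltnn andbF.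
  elim: n i => [|n IH] i e.
    rewrite addn0 in e; subst i; apply: exec_loop_exit; rewrite -Gi.
    have -> : onth o (size o) = None by apply/eqP; rewrite onth_None.
    apply: (exec_act (m := MLeft)) => //; rewrite Gi' /=.
    by have -> : onth o (size o) = None by apply/eqP; rewrite onth_None.
  rewrite -[n.+2]add1n; apply: exec_loop_next (IH i.+1 (etrans (addSnnS i n) e)).
  rewrite -Gi; apply: (exec_act (m := MRight)) => //; rewrite Gi' /=.
  by have : onth o i != None; [rewrite onth_None; lia | case: (onth o i)].
exists (upd (Gc (size o).+2) 0 (plain K (Some a))); last first.
  move=> p le; have [->|ne] := eqVneq p 0; first by rewrite upd_eq.
  rewrite upd_ne // /Gc; rewrite /= in le.
  by have -> : 0 < p < (size o).+2 by lia.
have h0 := h (size o) 0 (add0n _).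
have e1 : Gc 1 = tape w (a :: o) c by apply/funext => p; rewrite /Gc; case: p.
rewrite e1 in h0.
have h1 : exec home (Gc (size o).+2) (size o) false (Gc (size o).+2) 0 (size o).+1.
  by apply: exec_home => i _; rewrite /Gc; case: i => // i /=; case: ifP.
have h2 : exec (act (fun v => (false, plain K v.1.1.2, MStay))) (Gc (size o).+2) 0
    false (upd (Gc (size o).+2) 0 (plain K (Some a))) 0 1.
  exact: (exec_act (m := MStay)).
apply: (execW (exec_ite (b := true) (exec_test (m := MRight) _ _)
  (exec_seqf h0 (exec_seqf h1 h2)))) => //=; lia.
Qed.

Lemma read_letters (M : TM A) o (s : seq (option (A + aux M))) :
  (forall i, i <= size o -> nth None s i = omap inl (onth o i)) -> read s = o.
Proof.
elim: o s => [|a o IH] [|x s] h //=; first by have := h 0 isT => /= ->.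
  by have := h 0 isT.
have := h 0 isT => /= ->; congr cons; apply: IH => i le.
exact: (h i.+1 le).
Qed.

Lemma output_finish (M : frag vcell) o G cf b :
  represents (M := M) cf (inr b) G 0 ->
  (forall p, p <= size o -> G p = plain K (onth o p)) -> output cf = o.
Proof.
have e x : raw (plain K x) = omap inl x.
  by case: x => [a|]; rewrite ?raw_letter ?raw_blank.
case: cf => [[[q l] a] r] [_ _ ea er] h; apply: read_letters => -[|i] le /=.
  by rewrite ea h // e.
by rewrite er add1n h // e.
Qed.

End Registers.
Arguments tcode {A K} t r.
Arguments emit {A K} r a.
Arguments forr {A K} s b body.

(** * Polynomial time from bounded formulas *)

Theorem dform_decidable (A : finType) (f : dform A) (L : language A) :
  fwf 0 f -> (forall w, L w <-> dsem w 0 (fun=> 0) f) -> polytime_decidable L.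
Proof.
move=> wf hL; pose K := fsize f.
have [q hq] := runs_fcode (A := A) K wf.
exists (machine (seqf (@setup A K) (fcode K 0 f))), (1%:P + q)%R => x.
rewrite -[(_ + _).[_]%R]/(pev _ (size x)) pevD pevC.
have := hq x [::] (fun=> 0) (size x) (leqnn _) (leqnn _) _.
move=> /(_ (conj (fun i _ => leq0n _) (fun _ _ => erefl))) h.
have := machine_run (exec_seqf (@exec_setup A K x) h).
set c := run _ _ => hc; split; first exact: halted_represents hc.
case: c hc => [[[s l] a] r] [-> _ _ _] /=.
exact: hL.
Qed.

Theorem dform_computable (F : seq bool -> seq bool) (t : dterm)
    (f : dform bool) : twf 0 t -> fwf 1 f ->
  (forall w, F w = mkseq (fun i => dsem w 1 (upd (fun=> 0) 0 i) f)
                     (dval (size w) (fun=> 0) t)) -> polytime_computable F.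
Proof.
move=> wft wf hF; pose K := dsize t + fsize f + 2.
have [q hq] := runs_fcode (A := bool) K wf.
have [q' hq'] := runs_tcode bool K wft.
(* The output position is treated as a quantified variable number 0: register 0 holds it and
   register 1 its bound, as [fcode] expects at depth 1. *)
pose body := ite (fcode K 1 f) (emit 0 true) (emit 0 false).
pose M := seqf (setup bool K) (seqf (tcode t 1) (seqf (forr 0 1 body) (finish bool K))).
have [Q eQ] : exists Q, forall n, pev Q n = n + pev (tbound t) n.
  by exists ('X + tbound t)%R => n; rewrite !pevE.
exists (machine M), (1%:P + (q' + ((Q + 1%:P) * ((q \Po Q) + (18%:P * Q + 37%:P)) +
   (2%:P * Q + 5%:P))))%R => x.
rewrite -[(1%:P + _).[_]%R]/(pev _ (size x)).
set m := dval (size x) (fun=> 0) t in hF.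
pose N := size x; pose B := pev Q N.
have lem : m <= pev (tbound t) N by apply: leq_tbound wft (leqnn _) _ => i.
have eB : B = N + pev (tbound t) N by apply: eQ.
have leB : size x <= B by rewrite eB leq_addr.
have leK : 2 * 1 + fsize f <= K by rewrite /K; lia.
have h1 := hq' 1 x [::] (fun=> 0) N (ltac:(lia)) ltac:(rewrite /K; lia) (leqnn _)
  (conj (fun i _ => leq0n _) (fun _ _ => erefl)).
have -> : F x = mkseq (fun i => dsem x 1 (upd (fun=> 0) 0 i) f) m by rewrite hF.
pose os j := mkseq (fun i => dsem x 1 (upd (fun=> 0) 0 i) f) j.
pose st := upd (fun=> 0) 1 m.
have h2 : runs (K := K) (forr 0 1 body) x (os 0) (upd st 0 0) false (os m)
    (upd st 0 m) (m.+1 * (pev q B + (6 * B + 12) + 2 * (6 * B + 12) + 1)).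
  apply: (runs_for (sg := fun=> st)); rewrite /K; try lia; first by move=> j _; rewrite /st upd_eq.
  move=> j lt; rewrite /body.
  have hj : dsem x 1 (envof (upd st 0 j)) f = dsem x 1 (upd (fun=> 0) 0 j) f.
    congr dsem; apply/funext => i; rewrite /envof /st; case: i => [|i]; first by rewrite !upd_eq.
    by rewrite !upd_ne //; lia.
  have clj : clean (2 * 1) (upd st 0 j) B.
    split=> i lti; rewrite /st; case: i lti => [|[|i]] // _; rewrite /upd /=; lia.
  have := hq x (os j) _ B _ _ clj.
  rewrite hj => /(_ leK leB) he.
  apply: exec_ite he _.
  have -> : os j.+1 = rcons (os j) (dsem x 1 (upd (fun=> 0) 0 j) f).
    by rewrite /os /mkseq -[j.+1]addn1 iotaD map_cat /= add0n cats1.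
  case: (dsem _ _ _ _); apply: (@runs_emit _ K 0 _ x (os j) (upd st 0 j) B);
    rewrite ?size_mkseq ?upd_eq //; lia.
have [G h3 hG] := exec_finish K x (os m) (upd st 0 m).
have e0 : upd st 0 0 = st by apply: upd_same.
rewrite e0 in h2.
have hx := exec_seqf (exec_setup K x) (exec_seqf h1 (exec_seqf h2 h3)).
have le : 1 + (pev q' N + (m.+1 * (pev q B + (6 * B + 12) + 2 * (6 * B + 12) + 1) +
   (2 * size (os m) + 5))) <= pev (1%:P + (q' + ((Q + 1%:P) * ((q \Po Q) +
   (18%:P * Q + 37%:P)) + (2%:P * Q + 5%:P))))%R (size x).
  have le3 : m.+1 * (pev q B + (6 * B + 12) + 2 * (6 * B + 12) + 1) <=
      (B + 1) * (pev q B + (18 * B + 37)) by apply: leq_mul; lia.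
  by rewrite size_mkseq !(pevD, pevM, pevC, pev_comp) -/N -/B; lia.
have hc := machine_run (execW hx le).
split; first exact: halted_represents hc.
exact: output_finish hc hG.
Qed.

(** * Homogeneous limits *)

Definition binsig (c : nat) : signature := @Signature 'I_c (fun _ => 2).

(** Equality of quantifier-free types in the language with the colour; the limit is homogeneous for
    these types. *)
Definition same_type (c : nat) (T T' : eqType) (r : 'I_c -> rel T) (u : pred T)
    (r' : 'I_c -> rel T') (u' : pred T') k (a : k.-tuple T) (b : k.-tuple T') :=
  [/\ forall i j, (tnth a i == tnth a j) = (tnth b i == tnth b j),
      forall s i j, r s (tnth a i) (tnth a j) = r' s (tnth b i) (tnth b j)
    & forall i, u (tnth a i) = u' (tnth b i)].

Section SameType.
Variables (c : nat) (T T' : eqType).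
Variables (r : 'I_c -> rel T) (u : pred T) (r' : 'I_c -> rel T') (u' : pred T').

Lemma same_type_sym k (a : k.-tuple T) (b : k.-tuple T') :
  same_type r u r' u' a b -> same_type r' u' r u b a.
Proof. by case=> h1 h2 h3; split=> *; rewrite (h1, h2, h3). Qed.

Lemma same_type_cons k (a : k.-tuple T) (b : k.-tuple T') x y :
  same_type r u r' u' a b ->
  (forall i, (x == tnth a i) = (y == tnth b i)) ->
  (forall s, r s x x = r' s y y) ->
  (forall s i, r s x (tnth a i) = r' s y (tnth b i)) ->
  (forall s i, r s (tnth a i) x = r' s (tnth b i) y) ->
  u x = u' y ->
  same_type r u r' u' [tuple of x :: a] [tuple of y :: b].
Proof.
case=> h1 h2 h3 e1 e2 e3 e4 e5.
have cs (P : 'I_k.+1 -> Prop) : P ord0 -> (forall i, P (lift ord0 i)) -> forall i, P i.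
  by move=> p0 ps i; case: (unliftP ord0 i) => [j|] ->.
split.
- apply: (cs) => [|i]; apply: (cs) => [|j]; rewrite ?tnth0 ?tnthS ?eqxx //.
  by rewrite eq_sym e1 eq_sym.
- by move=> s; apply: (cs) => [|i]; apply: (cs) => [|j]; rewrite ?tnth0 ?tnthS.
- by apply: (cs) => [|i]; rewrite ?tnth0 ?tnthS.
Qed.

Lemma same_type_mem k (a : k.-tuple T) (b : k.-tuple T') i :
  same_type r u r' u' a b ->
  same_type r u r' u' [tuple of tnth a i :: a] [tuple of tnth b i :: b].
Proof. by move=> h; case: (h) => h1 h2 h3; apply: same_type_cons. Qed.

End SameType.

(** * The homogeneous limit and its extension property *)

Section Limit.
Variables (c : nat) (e : 'I_c).
Variable Forb : forall T : eqType, ('I_c -> rel T) -> pred T -> seq T -> Prop.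
Hypothesis Forb_nil : forall (T : eqType) (r : 'I_c -> rel T) u, ~ Forb r u [::].
Hypothesis Forb_clique : forall (T : eqType) (r : 'I_c -> rel T) u K, Forb r u K ->
  {in K &, forall x y, x != y -> r e x y}.
(** The map has to preserve relations but not to reflect them: adding relations to a forbidden set
    leaves it forbidden. This is why omitting forbidden sets can be tested by homomorphisms. *)
Hypothesis Forb_hom : forall (T T' : eqType) (r : 'I_c -> rel T) u
    (r' : 'I_c -> rel T') u' (h : T -> T') K,
  {in K &, injective h} -> {in K &, forall x y s, r s x y -> r' s (h x) (h y)} ->
  {in K, forall x, u' (h x) = u x} -> Forb r u K -> Forb r' u' (map h K).

(** Entries of [a] are sent to the entries of [b] with the same index. The default value comes from
    an element of [K], which exists because the empty set is not forbidden. *)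
Lemma Forb_transfer (T T' : eqType) (r : 'I_c -> rel T) u (r' : 'I_c -> rel T') u'
    k (a : k.-tuple T) (b : k.-tuple T') K :
  same_type r u r' u' a b -> {subset K <= a} -> Forb r u K -> exists K', Forb r' u' K'.
Proof.
case=> h1 h2 h3 sub F; case: K sub F => [|x K] sub F; first by case: (Forb_nil F).
have /tnthP[i0 _] := sub x (mem_head _ _).
pose h y := nth (tnth b i0) b (index y a).
have hE y : y \in x :: K -> exists2 i, y = tnth a i & h y = tnth b i.
  move/sub=> ya; have lt : index y a < k by rewrite -[X in _ < X](size_tuple a) index_mem.
  exists (Ordinal lt); first by rewrite (tnth_nth y) /= nth_index.
  by rewrite /h [RHS](tnth_nth (tnth b i0)).
exists (map h (x :: K)); apply: Forb_hom F.
- move=> y z /hE[i -> ->] /hE[j -> ->] /eqP; rewrite -h1; exact: eqP.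
- by move=> y z /hE[i -> ->] /hE[j -> ->] s; rewrite h2.
- by move=> y /hE[i -> ->]; rewrite h3.
Qed.

(* A natural number codes a vertex: its colour, its loops, and its relations to
   finitely many smaller numbers; the second component of the unpickled pair only
   serves to make codes arbitrarily large.  Two vertices are unrelated unless the
   larger one lists the smaller one. *)
Definition desc : Type :=
  (bool * {ffun 'I_c -> bool} * seq (nat * {ffun 'I_c -> bool * bool}))%type.

Definition descr (n : nat) : desc :=
  if @unpickle (desc * nat)%type n is Some (d, _) then d
  else (false, [ffun=> false], [::]).

Definition look (n x : nat) : option {ffun 'I_c -> bool * bool} :=
  ohead [seq p.2 | p <- (descr n).2 & p.1 == x].

Definition nrel (s : 'I_c) : rel nat := fun x y =>
  if x == y then (s != e) && (descr x).1.2 s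
  else if x < y then (if look y x is Some f then (f s).2 else false)
  else (if look x y is Some f then (f s).1 else false).

Definition nbit : pred nat := fun x => (descr x).1.1.

(** A number is rejected if it is the largest element of some forbidden set. Every forbidden set has
    a largest element, so no forbidden set consists of good numbers. The smaller elements range over
    all numbers, good or not, which avoids a recursive definition. *)
Definition good : pred nat := fun n =>
  `[< forall K, n \in K -> {in K, forall x, x <= n} -> ~ Forb nrel nbit K >].

Definition limit := {n : nat | good n}.
Definition lrel (s : 'I_c) : rel limit := fun x y => nrel s (val x) (val y).
Definition lbit : pred limit := fun x => nbit (val x).
Definition limit_structure : structure (binsig c) limit :=
  fun R => [set t | lrel R (tnth t ord0) (tnth t ord_max)]%classic.

(** Pigeonhole: among [N.+1] distinct codes of the same description, one is not below [N]. *)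
Lemma descr_large (d : desc) N : exists2 n, N <= n & descr n = d.
Proof.
pose f k := pickle (d, k : nat).
have fd k : descr (f k) = d by rewrite /descr /f pickleK.
have [/hasP[k _ le]|no] := boolP (has (fun k => N <= f k) (iota 0 N.+1)).
  by exists (f k).
have us : uniq (map f (iota 0 N.+1)).
  rewrite map_inj_uniq ?iota_uniq // => x y /(pcan_inj pickleK) [] //.
suff : size (map f (iota 0 N.+1)) <= size (iota 0 N) by rewrite size_map !size_iota ltnn.
apply: uniq_leq_size us _ => y /mapP[k kin ->]; rewrite mem_iota add0n /=.
by move/hasPn: no => /(_ k kin); rewrite -ltnNge.
Qed.

Lemma seq_max (s : seq nat) : s != [::] -> exists2 n, n \in s & {in s, forall x, x <= n}.
Proof.
case: s => // x s _; elim: s x => [|y s IH] x.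
  by exists x; [exact: mem_head | move=> z; rewrite inE => /eqP->].
have [n ns le] := IH y; have [lt|lt] := leqP x n.
  by exists n; [rewrite inE ns orbT | move=> z; rewrite inE => /orP[/eqP->|/le]].
exists x; first exact: mem_head.
by move=> z; rewrite inE => /orP[/eqP-> //|/le zn]; apply: leq_trans zn (ltnW lt).
Qed.

Lemma limit_free (K : seq limit) : ~ Forb lrel lbit K.
Proof.
move=> F; have F' : Forb nrel nbit (map val K).
  by apply: Forb_hom F => // x y _ _; apply: val_inj.
have [|n nK le] := @seq_max (map val K).
  by case: (K) F => // /Forb_nil.
have /mapP[x _ ex] := nK; have := valP x; rewrite -ex => /asboolP gn.
exact: gn nK le F'.
Qed.

Section Extension.
Variables (T : eqType) (r : 'I_c -> rel T) (u : pred T).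
Hypothesis irr : forall x, r e x x = false.

(** The code [n] is taken above all entries of [v], so its own list decides how it is related to
    them. The last conclusion is free amalgamation: smaller E-neighbours of [n] are only those that
    the list names. *)
Lemma nat_extension k (a : k.-tuple T) (v : k.-tuple nat) x :
  same_type r u nrel nbit a v -> x \notin a ->
  exists n, [/\ same_type r u nrel nbit [tuple of x :: a] [tuple of n :: v],
    {in v, forall y, y < n} & forall y, y < n -> nrel e y n -> y \in v].
Proof.
move=> h xa; case: (h) => h1 h2 h3.
pose ty i : nat * {ffun 'I_c -> bool * bool} :=
  (tnth v i, [ffun s => (r s x (tnth a i), r s (tnth a i) x)]).
pose d : desc := (u x, [ffun s => r s x x], [seq ty i | i <- enum 'I_k]).
have [n len dn] := descr_large d (\max_(i < k) tnth v i).+1.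
have ltv i : tnth v i < n.
  by apply: leq_trans len; rewrite ltnS; apply: (leq_bigmax (F := fun i => tnth v i)).
have lookv i : look n (tnth v i) = Some (ty i).2.
  rewrite /look dn /= -/ty.
  have : has (fun p => p.1 == tnth v i) [seq ty i | i <- enum 'I_k].
    by apply/hasP; exists (ty i) => //; apply: map_f; rewrite mem_enum.
  (* Entries of [v] may repeat, but the relations listed for one number agree, since equal entries
     of [v] correspond to equal entries of [a]. *)
  have : {in [seq ty i | i <- enum 'I_k], forall p, p.1 == tnth v i -> p.2 = (ty i).2}.
    move=> p /mapP[j _ ->] /= /eqP e1; apply/ffunP => s; rewrite !ffunE.
    by have /eqP-> : tnth a j == tnth a i by rewrite h1 e1.
  elim: [seq _ | _ <- _] => //= p l IH al.
  case: ifP => /= [pi _|_ hs]; first by rewrite (al p (mem_head _ _) pi).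
  by apply: IH hs => q ql; apply: al; rewrite inE ql orbT.
exists n; split.
- apply: same_type_cons => //.
  + move=> i; have -> : (n == tnth v i) = false by have := ltv i; lia.
    by apply/negbTE/negP => /eqP ex; case/negP: xa; rewrite ex mem_tnth.
  + move=> s; rewrite /nrel eqxx dn /= ffunE.
    by have [->|] := eqVneq s e; rewrite ?irr.
  + move=> s i; rewrite /nrel; have lt := ltv i.
    have -> : (n == tnth v i) = false by lia.
    have -> : (n < tnth v i) = false by lia.
    by rewrite lookv /= ffunE.
  + move=> s i; rewrite /nrel ltv.
    have -> : (tnth v i == n) = false by have := ltv i; lia.
    by rewrite lookv /= ffunE.
  + by rewrite /nbit dn.
- by move=> y /tnthP[i ->].
- move=> y ly; rewrite /nrel ly; have -> : (y == n) = false by lia.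
  rewrite /look dn /=; case ef: [seq _ | _ <- _ & _] => [|f l] // _.
  have : f \in f :: l by apply: mem_head.
  rewrite -ef.
  case/mapP=> p; rewrite mem_filter => /andP[/eqP <- /mapP[i _ ->]] _.
  exact: mem_tnth.
Qed.

(** The new code is good: a forbidden set with largest element [n] is a clique, hence lies inside
    [n :: v], and would transfer to a forbidden set of [T]. *)
Lemma limit_extension k (a : k.-tuple T) (v : k.-tuple limit) x :
  (forall K, ~ Forb r u K) -> same_type r u lrel lbit a v ->
  exists y, same_type r u lrel lbit [tuple of x :: a] [tuple of y :: v].
Proof.
move=> free h; have [/tnthP[i ->]|xa] := boolP (x \in a).
  by exists (tnth v i); apply: same_type_mem.
have h' : same_type r u nrel nbit a [tuple of map val v].
  by case: h => h1 h2 h3; split=> *; rewrite !tnth_map (h1, h2, h3).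
have [n [hn lt nbr]] := nat_extension h' xa.
have gn : good n.
  apply/asboolP => K nK le F.
  have sub : {subset K <= [tuple of n :: [tuple of map val v]]}.
    move=> y yK; rewrite inE; have [//|ne] := eqVneq y n.
    apply: nbr; first by have := le y yK; rewrite leq_eqVlt (negbTE ne).
    by apply: (Forb_clique F).
  have [K' F'] := Forb_transfer (same_type_sym hn) sub F.
  exact: free F'.
exists (Sub n gn); case: hn => h1 h2 h3.
have e1 i : tnth [tuple of n :: [tuple of map val v]] i =
    val (tnth [tuple of (Sub n gn : limit) :: v] i).
  case: (unliftP ord0 i) => [j|] ->; last by rewrite !tnth0.
  by rewrite !tnthS tnth_map.
by split=> *; rewrite (h1, h2, h3) !e1.
Qed.

End Extension.

Lemma lrel_irr x : lrel e x x = false.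
Proof. by rewrite /lrel /nrel !eqxx. Qed.

(** Back-and-forth: the limit omits forbidden sets and has no E-loops, so the extension property
    applies to the limit itself, in both directions. *)
Lemma sat_same_type k (phi : formula (binsig c) k) (v w : k.-tuple limit) :
  same_type lrel lbit lrel lbit v w ->
  sat limit_structure phi v <-> sat limit_structure phi w.
Proof.
elim: phi v w => {k} [k i j|k R t|k f IH|k f IHf g IHg|k f IH] v w h /=.
- by case: h => h1 _ _; split=> /eqP; [rewrite h1|rewrite -h1] => /eqP.
- by case: h => _ h2 _; rewrite /limit_structure /= !tnth_map h2.
- by rewrite (IH v w).
- by rewrite (IHf v w) // (IHg v w).
- split=> -[d hd].
    have [d' h'] := limit_extension lrel_irr d limit_free h.
    by exists d'; apply/(IH _ _ h').
  have [d' h'] := limit_extension lrel_irr d limit_free (same_type_sym h).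
  by exists d'; apply/(IH _ _ h').
Qed.

Lemma limit_omega_categorical : omega_categorical limit_structure.
Proof.
move=> k _.
pose ty (v : k.-tuple limit) : {ffun 'I_k * 'I_k -> bool * {ffun 'I_c -> bool} * bool} :=
  [ffun p => (tnth v p.1 == tnth v p.2, [ffun s => lrel s (tnth v p.1) (tnth v p.2)],
     lbit (tnth v p.1))].
have tyP v w : ty v = ty w -> same_type lrel lbit lrel lbit v w.
  move=> /ffunP h; split=> [i j|s i j|i].
  - by have := h (i, j); rewrite !ffunE => -[].
  - by have := h (i, j); rewrite !ffunE => -[_ /ffunP/(_ s)]; rewrite !ffunE.
  - by have := h (i, i); rewrite !ffunE => -[].
(* A definable set is a union of type classes, hence one of the finitely many sets [X A]. *)
pose X (A : {set {ffun 'I_k * 'I_k -> bool * {ffun 'I_c -> bool} * bool}}) :=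
  [set v | ty v \in A]%classic.
apply: (@sub_finite_set _ _ (X @` setT)%classic); last by apply: finite_image.
move=> Y [phi ->].
exists [set t | `[< exists2 v, ty v = t & sat limit_structure phi v >]] => //.
apply/seteqP; split=> v /=; rewrite /X /= inE.
  by move=> /asboolP[w /tyP/sat_same_type <-].
by move=> hv; apply/asboolP; exists v.
Qed.

Lemma limit_countable : countable [set: limit].
Proof. exact: countableP. Qed.

Definition brel m (B : fin_structure (binsig c) m) (s : 'I_c) : rel 'I_m :=
  fun i j => B s [tuple i; j].

(** A homomorphism pulls the colour back, and it is injective on cliques because the limit has no
    E-loops. Conversely, iterating the one-point extension over all vertices yields even an
    embedding of the coloured structure. *)
Lemma limit_homomorphic m (B : fin_structure (binsig c) m) :
  homomorphic B limit_structure <->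
  (forall i, brel B e i i = false) /\ exists u, forall K, ~ Forb (brel B) u K.
Proof.
split=> [[h hh]|[irr [u free]]].
  have hB s i j : brel B s i j -> lrel s (h i) (h j).
    by move=> /hh; rewrite /limit_structure /= !(tnth_nth (h i)).
  split=> [i|].
    by apply/negbTE/negP => /hB; rewrite lrel_irr.
  exists (fun i => lbit (h i)) => K F; apply: (@limit_free (map h K)).
  have F' := F; apply: Forb_hom F' => //; last by move=> x y _ _ s; apply: hB.
  move=> x y xK yK exy; apply/eqP; apply/negPn/negP => ne.
  by have := hB _ _ _ (Forb_clique F xK yK ne); rewrite exy lrel_irr.
have ex k (a : k.-tuple 'I_m) : exists v, same_type (brel B) u lrel lbit a v.
  elim: k a => [|k IH] a; first by exists [tuple]; split=> [[]|s []|[]].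
  case/tupleP: a => x a; have [v hv] := IH a.
  by have [y hy] := limit_extension irr x free hv; exists [tuple of y :: v].
have [v [_ h2 _]] := ex m (ord_tuple m).
exists (tnth v) => R t Rt; rewrite /limit_structure /= !tnth_map.
rewrite -[tnth t ord0]tnth_ord_tuple -[tnth t ord_max]tnth_ord_tuple -h2.
rewrite !tnth_ord_tuple /brel; suff <- : t = [tuple tnth t ord0; tnth t ord_max] by [].
by apply: eq_from_tnth => -[[|[|i]] lt] //; rewrite [RHS](tnth_nth (tnth t ord0)) /=;
  congr tnth; apply: val_inj.
Qed.

End Limit.

(** * Alternating quantifiers and forbidden structures *)

Fixpoint alt (X : Type) (ex : bool) (k : nat) (P : seq X -> Prop) : Prop :=
  if k is k'.+1 then
    if ex then exists u, alt false k' (fun us => P (u :: us))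
    else forall u, alt true k' (fun us => P (u :: us))
  else P [::].

Fixpoint related (X Y : Type) (R : nat -> X -> Y -> Prop) (i : nat) xs ys : Prop :=
  match xs, ys with
  | x :: xs', y :: ys' => R i x y /\ related R i.+1 xs' ys'
  | [::], [::] => True
  | _, _ => False
  end.

Lemma related_rev (X Y : Type) (R : nat -> X -> Y -> Prop) i xs ys :
  related R i xs ys -> related (fun j y x => R j x y) i ys xs.
Proof. by elim: xs ys i => [|x xs IH] [|y ys] i //= [h /IH]. Qed.

Lemma related_size (X Y : Type) (R : nat -> X -> Y -> Prop) i xs ys :
  related R i xs ys -> size xs = size ys.
Proof. by elim: xs ys i => [|x xs IH] [|y ys] i //= [_ /IH->]. Qed.

Lemma related_nth (X Y : Type) (R : nat -> X -> Y -> Prop) i xs ys x0 y0 b :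
  related R i xs ys -> b < size xs -> R (i + b) (nth x0 xs b) (nth y0 ys b).
Proof.
elim: xs ys i b => [|x xs IH] [|y ys] i //= [|b] [h hs] lt; first by rewrite addn0.
by rewrite -addSnnS; apply: IH.
Qed.

Lemma alt_related (X Y : Type) (R : nat -> X -> Y -> Prop) ex k i P Q :
  (forall j x, i <= j -> exists y, R j x y) -> (forall j y, i <= j -> exists x, R j x y) ->
  (forall xs ys, size xs = k -> related R i xs ys -> P xs -> Q ys) ->
  alt ex k P -> alt ex k Q.
Proof.
move=> hR hR'; elim: k ex i P Q hR hR' => [|k IH] ex i P Q hR hR' h /=.
  exact: h.
case: ex => [[x hx]|hx].
  have [y xy] := hR i x (leqnn i); exists y; apply: (IH _ i.+1 _ _ _ _ _ hx).
  - by move=> j x' /ltnW; apply: hR.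
  - by move=> j x' /ltnW; apply: hR'.
  - by move=> xs ys sz hs; apply: h => //=; rewrite sz.
move=> y; have [x xy] := hR' i y (leqnn i); apply: (IH _ i.+1 _ _ _ _ _ (hx x)).
- by move=> j x' /ltnW; apply: hR.
- by move=> j x' /ltnW; apply: hR'.
- by move=> xs ys sz hs; apply: h => //=; rewrite sz.
Qed.

Lemma alt_related_iff (X Y : Type) (R : nat -> X -> Y -> Prop) ex k P Q :
  (forall j x, exists y, R j x y) -> (forall j y, exists x, R j x y) ->
  (forall xs ys, size xs = k -> related R 0 xs ys -> P xs <-> Q ys) ->
  alt ex k P <-> alt ex k Q.
Proof.
move=> hR hR' h; split.
  apply: (alt_related (R := R) (i := 0)) => // xs ys sz hs.
  by have [] := h _ _ sz hs.
apply: (alt_related (R := fun j y x => R j x y) (i := 0)) => // ys xs sz hs.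
have hs' := related_rev hs; have [] // := h xs ys _ hs'.
by rewrite (related_size hs').
Qed.

Lemma eq_alt (X : Type) ex k (P Q : seq X -> Prop) :
  (forall xs, size xs = k -> P xs <-> Q xs) -> alt ex k P <-> alt ex k Q.
Proof.
move=> h; apply: (alt_related_iff (R := fun _ x y => x = y)); try by move=> _ x; exists x.
move=> xs ys sz hs; suff <- : xs = ys by apply: h.
by elim: xs ys {sz} 0 hs => [|x xs IH] [|y ys] i //= [-> /IH->].
Qed.

Lemma alt_not (X : Type) ex k (P : seq X -> Prop) :
  ~ alt ex k P <-> alt (~~ ex) k (fun us => ~ P us).
Proof.
elim: k ex P => [|k IH] [] P //=.
- rewrite -forallNP; split=> h x; [apply/(IH false)|apply/(IH false)]; exact: h.
- rewrite -existsNP; split=> -[x h]; exists x; apply/(IH true); exact: h.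
Qed.

Lemma alt_const (X : Type) (x0 : X) ex k (P : Prop) : alt ex k (fun _ : seq X => P) <-> P.
Proof.
elim: k ex => [|k IH] [] //=; split.
- by case=> x /IH.
- by move=> h; exists x0; apply/IH.
- by move/(_ x0)/IH.
- by move=> h x; apply/IH.
Qed.

Lemma alt_witness (X : Type) (x0 : X) ex k (P : seq X -> Prop) :
  alt ex k P -> exists us, P us.
Proof.
elim: k ex P => [|k IH] ex P /=; first by exists [::].
case: ex => [[x /IH[us]]|/(_ x0)/IH[us]]; first by exists (x :: us).
by exists (x0 :: us).
Qed.

(** [alt] unfolds from the outside, whereas the tableau lives in the innermost block; this exposes
    that block, whose quantifier is given by parity. *)
Lemma alt_last (X : Type) ex k (P : seq X -> Prop) :
  alt ex k.+1 P <-> alt ex k (fun us =>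
    if ex (+) odd k then exists u, P (rcons us u) else forall u, P (rcons us u)).
Proof.
elim: k ex P => [|k IH] ex P; first by case: ex.
case: ex.
  rewrite (_ : true (+) odd k.+1 = false (+) odd k); last by rewrite /= negbK.
  by split=> -[y hy]; exists y; apply/(IH false (fun us => P (y :: us))).
by split=> hy y; apply/(IH true (fun us => P (y :: us))); apply: hy.
Qed.

Lemma alternateE ex k m (P : seq (seq bool) -> Prop) :
  alternate ex k m P <-> alt ex k (fun us : seq (m.-tuple bool) => P (map val us)).
Proof.
elim: k ex P => [|k IH] [] P //=.
- by split=> -[u hu]; exists u; apply/(IH false (fun us => P (val u :: us))).
- by split=> hu u; apply/(IH true (fun us => P (val u :: us))); apply: hu.
Qed.

(** * Quantified CNF formulas as forbidden structures *)

Section Forbidden.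
Variable nb : nat.
Definition nsym := (2 * nb).+2.
Definition symE : 'I_nsym := inord 0.
Definition symS : 'I_nsym := inord 1.
Definition symL (b : nat) (s : bool) : 'I_nsym := inord (2 + 2 * b + s).

(* Each vertex is both a clause and, for each quantifier block [b], a Boolean
   variable [us_b x]; [symL b s] relates a clause to the variables of block [b]
   that it contains with sign [s]. *)
Definition bad (T : eqType) (r : 'I_nsym -> rel T) (K : seq T) (us : seq (pred T)) :=
  [/\ K != [::],
      {in K &, forall x y, x != y -> r symE x y},
      {in K, forall x, exists2 y, y \in K & r symS x y}
    & {in K, forall x, exists2 y, y \in K &
        exists b s, [/\ b < nb, r (symL b s) x y & nth xpred0 us b y = s]}].

(* If [hid], the first block of variables is the vertex colour of the limit, which is
   not in the signature, so that a homomorphism has to guess it. *)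
Variable hid : bool.

Definition forbidden (T : eqType) (r : 'I_nsym -> rel T) (u : pred T) (K : seq T) :=
  alt true (nb - hid) (fun us => bad r K (if hid then u :: us else us)).

Lemma forbidden_bad (T : eqType) (r : 'I_nsym -> rel T) u K :
  forbidden r u K -> exists us, bad r K us.
Proof. by case/(alt_witness xpred0) => us h; eexists; apply: h. Qed.

Lemma forbidden_nil (T : eqType) (r : 'I_nsym -> rel T) u : ~ forbidden r u [::].
Proof. by case/forbidden_bad => us []. Qed.

Lemma forbidden_clique (T : eqType) (r : 'I_nsym -> rel T) u K : forbidden r u K ->
  {in K &, forall x y, x != y -> r symE x y}.
Proof. by case/forbidden_bad => us []. Qed.

Lemma bad_hom (T T' : eqType) (r : 'I_nsym -> rel T) (r' : 'I_nsym -> rel T')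
    (h : T -> T') K us us' :
  {in K &, injective h} -> {in K &, forall x y s, r s x y -> r' s (h x) (h y)} ->
  (forall b, b < nb -> {in K, forall x, nth xpred0 us' b (h x) = nth xpred0 us b x}) ->
  bad r K us -> bad r' (map h K) us'.
Proof.
move=> inj hr hu [h1 h2 h3 h4]; split; first by case: (K) h1.
- move=> _ _ /mapP[x xK ->] /mapP[y yK ->] ne; apply: hr => //; apply: h2 => //.
  by apply: contraNN ne => /eqP->.
- move=> _ /mapP[x xK ->]; have [y yK rxy] := h3 x xK.
  by exists (h y); [apply: map_f | apply: hr].
- move=> _ /mapP[x xK ->]; have [y yK [b [s [lt rxy e]]]] := h4 x xK.
  exists (h y); first exact: map_f.
  by exists b, s; split=> //; [apply: hr | rewrite hu].
Qed.

Lemma forbidden_hom (T T' : eqType) (r : 'I_nsym -> rel T) u (r' : 'I_nsym -> rel T') u'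
    (h : T -> T') K :
  {in K &, injective h} -> {in K &, forall x y s, r s x y -> r' s (h x) (h y)} ->
  {in K, forall x, u' (h x) = u x} -> forbidden r u K -> forbidden r' u' (map h K).
Proof.
move=> inj hr hu; rewrite /forbidden.
pose R (_ : nat) (v : pred T) (v' : pred T') := {in K, forall x, v' (h x) = v x}.
apply: (alt_related (R := R) (i := 0)).
(* The image colouring agrees with [v] along [h] because [h] is injective on [K]. *)
- move=> j v _; exists (fun y => has (fun x => (h x == y) && v x) K) => x xK.
  apply/hasP/idP => [[y yK /andP[/eqP e vy]]|vx].
    by rewrite -(inj _ _ yK xK e).
  by exists x; rewrite ?eqxx.
- by move=> j v _; exists (fun x => v (h x)).
- move=> us us' sz hs; apply: bad_hom => // b lt x xK.
  have hn vs vs' i j : related R i vs vs' -> nth xpred0 vs' j (h x) = nth xpred0 vs j x.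
    move=> hvs; have [lt'|ge] := ltnP j (size vs).
      exact: (related_nth xpred0 xpred0 hvs lt').
    by rewrite !nth_default // -(related_size hvs).
  by case: (hid); [case: b lt => [|b] _ /=; [exact: hu | exact: hn hs] | exact: hn hs].
Qed.

Definition template : structure (binsig nsym) (limit symE forbidden) :=
  @limit_structure _ symE forbidden.
Arguments template : clear implicits.

Lemma template_homomorphic m (B : fin_structure (binsig nsym) m) :
  homomorphic B template <->
  (forall i, brel B symE i i = false) /\ exists u, forall K, ~ forbidden (brel B) u K.
Proof.
exact: (limit_homomorphic forbidden_nil forbidden_clique forbidden_hom).
Qed.

Lemma template_omega_categorical : omega_categorical template.
Proof.
exact: (limit_omega_categorical forbidden_nil forbidden_clique forbidden_hom).
Qed.

Lemma template_countable : countable [set: limit symE forbidden].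
Proof. exact: limit_countable. Qed.

End Forbidden.
Arguments template nb hid : clear implicits.

(** * Encodings of structures *)

Section Encoding.
Variable c : nat.

Definition position (m s i j : nat) := m + 1 + s * m * m + i * m + j.

(** Each default of [nth] is the opposite of the required value, so each equation also says that the
    position lies within the word. *)
Definition is_encoding (x : seq bool) (m : nat) :=
  [/\ size x = m + 1 + c * m * m, nth true x m = false
    & forall i, i < m -> nth false x i = true].

Definition decode (x : seq bool) (m : nat) : fin_structure (binsig c) m :=
  fun R t => nth false x (position m (R : 'I_c) (tnth t ord0) (tnth t ord_max)).
Arguments decode x m : clear implicits.

Lemma nth_flatten_uniform (X Y : Type) (x0 : X) (d : Y) (F : X -> seq Y) k s q r :
  (forall x, size (F x) = k) -> q < size s -> r < k ->
  nth d (flatten (map F s)) (q * k + r) = nth d (F (nth x0 s q)) r.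
Proof.
move=> sz; elim: s q => // x s IH [|q] /= lt ltr; rewrite nth_cat sz.
  by rewrite mul0n add0n ltr.
by rewrite mulSn -addnA ltnNge leq_addr /= addKn; apply: IH.
Qed.

Lemma size_flatten_uniform (X Y : Type) (F : X -> seq Y) k s :
  (forall x, size (F x) = k) -> size (flatten (map F s)) = size s * k.
Proof. by move=> sz; elim: s => //= x s IH; rewrite size_cat sz IH mulSn. Qed.

Lemma size_lex_tuples m k : size (lex_tuples m k) = m ^ k.
Proof.
elim: k => //= k IH; rewrite (size_flatten_uniform (k := m ^ k)).
  by rewrite size_enum_ord expnS.
by move=> x; rewrite size_map.
Qed.

Lemma nth_lex_tuples m t0 (i j : 'I_m) : nth t0 (lex_tuples m 2) (i * m + j) = [tuple i; j].
Proof.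
rewrite /= (@nth_flatten_uniform _ _ i t0 _ m); last first.
- exact: ltn_ord.
- by rewrite size_enum_ord ltn_ord.
- by move=> x; rewrite size_map (size_lex_tuples m 1) expn1.
rewrite (nth_map [tuple j]); last by rewrite (size_lex_tuples m 1) expn1 ltn_ord.
rewrite nth_ord_enum.
have -> : nth [tuple j] (lex_tuples m 1) j = [tuple j].
  have := @nth_flatten_uniform _ _ j [tuple j]
    (fun i => [seq cons_tuple i t | t <- [:: nil_tuple 'I_m]]) 1 (enum 'I_m) j 0.
  rewrite muln1 addn0 => -> //; last by rewrite size_enum_ord.
  by rewrite /= nth_ord_enum; apply: val_inj.
exact: val_inj.
Qed.

Lemma size_encode m (B : fin_structure (binsig c) m) :
  size (encode B) = m + 1 + c * m * m.
Proof.
rewrite /encode size_cat size_nseq /= (size_flatten_uniform (k := m ^ 2)).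
  by rewrite size_enum_ord; lia.
by move=> R; rewrite size_map size_lex_tuples.
Qed.

Lemma nth_encode m (B : fin_structure (binsig c) m) (R : 'I_c) (i j : 'I_m) :
  nth false (encode B) (position m R i j) = brel B R i j.
Proof.
rewrite /encode /position nth_cat size_nseq.
have -> : (m + 1 + R * m * m + i * m + j < m) = false by lia.
have -> : m + 1 + R * m * m + i * m + j - m = (R * (m ^ 2) + (i * m + j)).+1.
  by rewrite -mulnn; lia.
have lt : i * m + j < m ^ 2.
  by have := ltn_ord i; have := ltn_ord j; rewrite -mulnn; nia.
rewrite /= (@nth_flatten_uniform _ _ R) ?size_enum_ord //; last first.
  by move=> S; rewrite size_map size_lex_tuples.
rewrite (nth_map [tuple i; j]) ?size_lex_tuples // nth_ord_enum.
by rewrite nth_lex_tuples.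
Qed.

Lemma encode_is_encoding m (B : fin_structure (binsig c) m) : is_encoding (encode B) m.
Proof.
split; first exact: size_encode.
  by rewrite /encode nth_cat size_nseq ltnn subnn.
by move=> i lt; rewrite /encode nth_cat size_nseq lt nth_nseq lt.
Qed.

Lemma decodeK m (B : fin_structure (binsig c) m) : decode (encode B) m = B.
Proof.
apply: functional_extensionality_dep => R; apply/funext => t; rewrite /decode nth_encode /brel.
congr (B R _); apply: eq_from_tnth => -[[|[|i]] lt] //;
  rewrite (tnth_nth (tnth t ord0)) /=; congr tnth; exact: val_inj.
Qed.

Lemma position_surj m p : m < p -> p < m + 1 + c * m * m ->
  exists (R : 'I_c) (i j : 'I_m), p = position m R i j.
Proof.
move=> gt lt; have mgt0 : 0 < m by case: (m) lt gt => //; lia.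
pose q := p - (m + 1); have ep : p = m + 1 + q by rewrite /q; lia.
have ltq : q < c * m * m by rewrite /q; lia.
have ltR : q %/ (m * m) < c by rewrite ltn_divLR ?mulnA // muln_gt0 mgt0.
have lti : q %% (m * m) %/ m < m by rewrite ltn_divLR // ltn_mod muln_gt0 mgt0.
have ltj : q %% (m * m) %% m < m by rewrite ltn_mod.
exists (Ordinal ltR), (Ordinal lti), (Ordinal ltj).
rewrite /position /= -[_ * m * m]mulnA -!addnA -(divn_eq (q %% (m * m)) m).
by rewrite -divn_eq ep addnA.
Qed.

Lemma encodeK x m : is_encoding x m -> encode (decode x m) = x.
Proof.
case=> sz hm hi; apply: (@eq_from_nth _ false); first by rewrite size_encode.
move=> p; rewrite size_encode => lt.
have [h1 h2 h3] := encode_is_encoding (decode x m).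
have [ltp|gt|->] := ltngtP p m; first by rewrite hi // h3.
  by have [R [i [j ->]]] := position_surj gt lt; rewrite nth_encode.
rewrite (set_nth_default true) ?h2 1?(set_nth_default true) ?hm //; last by rewrite h1; lia.
by rewrite sz; lia.
Qed.

Lemma is_encoding_inj x m m' : is_encoding x m -> is_encoding x m' -> m = m'.
Proof.
case=> sz hm hi [sz' hm' hi']; case: (ltngtP m m') => // lt.
  by have := hi' _ lt; rewrite (set_nth_default true) ?hm //; lia.
by have := hi _ lt; rewrite (set_nth_default true) ?hm' //; lia.
Qed.

Lemma CSP_encoding (D : Type) (I : structure (binsig c) D) x :
  CSP I x <-> exists2 m, is_encoding x m & homomorphic (decode x m) I.
Proof.
split=> [[m [B [-> h]]]|[m enc h]].
  by exists m; [apply: encode_is_encoding | rewrite decodeK].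
by exists m, (decode x m); rewrite encodeK.
Qed.

Lemma CSP_encode (D : Type) (I : structure (binsig c) D) m (B : fin_structure (binsig c) m) :
  CSP I (encode B) <-> homomorphic B I.
Proof.
rewrite CSP_encoding; split=> [[m' enc]|h].
  by rewrite -(is_encoding_inj (encode_is_encoding B) enc) decodeK.
by exists m; [apply: encode_is_encoding | rewrite decodeK].
Qed.

Lemma brel_decode x m s i j : brel (decode x m) s i j = nth false x (position m s i j).
Proof. by []. Qed.

End Encoding.
Arguments decode {c} x m.

(** * Membership *)

(** A layer with semantics in [Prop] and disjunctions over finite types, into which the verifier and
    the tableau clauses can be transcribed connective by connective. *)
Inductive pform (A : Type) :=
| PEq of dterm & dterm
| PLet of A & dterm
| PNot of pform A
| PAnd of pform A & pform A
| POr of pform A & pform A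
| PImp of pform A & pform A
| PEx of dterm & pform A
| PAll of dterm & pform A
| PSome (I : finType) of (I -> pform A).
Arguments PEq {A}.

Fixpoint psem (A : Type) (w : seq A) (d : nat) (e : nat -> nat) (f : pform A) : Prop :=
  match f with
  | PEq a b => dval (size w) e a = dval (size w) e b
  | PLet x t => onth w (dval (size w) e t) = Some x
  | PNot g => ~ psem w d e g
  | PAnd g h => psem w d e g /\ psem w d e h
  | POr g h => psem w d e g \/ psem w d e h
  | PImp g h => psem w d e g -> psem w d e h
  | PEx t g => exists2 x, x < dval (size w) e t & psem w d.+1 (upd e d x) g
  | PAll t g => forall x, x < dval (size w) e t -> psem w d.+1 (upd e d x) g
  | PSome J F => exists i : J, psem w d e (F i)
  end.

Fixpoint pwf (A : Type) (d : nat) (f : pform A) : Prop :=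
  match f with
  | PEq a b => twf d a && twf d b
  | PLet _ t => twf d t
  | PNot g => pwf d g
  | PAnd g h | POr g h | PImp g h => pwf d g /\ pwf d h
  | PEx t g | PAll t g => twf d t /\ pwf d.+1 g
  | PSome J F => forall i : J, pwf d (F i)
  end.

Definition dor (A : Type) (g h : dform A) := DNot (DAnd (DNot g) (DNot h)).
Definition dfalse (A : Type) : dform A := DEq (TConst 0) (TConst 1).

Fixpoint compile (A : Type) (f : pform A) : dform A :=
  match f with
  | PEq a b => DEq a b
  | PLet x t => DLet x t
  | PNot g => DNot (compile g)
  | PAnd g h => DAnd (compile g) (compile h)
  | POr g h => dor (compile g) (compile h)
  | PImp g h => dor (DNot (compile g)) (compile h)
  | PEx t g => DEx t (compile g)
  | PAll t g => DNot (DEx t (DNot (compile g)))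
  | PSome J F => foldr (fun i g => dor (compile (F i)) g) (dfalse A) (enum J)
  end.

Lemma fwf_compile (A : Type) d (f : pform A) : pwf d f -> fwf d (compile f).
Proof.
elim: f d => //=.
- by move=> g IHg h IHh d [/IHg-> /IHh->].
- by move=> g IHg h IHh d [/IHg-> /IHh->].
- by move=> g IHg h IHh d [/IHg-> /IHh->].
- by move=> t g IH d [-> /IH->].
- by move=> t g IH d [-> /IH->].
- move=> J F IH d wf; elim: (enum J) => //= i s ->.
  by rewrite (IH i d (wf i)).
Qed.

Lemma dsem_or (A : eqType) w d e (g h : dform A) :
  dsem w d e (dor g h) = dsem w d e g || dsem w d e h.
Proof. by rewrite /= negb_and !negbK. Qed.

Lemma has_iotaP (p : pred nat) n : reflect (exists2 x, x < n & p x) (has p (iota 0 n)).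
Proof.
apply: (iffP hasP) => -[x h px]; exists x => //.
  by move: h; rewrite mem_iota.
by rewrite mem_iota.
Qed.

Lemma psem_compile (A : eqType) (w : seq A) d e (f : pform A) :
  psem w d e f <-> dsem w d e (compile f).
Proof.
elim: f d e => [a b|x t|g IH|g IHg h IHh|g IHg h IHh|g IHg h IHh|t g IH|t g IH|J F IH] d e.
- by split=> /eqP.
- by split=> /eqP.
- by split=> [h|/negP h]; [apply/negP|]; rewrite /= IH // in h *.
- by rewrite /= IHg IHh; split=> /andP.
- by rewrite [compile _]/= dsem_or /= IHg IHh; split=> /orP.
- rewrite [compile _]/= dsem_or /= IHg IHh; split; first by move/implyP; rewrite implybE.
  by rewrite -implybE => /implyP.
- by rewrite /=; split=> [[x lt /IH h]|/has_iotaP[x lt /IH h]];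
    [apply/has_iotaP|]; exists x.
- rewrite /=; split=> [h|/negP h x lt].
    by apply/negP => /has_iotaP[x lt /negP]; apply; apply/IH; apply: h.
  apply/IH/negPn/negP => hx; apply: h; apply/has_iotaP; by exists x.
- have -> : dsem w d e (compile (PSome F)) = has (fun i => dsem w d e (compile (F i))) (enum J).
    by rewrite [compile _]/=; elim: (enum J) => // i s IHs; rewrite [foldr _ _ _]/= dsem_or IHs.
  split=> [[i /IH h]|/hasP[i _ /IH h]]; last by exists i.
  by apply/hasP; exists i; rewrite ?mem_enum.
Qed.

Lemma pform_decidable (A : finType) (f : pform A) (L : language A) :
  pwf 0 f -> (forall w, L w <-> psem w 0 (fun=> 0) f) -> polytime_decidable L.
Proof.
move=> wf hL; apply: (dform_decidable (fwf_compile wf)) => w.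
by rewrite hL psem_compile.
Qed.

Lemma pform_computable (F : seq bool -> seq bool) (t : dterm) (f : pform bool) :
  twf 0 t -> pwf 1 f ->
  (forall w, size (F w) = dval (size w) (fun=> 0) t) ->
  (forall w i, i < size (F w) -> nth false (F w) i <-> psem w 1 (upd (fun=> 0) 0 i) f) ->
  polytime_computable F.
Proof.
move=> wft wf sz hF; apply: (dform_computable wft (fwf_compile wf)) => w.
apply: (@eq_from_nth _ false); first by rewrite size_mkseq.
move=> i lt; rewrite nth_mkseq -?sz //; apply/idP/idP.
  by move/(hF w i lt)/psem_compile.
by move/psem_compile/(hF w i lt).
Qed.

Lemma size_join_words l x us : (forall u, u \in us -> size u = l) ->
  size (join_words x us) = size x + size us * l.+1.
Proof.
rewrite /join_words size_cat size_map => h; congr addn.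
elim: us h => //= u us IH h; rewrite size_cat size_map h ?mem_head // mulSn.
by rewrite IH // => v vin; apply: h; rewrite inE vin orbT.
Qed.

Lemma onth_some (T : Type) (x0 : T) s i : i < size s -> onth s i = Some (nth x0 s i).
Proof. by elim: s i => // x s IH [|i] //= lt; rewrite IH. Qed.

Lemma onth_join_prefix x us p : p < size x ->
  onth (join_words x us) p = Some (Some (nth false x p)).
Proof.
by move=> lt; rewrite onth_cat size_map lt (onth_some None) ?size_map // (nth_map false).
Qed.

Lemma onth_blocks l us b i : (forall u, u \in us -> size u = l) -> b < size us -> i <= l ->
  onth (flatten [seq None :: map Some u | u <- us]) (b * l.+1 + i) =
  Some (if i is i'.+1 then Some (nth false (nth [::] us b) i') else None).
Proof.
elim: us b => // u us IH [|b] h lt lei.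
  rewrite [flatten _]/= mul0n add0n -cat_cons onth_cat /= size_map h ?mem_head // ltnS lei.
  case: i lei {IH} => //= i lei; rewrite (onth_some None) ?size_map ?h ?mem_head //.
  by rewrite (nth_map false) // h ?mem_head.
rewrite [flatten _]/= -cat_cons onth_cat /= size_map h ?mem_head //.
rewrite mulSn -addnA ltnNge leq_addr /= addKn.
by apply: IH => // v vin; apply: h; rewrite inE vin orbT.
Qed.

Lemma onth_join_sep l x us b : (forall u, u \in us -> size u = l) -> b < size us ->
  onth (join_words x us) (size x + b * l.+1) = Some None.
Proof.
move=> h lt; rewrite onth_cat size_map ltnNge leq_addr /= addKn.
by rewrite -[X in onth _ X]addn0 (onth_blocks h lt).
Qed.

Lemma onth_join_word l x us b i : (forall u, u \in us -> size u = l) -> b < size us ->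
  i < l -> onth (join_words x us) (size x + b * l.+1 + i.+1) =
  Some (Some (nth false (nth [::] us b) i)).
Proof.
move=> h lt lti; rewrite onth_cat size_map ltnNge -addnA leq_addr /= addKn.
by rewrite (onth_blocks h lt).
Qed.

(** * The verifier as a bounded formula *)

Section Verifier.
Variables (nb kap : nat).
Hypothesis kap_lt : kap < nb.
Local Notation c := (nsym nb).
Local Notation V := TVar.
Local Notation C := TConst.
Local Notation "a +t b" := (TAdd a b) (at level 50, left associativity).
Local Notation "a *t b" := (TMul a b) (at level 40, left associativity).

(* Variable 0 is the length of the instance, 1 its number of vertices [m].  The word of
   block [kap] codes, besides the values of that block, the set of vertices of the
   candidate forbidden part, by its bits from [m] on. *)
Definition tpos m s i j := m +t C 1 +t s *t m *t m +t i *t m +t j.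
Definition prel (s : 'I_c) i j : pform (option bool) :=
  PLet (Some true) (tpos (V 1) (C s) (V i) (V j)).
Definition pbit b t : pform (option bool) :=
  PLet (Some true) (V 0 +t C b *t (V 0 +t C 1) +t (t +t C 1)).
Definition pmem i := pbit kap (V 1 +t V i).
Definition penc : pform (option bool) :=
  PAnd (PEq (V 0) (V 1 +t C 1 +t C c *t V 1 *t V 1))
    (PAnd (PLet (Some false) (V 1)) (PAll (V 1) (PLet (Some true) (V 2)))).
Definition pbad : pform (option bool) :=
  PAnd (PEx (V 1) (pmem 2))
 (PAnd (PAll (V 1) (PAll (V 1) (PImp (pmem 2) (PImp (pmem 3)
         (PImp (PNot (PEq (V 2) (V 3))) (prel (symE nb) 2 3))))))
 (PAnd (PAll (V 1) (PImp (pmem 2) (PEx (V 1) (PAnd (pmem 3) (prel (symS nb) 2 3)))))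
       (PAll (V 1) (PImp (pmem 2) (PEx (V 1) (PAnd (pmem 3)
         (PSome (fun b : 'I_nb => PSome (fun s : bool =>
           PAnd (prel (symL nb b s) 2 3)
             (if s then pbit b (V 3) else PNot (pbit b (V 3)))))))))))).
(** Accepts evidence against membership. The length of the instance is recovered as the position of
    the first separator. A word that encodes no structure and an E-loop count as evidence whatever
    the guessed blocks are. *)
Definition pverify : pform (option bool) :=
  PEx TLen (PAnd (PAnd (PLet None (V 0)) (PAll (V 0) (PNot (PLet None (V 1)))))
    (POr (PNot (PEx (V 0) penc))
         (PEx (V 0) (PAnd penc (POr (PEx (V 1) (prel (symE nb) 2 2)) pbad))))).

Lemma pverify_wf : pwf 0 pverify.
Proof. by do !split=> //; match goal with |- context [if ?s then _ else _] => case: s end. Qed.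

Section Word.
Variables (x : seq bool) (us : seq (seq bool)).
Hypothesis size_us : size us = nb.
Hypothesis size_u : forall u, u \in us -> size u = size x.
Local Notation y := (join_words x us).

Definition chosen m : seq 'I_m :=
  filter (fun i : 'I_m => nth false (nth [::] us kap) (m + i)) (enum 'I_m).
Definition assign m : seq (pred 'I_m) :=
  [seq (fun i : 'I_m => nth false u i) | u <- us].

Lemma position_lt m (s : 'I_c) i j : is_encoding c x m -> i < m -> j < m ->
  position m s i j < size x.
Proof.
case=> -> _ _ lti ltj; rewrite /position.
have h1 : i * m + j < m * m by nia.
have h2 : s.+1 * (m * m) <= c * (m * m) by rewrite leq_mul2r ltn_ord orbT.
by move: h1 h2; rewrite mulSn !mulnA; lia.
Qed.

Lemma onth_rel m (s : 'I_c) (i j : 'I_m) : is_encoding c x m ->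
  onth y (position m s i j) = Some (Some true) <-> brel (@decode c x m) s i j.
Proof.
move=> enc; rewrite onth_join_prefix ?position_lt // brel_decode.
by split=> [[]|->].
Qed.

Lemma onth_bit b i : b < nb -> i < size x ->
  onth y (size x + b * (size x + 1) + (i + 1)) = Some (Some true) <->
  nth false (nth [::] us b) i.
Proof.
move=> ltb lti; rewrite !addn1 (onth_join_word _ size_u) ?size_us //.
by split=> [[]|->].
Qed.

Lemma mem_chosen m (i : 'I_m) : is_encoding c x m ->
  onth y (size x + kap * (size x + 1) + (m + i + 1)) = Some (Some true) <->
  i \in chosen m.
Proof.
move=> enc; rewrite onth_bit //.
  by rewrite /chosen mem_filter mem_enum andbT.
by case: enc => -> _ _; have := ltn_ord i; rewrite /nsym; nia.
Qed.

Lemma nth_assign m b (i : 'I_m) : is_encoding c x m -> b < nb ->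
  onth y (size x + b * (size x + 1) + (i + 1)) = Some (Some true) <->
  nth xpred0 (assign m) b i.
Proof.
move=> enc ltb; rewrite onth_bit //.
  by rewrite (nth_map [::]) ?size_us.
by case: enc => -> _ _; have := ltn_ord i; nia.
Qed.

Lemma psem_pbad m e : is_encoding c x m -> e 0 = size x -> e 1 = m ->
  psem y 2 e pbad <-> @bad nb _ (brel (@decode c x m)) (chosen m) (assign m).
Proof.
move=> enc e0 e1; rewrite /= /upd /= !e0 !e1; split.
- case=> -[i0 lt0 h0] [h1 [h2 h3]]; split.
  + by apply/eqP => ek; move/(mem_chosen (Ordinal lt0) enc): h0; rewrite ek.
  + move=> i j /(mem_chosen _ enc) hi /(mem_chosen _ enc) hj ne.
    apply/(onth_rel _ _ _ enc); apply: h1 => // eij.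
    by move: ne; rewrite -val_eqE /= eij eqxx.
  + move=> i /(mem_chosen _ enc) hi; have [j ltj [hj hr]] := h2 i (ltn_ord i) hi.
    exists (Ordinal ltj); first exact/(mem_chosen _ enc).
    exact/(onth_rel _ _ _ enc).
  + move=> i /(mem_chosen _ enc) hi; have [j ltj [hj [b [s [hr hs]]]]] := h3 i (ltn_ord i) hi.
    exists (Ordinal ltj); first exact/(mem_chosen _ enc).
    exists b, s; split=> //; first exact/(onth_rel _ _ _ enc).
    case: s hs {hr} => /=; rewrite /upd /= e0.
      by move/(nth_assign (Ordinal ltj) enc (ltn_ord b)).
    by move=> hs; apply/negbTE/negP => /(nth_assign (Ordinal ltj) enc (ltn_ord b)).
- case=> h0 h1 h2 h3; split; last split; last split.
  + case: (chosen m) h0 (fun i => mem_chosen i enc) => // i K _ /(_ i) [_ h].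
    by exists i => //; apply: h; apply: mem_head.
  + move=> i lti j ltj /(mem_chosen (Ordinal lti) enc) hi /(mem_chosen (Ordinal ltj) enc) hj ne.
    by apply/(onth_rel _ (Ordinal lti) (Ordinal ltj) enc); apply: h1 => //; apply/eqP => -[].
  + move=> i lti /(mem_chosen (Ordinal lti) enc) /h2.
    move=> [j /(mem_chosen _ enc) hj /(onth_rel _ _ _ enc) hr].
    by exists j.
  + move=> i lti /(mem_chosen (Ordinal lti) enc) /h3.
    move=> [j /(mem_chosen _ enc) hj [b [s [ltb /(onth_rel _ _ _ enc) hr hs]]]].
    exists j => //; split=> //; exists (Ordinal ltb), s; split=> //.
    case: s hs {hr} => /= hs; rewrite /upd /= e0; last first.
      by move/(nth_assign j enc ltb); rewrite hs.
    by apply/(nth_assign j enc ltb); rewrite hs.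
Qed.

Lemma psem_penc m e : m < size x -> e 0 = size x -> e 1 = m ->
  psem y 2 e penc <-> is_encoding c x m.
Proof.
move=> lt e0 e1; rewrite /= /upd /= !e0 !e1 onth_join_prefix //.
rewrite (set_nth_default true) //; split.
  case=> sz [[hm] h]; split=> // i lti; have := h i lti.
  by rewrite onth_join_prefix ?(ltn_trans lti) // => -[].
case=> sz hm h; do !split=> //; first by rewrite hm.
by move=> i lti; rewrite onth_join_prefix ?(ltn_trans lti) // h.
Qed.

Lemma psem_pverify e : psem y 0 e pverify <->
  (~ exists m, is_encoding c x m) \/
  exists2 m, is_encoding c x m &
    (exists i, brel (@decode c x m) (symE nb) i i) \/
    @bad nb _ (brel (@decode c x m)) (chosen m) (assign m).
Proof.
have sep : onth y (size x) = Some None.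
  have := onth_join_sep x size_u (b := 0); rewrite mul0n addn0 size_us; apply.
  exact: leq_ltn_trans kap_lt.
have enclt m : is_encoding c x m -> m < size x by case=> -> _ _; lia.
have step n0 : (n0 < size y /\ onth y n0 = Some None /\
   (forall i, i < n0 -> onth y i <> Some None)) <-> n0 = size x.
  split=> [[_ [h1 h2]]|->].
    case: (ltngtP n0 (size x)) => // lt; last by case: (h2 _ lt).
    by move: h1; rewrite onth_join_prefix.
  split; first by rewrite (size_join_words _ size_u) size_us; nia.
  by split=> // i lt; rewrite onth_join_prefix.
have main : psem y 1 (upd e 0 (size x)) (POr (PNot (PEx (V 0) penc))
         (PEx (V 0) (PAnd penc (POr (PEx (V 1) (prel (symE nb) 2 2)) pbad)))) <->
  (~ exists m, is_encoding c x m) \/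
  exists2 m, is_encoding c x m &
    (exists i, brel (@decode c x m) (symE nb) i i) \/
    @bad nb _ (brel (@decode c x m)) (chosen m) (assign m).
  have eenc m : m < size x ->
      psem y 2 (upd (upd e 0 (size x)) 1 m) penc <-> is_encoding c x m.
    by move=> lt; apply: psem_penc.
  have ebad m : is_encoding c x m -> psem y 2 (upd (upd e 0 (size x)) 1 m) pbad <->
     @bad nb _ (brel (@decode c x m)) (chosen m) (assign m).
    by move=> enc; apply: psem_pbad.
  have eloop m : is_encoding c x m ->
     psem y 2 (upd (upd e 0 (size x)) 1 m) (PEx (V 1) (prel (symE nb) 2 2)) <->
     exists i, brel (@decode c x m) (symE nb) i i.
    move=> enc; split=> [[i lt h]|[i h]].
      by exists (Ordinal lt); apply/(onth_rel _ _ _ enc).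
    by exists i; [apply: ltn_ord | apply/(onth_rel _ _ _ enc)].
  split=> -[h|[m h1 h2]].
  - by left=> -[m enc]; apply: h; exists m; [apply: enclt | apply/eenc => //; apply: enclt].
  - case: h2 => /(eenc m h1) enc h2; right; exists m => //.
    by case: h2 => [/(eloop m enc)|/(ebad m enc)]; [left|right].
  - by left=> -[m lt /(eenc m lt) enc]; apply: h; exists m.
  - right; exists m; first exact: enclt.
    split; first by apply/eenc => //; apply: enclt.
    by case: h2 => [/(eloop m h1)|/(ebad m h1)]; [left|right].
rewrite -main; split=> [[n0 lt [[h1 h2] h3]]|h].
  have <- : n0 = size x by apply/step.
  exact: h3.
have [_ /(_ erefl)[lt [h1 h2]]] := step (size x).
by exists (size x).
Qed.

End Word.
End Verifier.

Lemma bad_congr nb (T : eqType) (r : 'I_(nsym nb) -> rel T) K K' us us' :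
  K =i K' -> (forall b, b < nb -> nth xpred0 us b =1 nth xpred0 us' b) ->
  bad r K us -> bad r K' us'.
Proof.
move=> eK eu [h1 h2 h3 h4]; split.
- case: (K) h1 eK => // x s _ /(_ x); rewrite mem_head => eK.
  by apply/eqP => K0; rewrite K0 in eK.
- by move=> x y; rewrite -!eK; apply: h2.
- by move=> x; rewrite -eK => /h3[y yK h]; exists y; rewrite -?eK.
- move=> x; rewrite -eK => /h4[y yK [b [s [lt h e]]]]; exists y; rewrite -?eK //.
  by exists b, s; rewrite -eu.
Qed.

Definition word l (v : nat -> bool) : l.-tuple bool :=
  tcast (size_mkseq v l) (in_tuple (mkseq v l)).

Lemma nth_word l v i : i < l -> nth false (word l v) i = v i.
Proof. by move=> lt; rewrite /word val_tcast nth_mkseq. Qed.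

Definition extend m (v : pred 'I_m) (i : nat) : bool :=
  if insub i is Some j then v j else false.

Lemma extendE m (v : pred 'I_m) (i : 'I_m) : extend v i = v i.
Proof. by rewrite /extend valK. Qed.

(** * Words as colourings and candidate sets *)

Section Membership.
Variables (nb kap : nat) (x : seq bool) (m : nat).
Hypothesis enc : is_encoding (nsym nb) x m.
Local Notation r := (brel (@decode (nsym nb) x m)).
Local Notation l := (size x).

(** Words as long as the instance thus have room for a colouring of the [m] vertices followed by the
    indicator of a candidate set. *)
Lemma encoding_large : 2 * m <= l.
Proof. by case: enc => -> _ _; rewrite /nsym; nia. Qed.

Definition badw (us : seq (seq bool)) := bad r (chosen kap us m) (assign us m).

(** Once the block carrying [K] is fixed, the remaining words matter only through their first [m]
    bits, that is, as colourings. [phi] is a negation on the Sigma side and a double negation on the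
    Pi side. *)
Lemma badw_tail (phi : Prop -> Prop) ex k (ws : seq (seq bool)) (vs : seq (pred 'I_m)) K :
  size ws = size vs -> size ws + k = nb -> kap < size ws -> K =i chosen kap ws m ->
  (forall b, nth xpred0 (assign ws m) b =1 nth xpred0 vs b) ->
  alt ex k (fun us : seq (l.-tuple bool) => phi (badw (ws ++ map val us))) <->
  alt ex k (fun us => phi (bad r K (vs ++ us))).
Proof.
move=> sz szk ltk eK ev.
pose R (_ : nat) (u : l.-tuple bool) (v : pred 'I_m) := forall i : 'I_m, v i = nth false u i.
apply: (alt_related_iff (R := R)).
- by move=> j u; exists (fun i : 'I_m => nth false u i).
- move=> j v; exists (word l (extend v)) => i; rewrite nth_word ?extendE //.
  by have := encoding_large; have := ltn_ord i; lia.
move=> us us' szu hs; suff -> : badw (ws ++ map val us) = bad r K (vs ++ us') by [].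
have eK' : chosen kap (ws ++ map val us) m =i K.
  by move=> i; rewrite eK /chosen !mem_filter nth_cat ltk.
have eu b : nth xpred0 (assign (ws ++ map val us) m) b =1 nth xpred0 (vs ++ us') b.
  move=> i; rewrite /assign map_cat !nth_cat size_map sz.
  case: ifP => lt; first exact: ev.
  set b' := b - size vs; have [lt'|ge] := ltnP b' (size us).
    have h := related_nth [tuple of nseq l false] xpred0 hs lt' i.
    by rewrite h (nth_map [::]) ?size_map // (nth_map [tuple of nseq l false]).
  by rewrite !nth_default // ?size_map // -(related_size hs).
apply/propext; split; apply: bad_congr => //.
  by move=> b _ i; rewrite eu.
Qed.

End Membership.

Lemma nonencoding_CSP nb (D : Type) (I : structure (binsig (nsym nb)) D) x :
  ~ (exists m, is_encoding (nsym nb) x m) -> ~ CSP I x.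
Proof. by move=> h /CSP_encoding[m enc _]; apply: h; exists m. Qed.

Section Verify.
Variables (nb kap : nat) (hid : bool).
Hypothesis kap_lt : kap < nb.
Local Notation tmpl := (template nb hid).
Local Notation psat x us := (psem (join_words x us) 0 (fun=> 0) (pverify nb kap)).

Lemma psat_tuple x (us : seq ((size x).-tuple bool)) : size us = nb ->
  psat x (map val us) <->
  (~ exists m, is_encoding (nsym nb) x m) \/
  exists2 m, is_encoding (nsym nb) x m &
    (exists i, brel (@decode (nsym nb) x m) (symE nb) i i) \/
    badw nb kap x m (map val us).
Proof.
move=> sz; apply: psem_pverify; rewrite ?size_map //.
by move=> _ /mapP[u _ ->]; rewrite size_tuple.
Qed.

(** Leaves only loop-free encodings to treat: in the other cases the matrix is constant, and
    alternating quantifiers over a nonempty type vanish. [phi] is the identity for Sigma and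
    negation for Pi. *)
Lemma verify_alternation x (phi : Prop -> Prop) :
  (forall m, is_encoding (nsym nb) x m ->
     (forall i, brel (@decode (nsym nb) x m) (symE nb) i i = false) ->
     phi (CSP tmpl x) <->
     alt true nb (fun us : seq ((size x).-tuple bool) => phi (~ badw nb kap x m (map val us)))) ->
  phi (CSP tmpl x) <->
  alternate true nb (size x) (fun us => phi (~ psat x us)).
Proof.
move=> h; rewrite alternateE.
have [[m enc]|noenc] := pselect (exists m, is_encoding (nsym nb) x m).
  have psE (us : seq ((size x).-tuple bool)) : size us = nb -> (~ psat x (map val us)) =
      (~ ((exists i, brel (@decode (nsym nb) x m) (symE nb) i i) \/
          badw nb kap x m (map val us))).
    move=> sz; have [h1 h2] := psat_tuple sz.
    apply/propext; split=> nh hm; apply: nh; first by apply: h2; right; exists m.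
    case: (h1 hm) => [[]|[m' enc' hm']]; first by exists m.
    by rewrite (is_encoding_inj enc enc').
  have [[i hi]|noloop] := pselect (exists i, brel (@decode (nsym nb) x m) (symE nb) i i).
    have -> : CSP tmpl x = False.
      apply/propext; split=> // /CSP_encoding[m' enc' /template_homomorphic[irr _]].
      by move: irr; rewrite -(is_encoding_inj enc enc') => irr; rewrite irr in hi.
    rewrite -(alt_const [tuple of nseq (size x) false] true nb (phi False)).
    apply: eq_alt => us sz; rewrite psE //.
    suff -> : (~ ((exists i, brel (@decode (nsym nb) x m) (symE nb) i i) \/
          badw nb kap x m (map val us))) = False by [].
    by apply/propext; split=> //; apply; left; exists i.
  rewrite (h m) //; last first.
    by move=> i; apply/negbTE/negP => hi; apply: noloop; exists i.
  apply: eq_alt => us sz; rewrite psE //.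
  suff -> : ((exists i, brel (@decode (nsym nb) x m) (symE nb) i i) \/
          badw nb kap x m (map val us)) = badw nb kap x m (map val us) by [].
  by apply/propext; split=> [[]|] //; right.
have -> : CSP tmpl x = False.
  by apply/propext; split=> //; apply: nonencoding_CSP.
rewrite -(alt_const [tuple of nseq (size x) false] true nb (phi False)).
apply: eq_alt => us sz.
suff -> : (~ psat x (map val us)) = False by [].
by apply/propext; split=> //; apply; apply/psat_tuple => //; left.
Qed.

End Verify.

Lemma pverify_decidable nb kap :
  polytime_decidable [set y | psem y 0 (fun=> 0) (pverify nb kap)]%classic /\
  polytime_decidable [set y | ~ psem y 0 (fun=> 0) (pverify nb kap)]%classic.
Proof.
split; first by apply: (pform_decidable (pverify_wf nb kap)) => w.
by apply: (@pform_decidable _ (PNot (pverify nb kap)) _ (pverify_wf nb kap)) => w.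
Qed.

Lemma CSP_template nb hid x m : is_encoding (nsym nb) x m ->
  (forall i, brel (@decode (nsym nb) x m) (symE nb) i i = false) ->
  CSP (template nb hid) x <->
  exists u, forall K, ~ @forbidden nb hid _ (brel (@decode (nsym nb) x m)) u K.
Proof.
move=> enc irr; rewrite CSP_encoding; split=> [[m' enc']|h].
  by rewrite -(is_encoding_inj enc enc') => /template_homomorphic[].
by exists m => //; apply/template_homomorphic.
Qed.

(** Membership reads: some colouring [v0] is such that for all [K] and all [v1] the rest of the
    formula fails. The two universal objects share the second word, hence [kap = 1]. *)
Theorem template_SigmaP n : SigmaP (2 * n).+2 (CSP (template (2 * n).+2 true)).
Proof.
set nb := (2 * n).+2.
exists [set y | ~ psem y 0 (fun=> 0) (pverify nb 1)]%classic, 'X%R; split.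
  by case: (pverify_decidable nb 1).
move=> x; rewrite poly.hornerX; apply: (@verify_alternation nb 1 true isT x id).
move=> m enc irr; rewrite (CSP_template true enc irr).
have large := encoding_large enc.
set r := brel _ in irr *.
have tail (w0 w1 : (size x).-tuple bool) v0 v1 K :
   K =i chosen 1 [:: val w0; val w1] m ->
   (fun i : 'I_m => nth false w0 i) =1 v0 -> (fun i : 'I_m => nth false w1 i) =1 v1 ->
   alt true (2 * n) (fun us : seq ((size x).-tuple bool) =>
      ~ badw nb 1 x m [:: val w0, val w1 & map val us]) <->
   alt true (2 * n) (fun us => ~ bad r K [:: v0, v1 & us]).
  move=> eK e0 e1; apply: (@badw_tail nb 1 x m enc not true (2 * n) [:: val w0; val w1]
    [:: v0; v1]) => //.
  by case=> [|[|b]].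
rewrite /forbidden (_ : nb - true = (2 * n).+1) ?subn1 //; split=> [[v0 h]|[w0 h]].
  exists (word _ (extend v0)) => w1.
  have /alt_not h' := h (chosen 1 [:: val (word (size x) (extend v0)); val w1] m).
  apply/(tail _ _ v0 (fun i : 'I_m => nth false w1 i)); [by [] | | by [] | exact: (h' _)].
  by move=> i; rewrite nth_word ?extendE //; have := ltn_ord i; lia.
exists (fun i : 'I_m => nth false w0 i) => K; apply/alt_not => v1.
(* The first [m] bits hold the block, the next [m] bits the set [K]. *)
pose f i := if i < m then extend v1 i else extend (fun j => j \in K) (i - m).
apply: (iffLR (tail w0 (word _ f) _ v1 K _ _ _) (h (word _ f))) => //.
  move=> i; rewrite /chosen mem_filter mem_enum andbT /= nth_word.
    by rewrite /f ltnNge leq_addr /= addKn extendE.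
  by have := ltn_ord i; lia.
move=> i; rewrite nth_word /f ?ltn_ord ?extendE //.
by have := ltn_ord i; lia.
Qed.

(** Failure of membership reads: some [K] and some [v0] make the rest true. Both are existential and
    share the first word, hence [kap = 0]. *)
Theorem template_PiP n : PiP (2 * n).+1 (CSP (template (2 * n).+1 false)).
Proof.
set nb := (2 * n).+1.
exists [set y | psem y 0 (fun=> 0) (pverify nb 0)]%classic, 'X%R; split.
  by case: (pverify_decidable nb 0).
move=> x; rewrite poly.hornerX.
have -> : alternate true nb (size x)
    (fun us => psem (join_words x us) 0 (fun=> 0) (pverify nb 0)) =
  alternate true nb (size x)
    (fun us => ~ ~ psem (join_words x us) 0 (fun=> 0) (pverify nb 0)).
  by congr alternate; apply/funext => us; rewrite notK.
apply: (@verify_alternation nb 0 false isT x not).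
move=> m enc irr; rewrite (CSP_template false enc irr).
have large := encoding_large enc.
set r := brel _ in irr *.
have tail (w0 : (size x).-tuple bool) v0 K :
   K =i chosen 0 [:: val w0] m ->
   (fun i : 'I_m => nth false w0 i) =1 v0 ->
   alt false (2 * n) (fun us : seq ((size x).-tuple bool) =>
      ~ ~ badw nb 0 x m [:: val w0 & map val us]) <->
   alt false (2 * n) (fun us => ~ ~ bad r K [:: v0 & us]).
  move=> eK e0; apply: (@badw_tail nb 0 x m enc (fun P => ~ ~ P) false (2 * n)
    [:: val w0] [:: v0]) => //.
  by case=> [|b].
rewrite -[X in alt true X]/nb /=; split=> [h|[w0 h] [u hu]].
  have {h} [K h] : exists K, forbidden false r xpred0 K.
    apply: contrapT => h'; apply: h; exists xpred0 => K hK; apply: h'; by exists K.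
  case: h => v0 h.
  pose f i := if i < m then extend v0 i else extend (fun j => j \in K) (i - m).
  exists (word _ f); apply/(tail _ v0 K).
  - move=> i; rewrite /chosen mem_filter mem_enum andbT /= nth_word.
      by rewrite /f ltnNge leq_addr /= addKn extendE.
    by have := ltn_ord i; lia.
  - move=> i; rewrite nth_word /f ?ltn_ord ?extendE //.
    by have := ltn_ord i; lia.
  - apply: (iffRL (eq_alt false _) (h : alt false (2 * n) (fun us => bad r K (v0 :: us)))) => us _.
    by rewrite notK.
apply: (hu (chosen 0 [:: val w0] m)); exists (fun i : 'I_m => nth false w0 i).
have h' := iffLR (tail w0 _ (chosen 0 [:: val w0] m) (fun _ => erefl) (fun _ => erefl)) h.
by apply: (iffLR (eq_alt false _) h') => us _; rewrite notK.
Qed.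

(** * Tableaux *)

Section Tableau.
Variables (A : finType) (M : TM A).

Definition tcell : finType := option (A + aux M).
Definition tsym : finType := (tcell * option (state M))%type.

(** The state with which a head leaves the neighbour [x] in the given direction; [right] is thus
    meant for the left neighbour. *)
Definition incoming (right : bool) (x : tsym) : option (state M) :=
  if x.2 is Some st then
    match delta st x.1 with
    | Some (st', _, MRight) => if right then Some st' else None
    | Some (st', _, MLeft) => if right then None else Some st'
    | _ => None
    end
  else None.

Definition local_rule (a b c : tsym) : tsym :=
  match b.2 with
  | Some st =>
      match delta st b.1 with
      | Some (st', w, MStay) => (w, Some st')
      | Some (_, w, _) => (w, None)
      | None => b
      end
  | None => (b.1, if incoming true a is Some st' then Some st' else incoming false c)
  end.

Definition symbol_at (cf : config M) (h p : nat) : tsym :=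
  let: (st, l, a, r) := cf in
  if p < h then (nth None l (h - p.+1), None)
  else if p == h then (a, Some st)
  else (nth None r (p - h.+1), None).

Definition next_config (cf : config M) : config M := odflt cf (step cf).

Definition next_head (cf : config M) (h : nat) : nat :=
  let: (st, l, a, r) := cf in
  if delta st a is Some (_, _, m) then shift m h else h.

Lemma run_next t (cf : config M) : run t.+1 cf = next_config (run t cf).
Proof.
elim: t cf => [|t IH] cf; first by rewrite /= /next_config; case: (step cf).
rewrite [run t.+2 cf]/= [run t.+1 cf]/=.
case e: (step cf) => [cf'|]; first by rewrite -IH.
by rewrite /next_config e.
Qed.

(** Positions are absolute in the tableau but relative to the head in a configuration. [0 < h]
    prevents the truncated predecessor in [shift] from misplacing a head that moves left. Halted
    configurations repeat on both sides. *)
Lemma symbol_next cf h p : 0 < h -> 0 < p ->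
  symbol_at (next_config cf) (next_head cf h) p =
  local_rule (symbol_at cf h p.-1) (symbol_at cf h p) (symbol_at cf h p.+1).
Proof.
case: cf => [[[st l] a] r] h0 p0; rewrite /next_config /next_head /=.
case ed: (delta st a) => [[[st' w] m]|] /=; last first.
  rewrite /local_rule; case: (ltngtP p h) => [lt|gt|->] /=; last by rewrite ed.
  - rewrite /incoming; have -> : p.-1 < h by lia.
    case: ifP => [//|ge]; case: eqP => /= [_|//].
    by rewrite ed.
  - rewrite /incoming; have -> : (p.+1 < h) = false by lia.
    have -> : (p.+1 == h) = false by lia.
    by case: ifP => //; case: eqP => //= _ _; rewrite ed.
have h1 : (h.-1 < h) by lia.
case: m ed => ed /=.
- rewrite /local_rule; case: (ltngtP p h) => [lt|gt|->] /=.
  + have e1 : p.-1 < h by lia.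
    rewrite e1 /incoming /=; case: (ltngtP p h.-1) => [lt'|gt'|e] /=; last first.
    * subst p; rewrite prednK // ltnn eqxx /= ed.
      by congr (_, _); case: (l) => //=; rewrite ?subnn ?nth_nil //; have -> : h - h = 0 by lia.
    * by exfalso; lia.
    * have -> : p.+1 < h by lia.
      by rewrite nth_behead; have -> : (h.-1 - p.+1).+1 = h - p.+1 by lia.
  + have -> : (p < h.-1) = false by lia.
    have -> : (p == h.-1) = false by lia.
    have -> : (p.+1 < h) = false by lia.
    have -> : (p.+1 == h) = false by lia.
    rewrite prednK // -(subnSK gt) /= /incoming.
    case: ifP => [|_] /=; first by lia.
    by case: eqP => //= _; rewrite ed.
  + have -> : (h < h.-1) = false by lia.
    have -> : (h == h.-1) = false by lia.
    by rewrite ed prednK // subnn.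
- rewrite /local_rule; case: (ltngtP p h) => [lt|gt|->] /=; last by rewrite ed.
  + rewrite /incoming; have -> : p.-1 < h by lia.
    by case: ifP => //= _; case: eqP => //= _; rewrite ed.
  + rewrite /incoming; have -> : (p.+1 < h) = false by lia.
    have -> : (p.+1 == h) = false by lia.
    by case: ifP => //= _; case: eqP => //= _; rewrite ed.
- rewrite /local_rule; case: (ltngtP p h) => [lt|gt|->] /=.
  + have -> : p < h.+1 by lia.
    have -> : p.-1 < h by lia.
    rewrite /incoming /=; have -> : h.+1 - p.+1 = (h - p.+1).+1 by lia.
    by case: ifP => //= _; case: eqP => //= _; rewrite ed.
  + have -> : (p < h.+1) = false by lia.
    have -> : (p.+1 < h) = false by lia.
    have -> : (p.+1 == h) = false by lia.
    have -> : (p.-1 < h) = false by lia.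
    case: (eqVneq p h.+1) => [->|ne] /=.
      rewrite eqxx /incoming /= ed subnn.
      by case: (r).
    have -> : (p.-1 == h) = false by lia.
    rewrite /incoming /= nth_behead.
    by have -> : (p - h.+2).+1 = p - h.+1 by lia.
  + by rewrite ltnSn ed subnn.
Qed.

Lemma symbol_init (w : seq A) h p : symbol_at (init M w) h p =
  (if p < h then None else omap inl (onth w (p - h)), if p == h then Some (start M) else None).
Proof.
have e j : nth None [seq Some (inl a) : tcell | a <- w] j = omap inl (onth w j).
  by elim: w j => [|a w IH] [|j] //=.
rewrite /symbol_at /=; case: (ltngtP p h) => [lt|gt|->] //.
- by rewrite nth_nil.
- by rewrite nth_behead e; have -> : (p - h.+1).+1 = p - h by lia.
- by rewrite subnn -nth0 e.
Qed.

End Tableau.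

(** * Clauses describing a run *)

Section Clauses.
Variables (M : TM (option bool)) (acc : bool) (nb : nat) (x : seq bool) (q T : nat).
Hypothesis nb_gt0 : 0 < nb.

Local Notation n := (size x).
Definition jlen := n + nb * q.+1.
(** Cells at the borders are unconstrained, and this defect spreads by one cell per row. At time [T]
    the head lies between [T + 1] and [3 * T + 1]; it and its two neighbours must still be at
    distance [T] from both borders. *)
Definition width := 4 * T + jlen + 4.
Local Notation off := (2 * T + 1).
Local Notation last := nb.-1.
Local Notation sym := (tsym M).

(** A clause belongs to a place and a possible window of three symbols, and says that this window
    forces the symbol in the next row: three negative literals and one positive. As variables, only
    diagonal triples are used. *)
Definition triple : finType := (sym * sym * sym)%type.
Definition diag (s : sym) : triple := (s, s, s).
Definition z0 : triple := diag (None, None).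

Definition wrong (s : sym) : bool :=
  if s.2 is Some st then accepting st != acc else false.

Definition headok p (s : sym) :=
  (s.2 = Some (start M) /\ p = off) \/ (s.2 = None /\ p <> off).

(** The symbols of the initial row that do not depend on the quantified words: blanks, letters of
    [x] and separators. [varb] gives the others, conditional on a bit. *)
Definition fixb p (s : sym) :=
  headok p s /\
  ((p < off /\ s.1 = None) \/ (off + jlen <= p /\ s.1 = None) \/
   (exists v : bool, s.1 = Some (inl (Some v)) /\
      exists2 r, r < n & p = off + r /\ onth x r = Some v) \/
   (exists beta : 'I_nb, s.1 = Some (inl None) /\ p = off + n + beta * q.+1)).

Definition varb (beta : nat) (v : bool) p (s : sym) :=
  headok p s /\ s.1 = Some (inl (Some v)) /\
  exists2 r, r < q & p = off + n + beta * q.+1 + r.+1.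

(* Row [t >= 1] of the tableau is the configuration at time [t - 1].  The variable
   "position [p] of row [t] carries [s]" is that of the last block at vertex
   [(t, p, diag s)]; bit [r] of the word of block [beta] is that of block [beta] at
   [(0, p, z0)], where [p] is the position at which the machine reads it.  The head
   starts at [2 * T + 1], so that in [T] steps it stays away from the borders, where
   the clauses are tautologies. *)
Definition posv t p (z : triple) t' p' (z' : triple) :=
  let: (a, b, c) := z in
  (t <> 0 /\ (0 < p /\ p.+1 < width) /\ t <= T /\
     t' = t.+1 /\ p' = p /\ z' = diag (local_rule a b c)) \/
  (t <> 0 /\ (~ (0 < p /\ p.+1 < width) \/ (T < t /\ ~~ wrong b)) /\
     t' = t /\ p' = p /\ z' = diag b) \/
  (t = 0 /\ t' = 1 /\ p' = p /\ z' = diag b).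

Definition negv t p (z : triple) t' p' (z' : triple) :=
  let: (a, b, c) := z in
  (t <> 0 /\ t' = t /\ ((p = p'.+1 /\ z' = diag a) \/ (p' = p /\ z' = diag b) \/
     (p' = p.+1 /\ z' = diag c))) \/
  (t = 0 /\ ~ (fixb p b \/ exists beta : 'I_nb, exists v, varb beta v p b) /\
     t' = 1 /\ p' = p /\ z' = diag b).

(** If the bit has value [~~ s], the initial row carries the symbol [z.1.2]. As a clause this is an
    alternative, so the literal on the bit has the opposite sign [s]. *)
Definition guard (beta : nat) (s : bool) t p (z : triple) t' p' (z' : triple) :=
  t = 0 /\ t' = 0 /\ p' = p /\ z' = z0 /\ varb beta (~~ s) p z.1.2.

Definition lit (beta : nat) (s : bool) t p (z : triple) t' p' (z' : triple) :=
  (beta = last /\ s /\ posv t p z t' p' z') \/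
  (beta = last /\ ~~ s /\ negv t p z t' p' z') \/
  guard beta s t p z t' p' z'.

Definition satisfied (v : nat -> nat -> nat -> triple -> bool) :=
  forall t p z, t < width -> p < width -> exists beta s t' p' z',
    [/\ beta < nb, t' < width, p' < width, lit beta s t p z t' p' z' & v beta t' p' z' = s].

Definition carries (w : nat -> nat -> bool) (v : nat -> nat -> nat -> triple -> bool) :=
  forall beta r, beta < nb -> r < q ->
    v beta 0 (off + n + beta * q.+1 + r.+1) z0 = w beta r.

Lemma side_gt (beta r : nat) : beta < nb -> r < q ->
  off + n + beta * q.+1 + r.+1 < width.
Proof.
clear nb_gt0 => ltb ltr; rewrite /width /jlen.
have : beta.+1 * q.+1 <= nb * q.+1 by rewrite leq_mul2r; lia.
by rewrite mulSn; lia.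
Qed.

Section Word.
Variable us : seq (seq bool).
Hypothesis size_us : size us = nb.
Hypothesis size_u : forall u, u \in us -> size u = q.
Local Notation y := (join_words x us).

Lemma size_join : size y = jlen.
Proof. by rewrite (size_join_words x size_u) size_us. Qed.

Fixpoint head_at t : nat :=
  if t is t'.+1 then next_head (run t' (init M y)) (head_at t') else off.

Definition row t p : sym := symbol_at (run t (init M y)) (head_at t) p.

Lemma head_atP t : head_at t <= off + t /\ off <= head_at t + t.
Proof.
elim: t => [|t /= [h1 h2]]; first by rewrite /= addn0.
rewrite /next_head; case: (run t _) => [[[st l] a] r].
case: (delta st a) => [[[? ?] m]|]; last by lia.
by case: m => /=; lia.
Qed.

Lemma row_next t p : t < T -> 0 < p ->
  row t.+1 p = local_rule (row t p.-1) (row t p) (row t p.+1).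
Proof.
move=> lt p0; rewrite /row run_next [LHS](@symbol_next _ M _ (head_at t)) //.
have := head_atP t; rewrite -/(head_at t); lia.
Qed.

Lemma row0 p : row 0 p =
  (if p < off then None else omap inl (onth y (p - off)),
   if p == off then Some (start M) else None).
Proof. exact: symbol_init. Qed.

Lemma row_head t : row t (head_at t) =
  (let: (st, _, a, _) := run t (init M y) in (a, Some st)).
Proof. by rewrite /row /symbol_at; case: (run t _) => [[[st l] a] r]; rewrite ltnn eqxx. Qed.

Lemma row_no_head t p st : (row t p).2 = Some st ->
  st = (run t (init M y)).1.1.1.
Proof.
rewrite /row /symbol_at; case: (run t _) => [[[st' l] a] r] /=.
by case: ifP => //; case: ifP => //= _ _ [].
Qed.

Lemma headok_row0 p (s : sym) : headok p s <-> s.2 = (row 0 p).2.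
Proof.
rewrite row0 /=; case: eqP => e; split; rewrite /headok.
- by case=> [[]|[]].
- by left.
- by case=> [[]|[]].
- by right.
Qed.

Lemma fixb_row0 p s : p < width -> fixb p s -> s = row 0 p.
Proof.
move=> ltp [/headok_row0 e h]; case: s e h => s1 s2 /= -> h.
suff -> : s1 = (row 0 p).1 by case: (row 0 p).
rewrite row0 /=; case: h => [[-> ->] //|[[le ->]|[[v [-> [r lt [-> hr]]]]|[beta [-> ->]]]]].
- have -> : (p < off) = false by lia.
  suff : onth y (p - off) == None by move/eqP->.
  by rewrite onth_None size_join; lia.
- have -> : (off + r < off) = false by lia.
  rewrite addKn onth_join_prefix //.
  by move: hr; rewrite (onth_some false) // => -[->].
- have -> : (off + n + beta * q.+1 < off) = false by lia.
  by rewrite -[off + n + _]addnA addKn (onth_join_sep _ size_u) // size_us.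
Qed.

Lemma row0_word (beta : nat) r : beta < nb -> r < q ->
  (row 0 (off + n + beta * q.+1 + r.+1)).1 =
  Some (inl (Some (nth false (nth [::] us beta) r))).
Proof.
move=> ltb ltr; rewrite row0 /=.
have -> : (off + n + beta * q.+1 + r.+1 < off) = false by lia.
by rewrite -[off + n + _]addnA -[off + _ + _]addnA addKn (onth_join_word _ size_u) // size_us.
Qed.

Lemma row0_cases p : p < width -> fixb p (row 0 p) \/
  exists beta r, [/\ beta < nb, r < q, p = off + n + beta * q.+1 + r.+1 &
    varb beta (nth false (nth [::] us beta) r) p (row 0 p)].
Proof.
move=> ltp; have hok : headok p (row 0 p) by apply/headok_row0.
have [lto|leo] := ltnP p off.
  by left; split=> //; left; rewrite row0 lto.
have [r0 er0] : exists r0, p = off + r0 by exists (p - off); lia.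
have [ltn0|len0] := ltnP r0 n.
  left; split=> //; right; right; left; exists (nth false x r0).
  rewrite er0 row0 addKn /= onth_join_prefix //.
  have -> : (off + r0 < off) = false by lia.
  by split=> //; exists r0 => //; split=> //; rewrite (onth_some false).
have [gel|ltl] := leqP jlen r0.
  left; split=> //; right; left; split; first by lia.
  rewrite row0 er0 addKn /=; have -> : (off + r0 < off) = false by lia.
  suff : onth y r0 == None by move/eqP->.
  by rewrite onth_None size_join.
have [r1 er1] : exists r1, r0 = n + r1 by exists (r0 - n); lia.
have ltr1 : r1 < nb * q.+1 by move: ltl; rewrite /jlen er1; lia.
have ltb : r1 %/ q.+1 < nb by rewrite ltn_divLR.
have e1 := divn_eq r1 q.+1; case e2: (r1 %% q.+1) => [|r].
  left; split=> //; right; right; right; exists (Ordinal ltb).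
  have ep : p = off + n + r1 %/ q.+1 * q.+1 by rewrite er0 er1 {1}e1 e2; lia.
  split=> //; rewrite ep row0 /=.
  have -> : (off + n + r1 %/ q.+1 * q.+1 < off) = false by lia.
  by rewrite -[off + n + _]addnA addKn (onth_join_sep _ size_u) // size_us.
have ltr : r < q by have := ltn_pmod r1 (ltn0Sn q); rewrite e2.
right; exists (r1 %/ q.+1), r.
have ep : p = off + n + r1 %/ q.+1 * q.+1 + r.+1 by rewrite er0 er1 {1}e1 e2; lia.
split=> //; split=> //; split; last by exists r.
by rewrite ep row0_word.
Qed.

Local Notation word_bit := (fun beta r => nth false (nth [::] us beta) r).

(* The clauses force the variables of the actual run to be true; other variables may be
   true as well, but only the final clauses [wrong] constrain them. *)
Lemma satisfied_accepts v : carries word_bit v -> satisfied v ->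
  accepts (run T (init M y)) = acc.
Proof.
move=> hv sat.
have base p : p < width -> v last 1 p (diag (row 0 p)).
  move=> ltp; have [beta [s [t' [p' [z' [ltb _ _ hl hs]]]]]] :=
    sat 0 p (diag (row 0 p)) ltac:(rewrite /width; lia) ltp.
  case: hl => [[eb [es hp]]|[[_ [_ hn]]|[_ [et [ep [ez [_ [e1 [r ltr er]]]]]]]]].
  - case: hp => [[]//|[[]//|[_ [et [ep ez]]]]].
    by move: hs; rewrite es eb et ep ez => ->.
  - case: hn => [[]//|[_ [nh _]]]; case: nh.
    have [|[beta' [r [ltb' _ _ hvar]]]] := row0_cases ltp; first by left.
    by right; exists (Ordinal ltb'), (word_bit beta' r).
  - move: e1; rewrite /= er row0_word // => -[e1].
    move: hs; rewrite et ep ez er hv // e1.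
    by case: (s).
(* The region in which the run is forced shrinks by one cell at either end with each row. *)
have rows t : t <= T -> forall p, t <= p -> p + t < width -> v last t.+1 p (diag (row t p)).
  elim: t => [_ p _|t IH lt p lep gep]; first by rewrite addn0; apply: base.
  have lt' := ltnW lt.
  have va : v last t.+1 p.-1 (diag (row t p.-1)) by apply: IH => //; lia.
  have vb : v last t.+1 p (diag (row t p)) by apply: IH => //; lia.
  have vc : v last t.+1 p.+1 (diag (row t p.+1)) by apply: IH => //; lia.
  have ltt : t.+1 < width by rewrite /width; lia.
  have [beta [s [t' [p' [z' [ltb _ _ hl hs]]]]]] :=
    sat t.+1 p (row t p.-1, row t p, row t p.+1) ltt ltac:(lia).
  case: hl => [[eb [es hp]]|[[eb [es hn]]|[]//]].
  - case: hp => [[_ [_ [_ [et [ep ez]]]]]|[[_ [[nint|[nle _]] _]]|[]//]].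
    + by move: hs; rewrite es eb et ep ez -row_next //; lia.
    + by case: nint; split; lia.
    + by lia.
  - case: hn => [[_ [et hz]]|[]//]; move: hs; rewrite (negbTE es) eb et.
    case: hz => [[ep ->]|[[-> ->]|[-> ->]]]; rewrite ?vb ?vc //.
    have -> : p' = p.-1 by lia.
    by rewrite va.
have [h1 h2] := head_atP T.
pose h := head_at T; rewrite -/h in h1 h2.
have va : v last T.+1 h.-1 (diag (row T h.-1)) by apply: rows => //; rewrite /width; lia.
have vb : v last T.+1 h (diag (row T h)) by apply: rows => //; rewrite /width; lia.
have vc : v last T.+1 h.+1 (diag (row T h.+1)) by apply: rows => //; rewrite /width; lia.
have ltt : T.+1 < width by rewrite /width; lia.
have lth : h < width by rewrite /width; lia.
(* The window at the head in the final row: its negative literals are false, and a positive one is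
   present only if the state is not [wrong]. *)
have [beta [s [t' [p' [z' [ltb _ _ hl hs]]]]]] :=
  sat T.+1 h (row T h.-1, row T h, row T h.+1) ltt lth.
case: hl => [[eb [es hp]]|[[eb [es hn]]|[]//]].
- case: hp => [[_ [_ []]]|[[_ [[nint|[_ nw]] _]]|[]//]]; first by lia.
    by case: nint; rewrite /width; lia.
  move: nw; rewrite /wrong row_head /accepts; case: (run T _) => [[[st l] a] r] /=.
  by rewrite negbK => /eqP.
- case: hn => [[_ [et hz]]|[]//]; move: hs; rewrite (negbTE es) eb et.
  case: hz => [[ep ->]|[[-> ->]|[-> ->]]]; rewrite ?vb ?vc //.
  have -> : p' = h.-1 by lia.
  by rewrite va.
Qed.

(** The last block carries both its own word, in row 0, and the tableau in the later rows; only the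
    latter are overwritten. *)
Definition tableau (v : nat -> nat -> nat -> triple -> bool) (beta t p : nat) (z : triple) :=
  if (t == 0) || (beta != last) then v beta t p z
  else (t <= T.+1) && (z == diag (row t.-1 p)).

Lemma accepts_satisfied v : carries word_bit v ->
  accepts (run T (init M y)) = acc -> satisfied (tableau v).
Proof.
move=> hv hacc t p [[a b] c] ltt ltp.
have tabE t' p' s : t' != 0 -> tableau v last t' p' (diag s) = (t' <= T.+1) && (s == row t'.-1 p').
  move=> /negbTE ne; rewrite /tableau ne eqxx /=; congr andb.
  by apply/eqP/eqP => [[]|->].
have ltl : last < nb by lia.
have pos t' p' s : t' < width -> p' < width -> lit last true t p (a, b, c) t' p' (diag s) ->
    t' != 0 -> t' <= T.+1 -> s = row t'.-1 p' -> exists beta s t' p' z',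
    [/\ beta < nb, t' < width, p' < width, lit beta s t p (a, b, c) t' p' z' &
       tableau v beta t' p' z' = s].
  move=> lt1 lt2 hl h1 h2 h3; exists last, true, t', p', (diag s); split=> //.
  by rewrite tabE // h2 h3 eqxx.
have neg t' p' s : t' < width -> p' < width -> lit last false t p (a, b, c) t' p' (diag s) ->
    t' != 0 -> ~~ ((t' <= T.+1) && (s == row t'.-1 p')) -> exists beta s t' p' z',
    [/\ beta < nb, t' < width, p' < width, lit beta s t p (a, b, c) t' p' z' &
       tableau v beta t' p' z' = s].
  move=> lt1 lt2 hl h1 h2; exists last, false, t', p', (diag s); split=> //.
  by rewrite tabE //; apply/negbTE.
have s1 : 1 < width by rewrite /width; lia.
have [t0|tpos] := posnP t.
  subst t; have [eb|nb0] := eqVneq b (row 0 p).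
    apply: (pos 1 p b) => //; left; split=> //; split=> //; right; right; by [].
  have [hfv|hnv] := pselect (fixb p b \/
    exists beta : 'I_nb, exists v, varb beta v p b); last first.
    apply: (neg 1 p b) => //; right; left; split=> //; split=> //; right; by [].
  case: hfv => [hf|[beta [w hw]]]; first by rewrite (fixb_row0 ltp hf) eqxx in nb0.
  exists beta, (~~ w), 0, p, z0; split=> //.
    by right; right; split=> //; split=> //; split=> //; split=> //; rewrite negbK.
  case: (hw) => /headok_row0 e2 [e1 [r ltr ep]].
  rewrite /tableau /= ep hv //; apply/eqP; apply: contraNT nb0.
  have ew := row0_word (ltn_ord beta) ltr; rewrite -ep in ew.
  move: ew; set u := nth false _ r => ew nu; have eu : u = w by case: (u) (w) nu => [] [].
  rewrite eu -e1 in ew; rewrite [b]surjective_pairing [X in _ == X]surjective_pairing.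
  by rewrite -e2 ew.
have tn0 : t != 0 by lia.
have tn : t <> 0 by lia.
have negV p' s : (p = p'.+1 /\ s = a) \/ (p' = p /\ s = b) \/ (p' = p.+1 /\ s = c) ->
    lit last false t p (a, b, c) t p' (diag s).
  move=> h; right; left; split=> //; split=> //; left; split=> //; split=> //.
  by case: h => [[-> ->]|[[-> ->]|[-> ->]]]; [left|right; left|right; right].
(* Rows after [T.+1] are false throughout, so their clauses hold by the negative literal in the
   middle, like those of a window whose middle symbol is not the actual one. *)
have [|hb] := boolP ((t <= T.+1) && (b == row t.-1 p)); last first.
  by apply: (neg t p b) => //; apply: negV; right; left.
case/andP=> let1 /eqP eb.
have [int|nint] := boolP ((0 < p) && (p.+1 < width)); last first.
  apply: (pos t p b) => //; left; split=> //; split=> //; right; left; split=> //.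
  by split=> //; left => -[h1 h2]; rewrite h1 h2 in nint.
case/andP: int => p0 p1; have [leT|gtT] := leqP t T; last first.
  apply: (pos t p b) => //; left; split=> //; split=> //; right; left; split=> //.
  split=> //; right; split=> //; rewrite /wrong eb; have -> : t.-1 = T by lia.
  case e: (row T p).2 => [st|//]; rewrite (row_no_head e) negbK -hacc /accepts.
  by case: (run T _) => [[[st' l] a'] r].
have [ea|na] := eqVneq a (row t.-1 p.-1); last first.
  apply: (neg t p.-1 a) => //; first by lia.
    by apply: negV; left; split=> //; lia.
  by rewrite negb_and na orbT.
have [ec|nc] := eqVneq c (row t.-1 p.+1); last first.
  apply: (neg t p.+1 c) => //; first by apply: negV; right; right.
  by rewrite negb_and nc orbT.
apply: (pos t.+1 p (local_rule a b c)) => //.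
- by rewrite /width; lia.
- by left; split=> //; split=> //; left.
- rewrite ea eb ec -row_next //; last by lia.
  by rewrite prednK.
Qed.

End Word.
End Clauses.

Lemma symL_inj nb b b' s s' : b < nb -> b' < nb -> symL nb b s = symL nb b' s' ->
  b = b' /\ s = s'.
Proof.
by move=> lt lt' /(congr1 val); rewrite /= !inordK; case: s; case: s'; lia.
Qed.

Lemma symLE nb b s : b < nb -> symL nb b s <> symE nb /\ symL nb b s <> symS nb.
Proof.
move=> lt; split=> /(congr1 val) /=; rewrite !inordK //; case: s; lia.
Qed.

Lemma symSE nb : symS nb <> symE nb.
Proof. by move/(congr1 val) => /=; rewrite !inordK. Qed.

(** * The instance as a finite structure *)

Section Structure.
Variables (M : TM (option bool)) (acc : bool) (nb : nat) (x : seq bool) (q T : nat).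
Hypothesis nb_gt0 : 0 < nb.
Local Notation n := (size x).
Local Notation side := (width nb x q T).
Local Notation off := (2 * T + 1).
Local Notation last := nb.-1.
Local Notation zeta := #|triple M|.

Definition vcount := side * side * zeta.
Definition vertex t p (z : triple M) := (t * side + p) * zeta + enum_rank z.

Definition edge (beta : nat) (s : bool) i j :=
  exists2 t, t < side & exists2 p, p < side & exists2 t', t' < side & exists2 p', p' < side &
  exists z z', i = vertex t p z /\ j = vertex t' p' z' /\
    lit acc nb x q T beta s t p z t' p' z'.

Definition rels (R : 'I_(nsym nb)) (i j : nat) :=
  (R = symE nb /\ i <> j) \/ (R = symS nb /\ (j = i.+1 \/ (i.+1 = vcount /\ j = 0))) \/
  (exists beta : 'I_nb, exists s, R = symL nb beta s /\ edge beta s i j).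

Definition instance : fin_structure (binsig (nsym nb)) vcount :=
  fun R t => `[< rels R (tnth t ord0) (tnth t ord_max) >].

Lemma zeta_gt0 : 0 < zeta.
Proof. by apply/card_gt0P; exists (z0 M). Qed.

Lemma side_gt0 : 0 < side.
Proof. by rewrite /width; lia. Qed.

Lemma vertex_lt t p z : t < side -> p < side -> vertex t p z < vcount.
Proof.
move=> ltt ltp; rewrite /vertex /vcount.
have h1 : t * side + p < side * side by nia.
have h2 : (t * side + p).+1 * zeta <= side * side * zeta by rewrite leq_mul2r h1 orbT.
by apply: leq_trans h2; rewrite mulSn -addnS addnC leq_add2r.
Qed.

Lemma mul_add_inj d a b a' b' : b < d -> b' < d -> a * d + b = a' * d + b' ->
  a = a' /\ b = b'.
Proof.
move=> lt lt' e; have d0 : 0 < d by lia.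
have := congr1 (fun k => k %/ d) e; have := congr1 (fun k => k %% d) e.
by rewrite /= !modnMDl !divnMDl // !modn_small // !divn_small // !addn0.
Qed.

Lemma vertex_inj t p z t' p' z' : p < side -> p' < side ->
  vertex t p z = vertex t' p' z' -> [/\ t = t', p = p' & z = z'].
Proof.
move=> ltp ltp' /(mul_add_inj (ltn_ord _) (ltn_ord _)) [/(mul_add_inj ltp ltp')[-> ->]].
by move/val_inj/enum_rank_inj->.
Qed.

Lemma vertex_surj i : i < vcount -> exists t p z, [/\ t < side, p < side & i = vertex t p z].
Proof.
move=> lt; have lt1 : i %/ zeta < side * side by rewrite ltn_divLR // zeta_gt0.
have lt2 : i %% zeta < zeta by rewrite ltn_mod zeta_gt0.
exists (i %/ zeta %/ side), (i %/ zeta %% side), (enum_val (Ordinal lt2)); split.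
- by rewrite ltn_divLR // side_gt0.
- by rewrite ltn_mod side_gt0.
- by rewrite /vertex enum_valK /= -!divn_eq.
Qed.

Lemma vcount_gt0 : 0 < vcount.
Proof. by apply: leq_ltn_trans (vertex_lt (z0 M) side_gt0 side_gt0). Qed.

Lemma brel_instance R i j : brel instance R i j = `[< rels R i j >].
Proof. by []. Qed.

Lemma brel_symE i j : brel instance (symE nb) i j = (i != j).
Proof.
rewrite brel_instance; apply/asboolP/idP => [|ne].
  case=> [[_ ne]|[[e _]|[beta [s [e _]]]]].
  - by apply/eqP => e; apply: ne; rewrite e.
  - by case: (symSE (esym e)).
  - by case: (symLE s (ltn_ord beta)); rewrite e.
by left; split=> // e; case/eqP: ne; apply: val_inj.
Qed.

Lemma brel_symS (i j : 'I_vcount) : brel instance (symS nb) i j <->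
  (j = i.+1 :> nat \/ (i.+1 = vcount /\ j = 0 :> nat)).
Proof.
rewrite brel_instance; split=> [/asboolP|h]; last by apply/asboolP; right; left.
case=> [[e _]|[[_ //]|[beta [s [e _]]]]]; first by case: (symSE e).
by case: (symLE s (ltn_ord beta)); rewrite e.
Qed.

Lemma brel_symL b s (i j : 'I_vcount) : b < nb ->
  brel instance (symL nb b s) i j <-> edge b s i j.
Proof.
move=> lt; rewrite brel_instance; split=> [/asboolP|h]; last first.
  by apply/asboolP; right; right; exists (Ordinal lt), s.
case=> [[e _]|[[e _]|[beta [s' [e]]]]]; try by case: (symLE s lt); rewrite e.
by have [-> ->] := symL_inj lt (ltn_ord beta) e.
Qed.

Definition vals (fs : seq (pred 'I_vcount)) (beta t p : nat) (z : triple M) : bool :=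
  extend (nth xpred0 fs beta) (vertex t p z).

(** S is a cyclic successor: from any element of [K] one climbs to the last vertex, wraps around to
    0, and climbs to any other vertex without leaving [K]. *)
Lemma bad_full K fs : bad (brel instance) K fs -> K =i enum 'I_vcount.
Proof.
case=> K0 _ hS _ i; rewrite mem_enum.
have next (j k : 'I_vcount) : k = j.+1 :> nat \/ (j.+1 = vcount /\ k = 0 :> nat) ->
    j \in K -> k \in K.
  move=> h /hS[k' k'K /brel_symS h']; suff -> : k = k' by [].
  by apply: val_inj => /=; have := ltn_ord k; have := ltn_ord k'; lia.
have [i0 i0K] : exists i0, i0 \in K by case: (K) K0 => // i0 s _; exists i0; apply: mem_head.
have up d (j k : 'I_vcount) : k = j + d :> nat -> j \in K -> k \in K.
  elim: d k => [|d IH] k e jK.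
    by suff -> : k = j by []; apply: val_inj; rewrite /= e addn0.
  have lt : j + d < vcount by have := ltn_ord k; lia.
  by apply: (next (Ordinal lt)); [left; rewrite /= e addnS | apply: IH].
have ltm : vcount.-1 < vcount by have := vcount_gt0; lia.
have zK : Ordinal vcount_gt0 \in K.
  apply: (next (Ordinal ltm)); first by right; rewrite /=; have := vcount_gt0; lia.
  by apply: (up (vcount.-1 - i0) i0) => //=; have := ltn_ord i0; lia.
by apply: (up i _ _ _ zK).
Qed.

Lemma bad_satisfied fs : bad (brel instance) (enum 'I_vcount) fs <->
  satisfied acc nb x q T (vals fs).
Proof.
split=> [[_ _ _ h] t p z ltt ltp|sat].
  have [|j _ [b [s [ltb /(brel_symL _ _ _ ltb) he hs]]]] := h (Ordinal (vertex_lt z ltt ltp)).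
    by rewrite mem_enum.
  case: he => t1 lt1 [p1 lp1 [t' ltt' [p' ltp' [z1 [z' [/= e1 [e2 hl]]]]]]].
  have [et ep ez] := vertex_inj ltp lp1 e1; subst t1 p1 z1.
  exists b, s, t', p', z'; split=> //.
  by rewrite /vals -e2 extendE.
split.
- by rewrite -size_eq0 size_enum_ord; have := vcount_gt0; lia.
- by move=> i j _ _; rewrite brel_symE.
- move=> i _; have [ei|ne] := eqVneq i.+1 vcount.
    exists (Ordinal vcount_gt0); first by rewrite mem_enum.
    by apply/brel_symS; right.
  have lt : i.+1 < vcount by have := ltn_ord i; lia.
  exists (Ordinal lt); first by rewrite mem_enum.
  by apply/brel_symS; left.
- move=> i _; have [t [p [z [ltt ltp ei]]]] := vertex_surj (ltn_ord i).
  have [b [s [t' [p' [z' [ltb ltt' ltp' hl hs]]]]]] := sat t p z ltt ltp.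
  exists (Ordinal (vertex_lt z' ltt' ltp')); first by rewrite mem_enum.
  exists b, s; split=> //; last first.
    by rewrite -hs /vals -[vertex _ _ _]/(val (Ordinal (vertex_lt z' ltt' ltp'))) extendE.
  apply/brel_symL => //; exists t => //; exists p => //; exists t' => //; exists p' => //.
  by exists z, z'.
Qed.

Definition input_vertex beta r := vertex 0 (off + n + beta * q.+1 + r.+1) (z0 M).

Definition matches (beta : nat) (w : q.-tuple bool) (f : pred 'I_vcount) :=
  beta < nb -> forall r, r < q -> extend f (input_vertex beta r) = nth false w r.

Lemma matches_word beta (f : pred 'I_vcount) : exists w, matches beta w f.
Proof.
by exists (word q (fun r => extend f (input_vertex beta r))) => _ r ltr; rewrite nth_word.
Qed.

Lemma matches_pred beta w : exists f, matches beta w f.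
Proof.
exists (fun i : 'I_vcount =>
  `[< exists2 r, r < q & i = input_vertex beta r :> nat /\ nth false w r >]).
move=> ltb r ltr; have ltv : input_vertex beta r < vcount.
  exact: (vertex_lt _ side_gt0 (side_gt x T ltb ltr)).
rewrite -[input_vertex beta r]/(val (Ordinal ltv)) extendE /=.
apply/asboolP/idP => [[r' ltr' [e hw]]|hw]; last by exists r.
have [_ e2 _] := vertex_inj (side_gt x T ltb ltr) (side_gt x T ltb ltr') e.
by have -> : r = r' by lia.
Qed.

(** The last colouring [f] codes the last word together with the tableau. Clauses look at the outer
    blocks only at input vertices, so colourings that match the words there may be arbitrary
    elsewhere. *)
Lemma cook_levin (ws : seq (q.-tuple bool)) (fs : seq (pred 'I_vcount)) :
  size ws = last -> related matches 0 ws fs ->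
  (exists f, bad (brel instance) (enum 'I_vcount) (rcons fs f)) <->
  (exists w, accepts (run T (init M (join_words x (map val (rcons ws w))))) = acc).
Proof.
move=> szw hrel; have szf : size fs = last by rewrite -(related_size hrel).
have szr w : size (map val (rcons ws w)) = nb.
  by rewrite size_map size_rcons szw prednK.
have szu w u : u \in map val (rcons ws w) -> size u = q.
  by case/mapP => v _ ->; rewrite size_tuple.
have car f w : matches last w f -> carries nb x q T
    (fun beta r => nth false (nth [::] (map val (rcons ws w)) beta) r) (vals (rcons fs f)).
  move=> hm beta r ltb ltr; rewrite /vals.
  rewrite (nth_map w) ?size_rcons ?szw ?prednK // !nth_rcons szw szf.
  case: ltnP => [lt|ge].
    have := related_nth w xpred0 hrel (b := beta); rewrite szw => /(_ lt); exact.
  have -> : beta = last by lia.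
  by rewrite eqxx; apply: hm => //; lia.
split=> [[f hf]|[w hw]].
  have [w hm] := matches_word last f; exists w.
  exact: (satisfied_accepts nb_gt0 (szr w) (szu w) (car f w hm) (iffLR (bad_satisfied _) hf)).
have [g hm] := matches_pred last w.
have sat := accepts_satisfied nb_gt0 (szr w) (szu w) (car g w hm) hw.
set v := tableau _ _ _ _ _ in sat.
exists (fun i : 'I_vcount =>
  `[< exists t p z, [/\ t < side, p < side, i = vertex t p z :> nat & v last t p z] >]).
apply/bad_satisfied => t p z ltt ltp.
have [b [s [t' [p' [z' [ltb ltt' ltp' hl hs]]]]]] := sat t p z ltt ltp.
exists b, s, t', p', z'; split=> //; rewrite -hs /vals nth_rcons szf.
case: ltnP => [lt|ge].
  have ne : b != last by lia.
  by rewrite /v /tableau ne orbT /vals nth_rcons szf lt.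
have -> : b = last by lia.
rewrite eqxx -[vertex _ _ _]/(val (Ordinal (vertex_lt z' ltt' ltp'))) extendE /=.
apply/asboolP/idP => [[t1 [p1 [z1 [lt1 lp1 e hv]]]]|hv].
  by have [-> -> ->] := vertex_inj ltp' lp1 e.
by exists t', p', z'.
Qed.

End Structure.

(** * The reduction as a bounded formula *)

Definition pterm (p : {poly nat}) (t : dterm) : dterm :=
  foldr (fun a r => TAdd (TMul r t) (TConst a)) (TConst 0) p.

Lemma and_cong (A A' B B' : Prop) : (A <-> A') -> (B <-> B') -> (A /\ B) <-> (A' /\ B').
Proof. by move=> -> ->. Qed.
Lemma or_cong (A A' B B' : Prop) : (A <-> A') -> (B <-> B') -> (A \/ B) <-> (A' \/ B').
Proof. by move=> -> ->. Qed.
Lemma not_cong (A A' : Prop) : (A <-> A') -> (~ A) <-> (~ A').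
Proof. by move=> ->. Qed.
Lemma ex_cong (T : Type) (P P' : T -> Prop) : (forall y, P y <-> P' y) ->
  (exists y, P y) <-> (exists y, P' y).
Proof. by move=> h; split=> -[y /h]; exists y. Qed.
Lemma ex2_cong (T : Type) (P Q Q' : T -> Prop) : (forall y, P y -> Q y <-> Q' y) ->
  (exists2 y, P y & Q y) <-> (exists2 y, P y & Q' y).
Proof. by move=> h; split=> -[y py /h]; exists y => //; firstorder. Qed.

Ltac psem_cong := repeat first
  [ apply: and_cong | apply: or_cong | apply: not_cong | apply: ex_cong => ?
  | apply: ex2_cong => ? ? ].

Lemma dval_pterm n e p t : dval n e (pterm p t) = pev p (dval n e t).
Proof.
rewrite /pterm /pev /poly.horner; case: p => s /= _.
by elim: s => //= a s ->.
Qed.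

Lemma twf_pterm d p t : twf d t -> twf d (pterm p t).
Proof. by move=> h; rewrite /pterm; elim: (polyseq p) => //= a s ->; rewrite h. Qed.

Section Abbreviations.
Variable A : Type.
Definition pconst (b : bool) : pform A := PEq (TConst 0) (TConst (~~ b)).
Definition plt d a b : pform A := PEx b (PEq a (TVar d)).
Definition plet d t (f : pform A) : pform A :=
  PEx (TAdd (TConst 1) t) (PAnd (PEq (TVar d) t) f).

Lemma dval_upd n d e y a : twf d a -> dval n (upd e d y) a = dval n e a.
Proof. by move=> wf; apply: eq_dval wf _ => i lt; rewrite upd_ne //; lia. Qed.

Lemma psem_pconst w d e b : psem w d e (pconst b) <-> b.
Proof. by case: b; split. Qed.

Lemma psem_pconst_eq w d e (T : eqType) (y z : T) : psem w d e (pconst (y == z)) <-> y = z.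
Proof. by rewrite psem_pconst; split=> /eqP. Qed.

Lemma psem_plt w d e a b : twf d a ->
  psem w d e (plt d a b) <-> dval (size w) e a < dval (size w) e b.
Proof.
move=> wf; split=> [[y lt]|lt] /=; first by rewrite dval_upd // upd_eq => ->.
by exists (dval (size w) e a) => //; rewrite /= dval_upd // upd_eq.
Qed.

Lemma psem_plet w d e t f : twf d t ->
  psem w d e (plet d t f) <-> psem w d.+1 (upd e d (dval (size w) e t)) f.
Proof.
move=> wf; split=> [[y _ []]|h] /=; first by rewrite dval_upd // upd_eq => <-.
exists (dval (size w) e t); first by rewrite /= add1n.
by rewrite /= dval_upd // upd_eq.
Qed.

Lemma pwf_plet d t f : twf d t -> pwf d.+1 f -> pwf d (plet d t f).
Proof.
move=> wf h; do !split=> //=; rewrite ltnSn /=.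
by elim: t wf => //= [i /ltnW //|a IHa b IHb|a IHa b IHb] /andP[/IHa-> /IHb->].
Qed.

End Abbreviations.
Arguments pconst {A} b.
Arguments plt {A} d a b.

Section Reduction.
Variables (M : TM (option bool)) (acc : bool) (nb : nat) (p q : {poly nat}).
Hypothesis nb_gt0 : 0 < nb.
Local Notation V := TVar.
Local Notation C := TConst.
Local Notation "a +t b" := (TAdd a b) (at level 50, left associativity).
Local Notation "a *t b" := (TMul a b) (at level 40, left associativity).
Local Notation zeta := #|triple M|.

(* Variables of the formulas below: 0 is the output position, 1 to 4 are the
   length [q] of the words, the running time, the side of the tableau and the
   number of vertices; 5 and 6 are two vertices with coordinates 7, 8 and 9, 10. *)
Definition toff := C 2 *t V 2 +t C 1.
Definition tjlen := TLen +t C nb *t (C 1 +t V 1).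

Definition fheadok (s : tsym M) : pform bool :=
  POr (PAnd (pconst (s.2 == Some (start M))) (PEq (V 8) toff))
      (PAnd (pconst (s.2 == None)) (PNot (PEq (V 8) toff))).

(** Successors are written [1 + _], which is convertible to the successor in the clause being
    rendered; in particular [a < 1 + b] renders [a <= b]. *)
Definition ffixb (s : tsym M) : pform bool :=
  PAnd (fheadok s)
  (POr (PAnd (plt 11 (V 8) toff) (pconst (s.1 == None)))
  (POr (PAnd (plt 11 (toff +t tjlen) (C 1 +t V 8)) (pconst (s.1 == None)))
  (POr (PSome (fun v : bool => PAnd (pconst (s.1 == Some (inl (Some v))))
         (PEx TLen (PAnd (PEq (V 8) (toff +t V 11)) (PLet v (V 11))))))
       (PSome (fun beta : 'I_nb => PAnd (pconst (s.1 == Some (inl None)))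
         (PEq (V 8) (toff +t TLen +t C beta *t (C 1 +t V 1)))))))).

Definition fvarb (beta : nat) (v : bool) (s : tsym M) : pform bool :=
  PAnd (fheadok s) (PAnd (pconst (s.1 == Some (inl (Some v))))
    (PEx (V 1) (PEq (V 8) (toff +t TLen +t C beta *t (C 1 +t V 1) +t (C 1 +t V 11))))).

Definition fposv (z z' : triple M) : pform bool :=
  let: (a, b, c) := z in
  POr (PAnd (PNot (PEq (V 7) (C 0)))
        (PAnd (PAnd (plt 11 (C 0) (V 8)) (plt 11 (C 1 +t V 8) (V 3)))
        (PAnd (plt 11 (V 7) (C 1 +t V 2)) (PAnd (PEq (V 9) (C 1 +t V 7))
        (PAnd (PEq (V 10) (V 8)) (pconst (z' == diag (local_rule a b c))))))))
 (POr (PAnd (PNot (PEq (V 7) (C 0)))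
        (PAnd (POr (PNot (PAnd (plt 11 (C 0) (V 8)) (plt 11 (C 1 +t V 8) (V 3))))
                 (PAnd (plt 11 (V 2) (V 7)) (pconst (~~ wrong acc b))))
        (PAnd (PEq (V 9) (V 7)) (PAnd (PEq (V 10) (V 8)) (pconst (z' == diag b))))))
      (PAnd (PEq (V 7) (C 0)) (PAnd (PEq (V 9) (C 1))
        (PAnd (PEq (V 10) (V 8)) (pconst (z' == diag b)))))).

Definition fnegv (z z' : triple M) : pform bool :=
  let: (a, b, c) := z in
  POr (PAnd (PNot (PEq (V 7) (C 0))) (PAnd (PEq (V 9) (V 7))
        (POr (PAnd (PEq (V 8) (C 1 +t V 10)) (pconst (z' == diag a)))
        (POr (PAnd (PEq (V 10) (V 8)) (pconst (z' == diag b)))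
             (PAnd (PEq (V 10) (C 1 +t V 8)) (pconst (z' == diag c)))))))
      (PAnd (PEq (V 7) (C 0))
        (PAnd (PNot (POr (ffixb b)
                 (PSome (fun beta : 'I_nb => PSome (fun v : bool => fvarb beta v b)))))
        (PAnd (PEq (V 9) (C 1)) (PAnd (PEq (V 10) (V 8)) (pconst (z' == diag b)))))).

Definition fguard (beta : nat) (s : bool) (z z' : triple M) : pform bool :=
  PAnd (PEq (V 7) (C 0)) (PAnd (PEq (V 9) (C 0)) (PAnd (PEq (V 10) (V 8))
    (PAnd (pconst (z' == z0 M)) (fvarb beta (~~ s) z.1.2)))).

Definition flit (beta : nat) (s : bool) (z z' : triple M) : pform bool :=
  POr (PAnd (pconst (beta == nb.-1)) (PAnd (pconst s) (fposv z z')))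
 (POr (PAnd (pconst (beta == nb.-1)) (PAnd (pconst (~~ s)) (fnegv z z')))
      (fguard beta s z z')).

Definition fvertex i t r (z : triple M) : pform bool :=
  PEq (V i) ((V t *t V 3 +t V r) *t C zeta +t C (enum_rank z)).

Definition fedge (beta : nat) (s : bool) : pform bool :=
  PEx (V 3) (PEx (V 3) (PEx (V 3) (PEx (V 3)
    (PSome (fun z : triple M => PSome (fun z' : triple M =>
      PAnd (fvertex 5 7 8 z) (PAnd (fvertex 6 9 10 z') (flit beta s z z')))))))).

Definition fpair (R : 'I_(nsym nb)) (f : pform bool) : pform bool :=
  PEx (V 4) (PEx (V 4) (PAnd (PEq (V 0) (tpos (V 4) (C R) (V 5) (V 6))) f)).

(** An output bit is 1 in the unary prefix and at the positions of related pairs. The separator, at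
    the position given by the number of vertices, falls under neither, since every [position] is
    larger. *)
Definition fbody : pform bool :=
  POr (plt 5 (V 0) (V 4))
 (POr (fpair (symE nb) (PNot (PEq (V 5) (V 6))))
 (POr (fpair (symS nb) (POr (PEq (V 6) (C 1 +t V 5))
                            (PAnd (PEq (C 1 +t V 5) (V 4)) (PEq (V 6) (C 0)))))
      (PSome (fun beta : 'I_nb => PSome (fun s : bool =>
         fpair (symL nb beta s) (fedge beta s)))))).

Definition tside T L := C 4 *t T +t L +t C 4.
Definition torder S := S *t S *t C zeta.
Definition freduction : pform bool :=
  plet 1 (pterm q TLen) (plet 2 (pterm p tjlen)
    (plet 3 (tside (V 2) tjlen) (plet 4 (torder (V 3)) fbody))).

Definition tlength : dterm :=
  let L := TLen +t C nb *t (C 1 +t pterm q TLen) in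
  let N := torder (tside (pterm p L) L) in
  N +t C 1 +t C (nsym nb) *t N *t N.

Section Input.
Variable x : seq bool.
Definition wlen := pev q (size x).
Definition rtime := pev p (jlen nb x wlen).
Local Notation side := (width nb x wlen rtime).
Local Notation inst := (@instance M acc nb x wlen rtime).
Local Notation N := (vcount M nb x wlen rtime).

Section Literals.
Variables (e : nat -> nat) (t r t' r' : nat).
Hypotheses (e1 : e 1 = wlen) (e2 : e 2 = rtime) (e3 : e 3 = side)
  (e7 : e 7 = t) (e8 : e 8 = r) (e9 : e 9 = t') (e10 : e 10 = r').

Ltac leaves := first
  [ exact: psem_pconst_eq | exact: psem_pconst
  | by rewrite psem_plt //= ?e1 ?e2 ?e3 ?e7 ?e8
  | by rewrite /= /upd /= ?e1 ?e2 ?e7 ?e8 ?e9 ?e10 ].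

Lemma psem_fheadok s : psem x 11 e (fheadok s) <-> headok rtime r s.
Proof. by rewrite /fheadok /headok; cbn [psem]; psem_cong; leaves. Qed.

Lemma psem_ffixb s : psem x 11 e (ffixb s) <-> fixb nb x wlen rtime r s.
Proof.
rewrite /ffixb /fixb; cbn [psem]; rewrite psem_fheadok; psem_cong; leaves.
Qed.

Lemma psem_fvarb beta v s : psem x 11 e (fvarb beta v s) <->
  varb x wlen rtime beta v r s.
Proof.
have eV1 : dval (size x) e (V 1) = wlen by [].
rewrite /fvarb /varb; cbn [psem]; rewrite psem_fheadok eV1.
by psem_cong; leaves.
Qed.

Lemma psem_fposv z z' : psem x 11 e (fposv z z') <->
  posv acc nb x wlen rtime t r z t' r' z'.
Proof.
case: z => [[a b] c]; rewrite /fposv /posv; cbn [psem].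
by psem_cong; leaves.
Qed.

Lemma psem_fnegv z z' : psem x 11 e (fnegv z z') <->
  negv nb x wlen rtime t r z t' r' z'.
Proof.
case: z => [[a b] c]; rewrite /fnegv /negv; cbn [psem].
by rewrite psem_ffixb; psem_cong; first [exact: psem_fvarb | leaves].
Qed.

Lemma psem_fguard beta s z z' : psem x 11 e (fguard beta s z z') <->
  guard x wlen rtime beta s t r z t' r' z'.
Proof.
by rewrite /fguard /guard; cbn [psem]; rewrite psem_fvarb; psem_cong; leaves.
Qed.

Lemma psem_flit beta s z z' : psem x 11 e (flit beta s z z') <->
  lit acc nb x wlen rtime beta s t r z t' r' z'.
Proof.
rewrite /flit /lit; cbn [psem].
by rewrite psem_fposv psem_fnegv psem_fguard; psem_cong; leaves.
Qed.

End Literals.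

Lemma psem_fedge e i j beta s :
  e 1 = wlen -> e 2 = rtime -> e 3 = side -> e 5 = i -> e 6 = j ->
  psem x 7 e (fedge beta s) <-> edge M acc nb x wlen rtime beta s i j.
Proof.
move=> e1 e2 e3 <- <-; rewrite /fedge /edge -e3; cbn [psem].
apply: ex2_cong => t ltt; apply: ex2_cong => r ltr.
apply: ex2_cong => t' ltt'; apply: ex2_cong => r' ltr'.
apply: ex_cong => z; apply: ex_cong => z'.
apply: and_cong; first by rewrite /fvertex /vertex /= /upd /= e3.
apply: and_cong; first by rewrite /fvertex /vertex /= /upd /= e3.
exact: psem_flit.
Qed.

Definition env0 i := upd (upd (upd (upd (upd (fun=> 0) 0 i) 1 wlen) 2 rtime) 3 side) 4 N.

Lemma psem_fpair k (R : 'I_(nsym nb)) f (P : nat -> nat -> Prop) :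
  (forall i j, psem x 7 (upd (upd (env0 k) 5 i) 6 j) f <-> P i j) ->
  psem x 5 (env0 k) (fpair R f) <->
  exists i j : 'I_N, k = position N R i j /\ P i j.
Proof.
move=> h; rewrite /fpair; cbn [psem]; split.
  move=> [i lti [j ltj [e /h hP]]].
  by exists (Ordinal lti), (Ordinal ltj).
move=> [i [j [e hP]]]; exists i; first exact: ltn_ord.
by exists j; [exact: ltn_ord | split=> //; apply/h].
Qed.

Lemma psem_fbody k : k < N + 1 + nsym nb * N * N ->
  psem x 5 (env0 k) fbody <-> nth false (encode inst) k.
Proof.
move=> ltk; have [h1 h2 h3] := encode_is_encoding inst.
rewrite /fbody; cbn [psem]; rewrite psem_plt //.
rewrite (@psem_fpair k (symE nb) _ (fun i j => i <> j)) //.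
rewrite (@psem_fpair k (symS nb) _ (fun i j => j = i.+1 \/ (i.+1 = N /\ j = 0))) //.
have eL : (exists (i : 'I_nb) (i0 : bool),
   psem x 5 (env0 k) (fpair (symL nb i i0) (fedge i i0))) <->
  exists (beta : 'I_nb) s (i j : 'I_N), k = position N (symL nb beta s) i j /\
    edge M acc nb x wlen rtime beta s i j.
  split=> -[beta [s h]]; exists beta, s; move: h;
    rewrite (@psem_fpair k _ _ (edge M acc nb x wlen rtime beta s)) // => i j;
    exact: psem_fedge.
rewrite eL {eL}.
have rel (R : 'I_(nsym nb)) (i j : 'I_N) : k = position N R i j ->
    (nth false (encode inst) k <-> rels M acc x wlen rtime R i j).
  by move=> ->; rewrite nth_encode brel_instance; split=> /asboolP.
split.
  case=> [lt|[|[|]]].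
  - by rewrite h3.
  - by case=> i [j [e h]]; apply/(rel _ _ _ e); left.
  - by case=> i [j [e h]]; apply/(rel _ _ _ e); right; left.
  - by case=> beta [s [i [j [e h]]]]; apply/(rel _ _ _ e); right; right; exists beta, s.
move=> hk; have [lt|gt|e] := ltngtP k N; first by left.
  have [R [i [j e]]] := position_surj gt ltk.
  have /(rel _ _ _ e) := hk; case=> [[eR h]|[[eR h]|[beta [s [eR h]]]]]; rewrite eR in e; right.
  - by left; exists i, j.
  - by right; left; exists i, j.
  - by right; right; exists beta, s, i, j.
by move: hk; rewrite e (set_nth_default true) ?h2 // h1; lia.
Qed.

End Input.

Lemma freduction_wf : pwf 1 freduction.
Proof.
rewrite /freduction; apply: pwf_plet; first exact: twf_pterm.
apply: pwf_plet; first exact: twf_pterm.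
apply: pwf_plet => //; apply: pwf_plet => //.
have hh s : pwf 11 (fheadok s) by do !split.
have hf s : pwf 11 (ffixb s) by do !split=> //; apply: hh.
have hv beta v s : pwf 11 (fvarb beta v s) by do !split=> //; apply: hh.
have hp z z' : pwf 11 (fposv z z') by case: z => [[a b] c]; do !split.
have hn z z' : pwf 11 (fnegv z z').
  by case: z => [[a b] c]; do !split.
by do !split=> //; first [apply: hp | apply: hn | apply: hh].
Qed.

Lemma reduction_computable : polytime_computable
  (fun x => encode (@instance M acc nb x (wlen x) (rtime x))).
Proof.
apply: (@pform_computable _ tlength freduction).
- by rewrite /= !twf_pterm //= twf_pterm.
- exact: freduction_wf.
- move=> x; rewrite size_encode /= !dval_pterm /= !dval_pterm /=.
  by [].
- move=> x i; rewrite size_encode => lt.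
  rewrite -psem_fbody // /freduction psem_plet ?twf_pterm //.
  rewrite psem_plet ?twf_pterm // psem_plet // psem_plet //.
  by rewrite /env0 /= !dval_pterm.
Qed.

End Reduction.

(** * Hardness *)

Local Notation target M acc nb p q x :=
  (@instance M acc nb x (wlen q x) (rtime nb p q x)).
Local Notation vertices M nb p q x :=
  (enum 'I_(vcount M nb x (wlen q x) (rtime nb p q x))).

Section Hardness.
Variables (M : TM (option bool)) (acc : bool) (nb : nat) (p q : {poly nat}).
Hypothesis nb_gt0 : 0 < nb.
Variable V : language (option bool).
Hypothesis deciding : forall y, let c := run p.[size y]%R (init M y) in
  halted c /\ (V y <-> accepts c).
Variable x : seq bool.
Local Notation inst := (target M acc nb p q x).
Local Notation vars := (pred 'I_(vcount M nb x (wlen q x) (rtime nb p q x))).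

Lemma cook_levin_language (ws : seq ((wlen q x).-tuple bool)) (fs : seq vars) :
  size ws = nb.-1 -> related (@matches M nb x (wlen q x) (rtime nb p q x)) 0 ws fs ->
  (exists f, bad (brel inst) (vertices M nb p q x) (rcons fs f)) <->
  exists w, if acc then V (join_words x (map val (rcons ws w)))
            else ~ V (join_words x (map val (rcons ws w))).
Proof.
move=> szw hrel; rewrite (cook_levin acc nb_gt0 szw hrel); apply: ex_cong => w.
set y := join_words _ _; have [_ hV] := deciding y.
have ep : p.[size y]%R = rtime nb p q x.
  congr (_.[_])%R; apply: size_join.
    by rewrite size_map size_rcons szw prednK.
  by move=> _ /mapP[u _ ->]; rewrite size_tuple.
rewrite ep in hV.
by case: acc; rewrite hV; case: (accepts _); split=> // /(_ isT).
Qed.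

(** A forbidden set of the instance is closed under S and hence contains all vertices, so this is
    the only set to be avoided. *)
Lemma instance_homomorphic hid :
  homomorphic inst (template nb hid) <->
  exists u, ~ forbidden hid (brel inst) u (vertices M nb p q x).
Proof.
rewrite template_homomorphic; split=> [[_ [u h]]|[u h]]; first by exists u; apply: h.
split; first by move=> i; rewrite brel_symE eqxx.
exists u => K hK; apply: h; have [us /bad_full eK] := forbidden_bad hK.
move: hK; rewrite /forbidden; apply: (alt_related (R := fun _ u v => u = v) (i := 0)).
- by move=> _ v _; exists v.
- by move=> _ v _; exists v.
move=> vs vs' _ hr; have -> : vs = vs'.
  by elim: vs vs' 0 hr => [|v vs IH] [|v' vs'] i //= [-> /IH->].
exact: (bad_congr (eK nb_gt0) (fun _ _ _ => erefl)).
Qed.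

End Hardness.

(** The innermost block of the given formula is universal. Its negation is existential, as a tableau
    requires, so the tableau describes rejecting runs: [acc] is [false]. *)
Theorem template_Sigma_hard n L : SigmaP (2 * n).+2 L ->
  reduces_to L (CSP (template (2 * n).+2 true)).
Proof.
set nb := (2 * n).+2; case=> V [q [[M [p hM]] hL]].
exists (fun x => encode (target M false nb p q x)); split.
  exact: reduction_computable.
move=> x; rewrite hL CSP_encode instance_homomorphic // alternateE.
have par : true (+) odd (2 * n).+1 = false by rewrite /= mul2n odd_double.
rewrite [X in X <-> _]alt_last par.
rewrite (@alt_related_iff _ _ (@matches M nb x (wlen q x) (rtime nb p q x)) true (2 * n).+1 _
  (fun fs => forall f,
     ~ bad (brel (target M false nb p q x)) (vertices M nb p q x) (rcons fs f))); first last.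
- move=> ws fs szw hrel; have h := @cook_levin_language M false nb p q isT V hM x ws fs szw hrel.
  split=> [hw f hf|hf w].
    by have [w hn] := iffLR h (ex_intro _ f hf); apply: hn; apply: hw.
  by apply: contrapT => hn; have [f /hf] := iffRL h (ex_intro _ w hn).
- by move=> j f; apply: matches_word.
- by move=> j w; apply: matches_pred.
have := @alt_last _ true (2 * n).+1
  (fun fs => ~ bad (brel (target M false nb p q x)) (vertices M nb p q x) fs).
rewrite par => <-.
apply: ex_cong => u; rewrite /forbidden (_ : nb - true = (2 * n).+1) ?subn1 //.
by rewrite alt_not.
Qed.

(** The complement of [L] is given by an odd number of blocks starting and ending existentially, so
    accepting runs fit the tableau directly: [acc] is [true]. *)
Theorem template_Pi_hard n L : PiP (2 * n).+1 L ->
  reduces_to L (CSP (template (2 * n).+1 false)).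
Proof.
set nb := (2 * n).+1; case=> V [q [[M [p hM]] hL]].
exists (fun x => encode (target M true nb p q x)); split.
  exact: reduction_computable.
move=> x; have {}hL := hL x.
suff h : alternate true nb (q.[size x])%R (fun us => V (join_words x us)) <->
   ~ exists u, ~ forbidden false
      (brel (target M true nb p q x)) u (vertices M nb p q x).
  rewrite CSP_encode instance_homomorphic //; split=> hx.
    by apply: contrapT => /h/hL.
  by apply: contrapT => /hL/h.
have -> : (~ exists u, ~ forbidden false
      (brel (target M true nb p q x)) u (vertices M nb p q x)) <->
   alt true nb (bad (brel (target M true nb p q x)) (vertices M nb p q x)).
  split=> [h|h [u]]; last by apply; rewrite /forbidden subn0.
  apply: contrapT => hn; apply: h; exists xpred0 => hf; apply: hn.
  by move: hf; rewrite /forbidden subn0.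
have par : true (+) odd (2 * n) = true by rewrite mul2n odd_double.
rewrite alternateE [X in X <-> _]alt_last [X in _ <-> X]alt_last par.
apply: (@alt_related_iff _ _ (@matches M nb x (wlen q x) (rtime nb p q x))).
- by move=> j w; apply: matches_pred.
- by move=> j f; apply: matches_word.
move=> ws fs szw hrel; have h := @cook_levin_language M true nb p q isT V hM x ws fs szw hrel.
exact: iff_sym.
Qed.

Local Open Scope classical_set_scope.

Theorem theorem1p4 (n : nat) (n_ge1 : 1 <= n) :
  (exists (sg : signature) (D : Type) (I : structure sg D),
     [/\ countable [set: D], omega_categorical I
       & complete (SigmaP (2 * n)) (CSP I)]) /\
  (exists (sg : signature) (D : Type) (I : structure sg D),
     [/\ countable [set: D], omega_categorical I
       & complete (PiP (2 * n + 1)) (CSP I)]).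
Proof.
split.
  (* [1 <= n] provides two blocks, the hidden one and the one whose word also carries [K]. *)
  case: n n_ge1 => // n _; rewrite mulnS add2n.
  exists (binsig (nsym (2 * n).+2)), (limit (symE (2 * n).+2) (forbidden true)),
    (template (2 * n).+2 true).
  split; [exact: template_countable | exact: template_omega_categorical |].
  by split; [exact: template_SigmaP | exact: template_Sigma_hard].
rewrite addn1.
exists (binsig (nsym (2 * n).+1)), (limit (symE (2 * n).+1) (forbidden false)),
  (template (2 * n).+1 false).
split; [exact: template_countable | exact: template_omega_categorical |].
by split; [exact: template_PiP | exact: template_Pi_hard].
Qed.
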